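(* Let $(\mathfrak{M},\Phi,\varphi)$ be a W*-dynamical system. If there is a unital completely positive map $\Psi:\mathfrak{M}\to\mathfrak{M}$ such that $\Phi(\Psi(a))=a$ for all $a\in\mathfrak{M}$, then $(\mathfrak{M},\Phi,\varphi)$ admits a minimal reversible dilation.
   Context: A W*-dynamical system is a triple $(\mathfrak{M},\Phi,\varphi)$ with $\mathfrak{M}$ a von Neumann algebra, $\Phi:\mathfrak{M}\to\mathfrak{M}$ a normal unital completely positive map (ucp-map) and $\varphi$ a normal faithful state on $\mathfrak{M}$ with $\varphi\circ\Phi=\varphi$. Homomorphisms are unital and *-preserving. A reversible dilation of $(\mathfrak{M},\Phi,\varphi)$ is a W*-dynamical system $(\widehat{\mathfrak{M}},\widehat\Phi,\widehat\varphi)$ with $\widehat\Phi$ an automorphism, together with a normal ucp-map $\mathcal{E}:\widehat{\mathfrak{M}}\to\mathfrak{M}$ and a normal injective homomorphism $i:\mathfrak{M}\to\widehat{\mathfrak{M}}$, such that for all $a\in\mathfrak{M}$, $X\in\widehat{\mathfrak{M}}$ and natural numbers $n$: $\mathcal{E}(i(a)X)=a\mathcal{E}(X)$, $\mathcal{E}(\widehat\Phi^n(i(a)))=\Phi^n(a)$ and $\widehat\varphi(X)=\varphi(\mathcal{E}(X))$. It is minimal if $\widehat{\mathfrak{M}}$ is the von Neumann algebra generated by $\bigcup_{k\in\mathbb{Z}}\{\widehat\Phi^k(i(a)):a\in\mathfrak{M}\}$. *)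

(* Defs.v *)
From HB Require Import structures.
From mathcomp Require Import all_boot all_order all_algebra.
From mathcomp Require Import complex.
From mathcomp Require Import all_classical all_reals all_analysis.

Set Implicit Arguments.
Unset Strict Implicit.
Unset Printing Implicit Defensive.

Import Order.TTheory GRing.Theory Num.Theory.
Import numFieldNormedType.Exports.

Local Open Scope classical_set_scope.
Local Open Scope ring_scope.

(* The inner product is linear in its first argument and conjugate-linear in
   the second. *)
Record hilbertType (R : realType) := HilbertType {
  hspace :> completeNormedModType R[i];
  ip : {dot hspace for @Num.conj R[i]};
  ip_normE : forall x : hspace, `|x| ^+ 2 = ip x x }.

Arguments ip {R h}.

(* Operators on H are plain functions H -> H, with the pointwise linear
   structure, composition as product and idfun as unit.  A map defined on a
   von Neumann algebra M of such operators is a total function of which only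
   the restriction to M is ever constrained. *)

Section Operators.
Context {R : realType} {H : hilbertType R}.
Implicit Types (a b : H -> H) (M S : set (H -> H)).

Definition bounded_op a := linear a /\ continuous a.

Definition adjoint a b := forall x y : H, ip (a x) y = ip x (b y).

(* 0 <= z in R[i] means that z is real and nonnegative. *)
Definition positive_op a := forall x : H, 0 <= ip (a x) x.

Definition op_le a b := positive_op (b - a).

(* Positivity of an n x n matrix of operators, as an operator on H^n. *)
Definition positive_opmx n (A : 'M[H -> H]_n) :=
  forall x : 'I_n -> H, 0 <= \sum_i \sum_j ip (A i j (x j)) (x i).

Definition commutant S : set (H -> H) :=
  [set b | bounded_op b /\ forall a, S a -> a \o b = b \o a].

(* The bicommutant condition entails that M is a unital algebra of bounded
   operators. *)
Definition von_neumann M :=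
  (forall a, M a -> exists2 b, M b & adjoint a b) /\
  commutant (commutant M) = M.

(* By definition of smallest, the intersection of all the von Neumann algebras
   on H that contain S. *)
Definition vn_generated S : set (H -> H) := smallest von_neumann S.

Definition self_adjoint_part M : set (H -> H) := [set a | M a /\ adjoint a a].

End Operators.

Section Normality.
Context {T U : Type}.

Definition is_lub {X : Type} (A : set X) (le : X -> X -> Prop) (D : set X)
    (s : X) :=
  [/\ A s, forall d, D d -> le d s
    & forall u, A u -> (forall d, D d -> le d u) -> le s u].

Definition up_directed (le : T -> T -> Prop) (D : set T) :=
  D !=set0 /\
  forall c d, D c -> D d -> exists e, [/\ D e, le c e & le d e].

(* f preserves the suprema of bounded increasing nets of A; as a bounded
   increasing net of self-adjoint elements of a von Neumann algebra always has
   a supremum, the nets that have one are exactly the bounded ones. *)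
Definition preserves_directed_lub (A : set T) (leT : T -> T -> Prop)
    (B : set U) (leU : U -> U -> Prop) (f : T -> U) :=
  forall D s, D `<=` A -> up_directed leT D ->
    is_lub A leT D s -> is_lub B leU (f @` D) (f s).

End Normality.

Section Maps.
Context {R : realType} {H K : hilbertType R}.
Implicit Types (M : set (H -> H)) (N : set (K -> K)).
Implicit Types (f : (H -> H) -> (K -> K)) (phi : (H -> H) -> R[i]).

Definition linear_on {V : lmodType R[i]} M (f : (H -> H) -> V) :=
  forall (c : R[i]) a b, M a -> M b -> f (c *: a + b) = c *: f a + f b.

Definition completely_positive M f :=
  forall n (A : 'M[H -> H]_n), (forall i j, M (A i j)) ->
    positive_opmx A -> positive_opmx (\matrix_(i, j) f (A i j)).

Record ucp_map M N f : Prop := {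
  ucp_fun : set_fun M N f;
  ucp_linear : linear_on M f;
  ucp_unital : f idfun = idfun;
  ucp_cp : completely_positive M f }.

Definition normal_map M N f :=
  preserves_directed_lub (self_adjoint_part M) op_le
    (self_adjoint_part N) op_le f.

Record star_homomorphism M N f : Prop := {
  hom_fun : set_fun M N f;
  hom_linear : linear_on M f;
  hom_mul : forall a b, M a -> M b -> f (a \o b) = f a \o f b;
  hom_unital : f idfun = idfun;
  hom_star : forall a b, M a -> M b -> adjoint a b -> adjoint (f a) (f b) }.

Record normal_faithful_state M phi : Prop := {
  state_linear : linear_on M (phi : (H -> H) -> R[i]^o);
  state_positive : forall a, M a -> positive_op a -> 0 <= phi a;
  state_unital : phi idfun = 1;
  state_normal : preserves_directed_lub (self_adjoint_part M) op_le
    [set z | z \is Num.real] (fun z w : R[i] => z <= w) phi;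
  state_faithful : forall a, M a -> positive_op a -> phi a = 0 -> a = 0 }.

End Maps.

Section Systems.
Context {R : realType}.

Record w_star_system (H : hilbertType R) (M : set (H -> H))
    (Phi : (H -> H) -> (H -> H)) (phi : (H -> H) -> R[i]) : Prop := {
  sys_algebra : von_neumann M;
  sys_ucp : ucp_map M M Phi;
  sys_normal : normal_map M M Phi;
  sys_state : normal_faithful_state M phi;
  sys_invariant : forall a, M a -> phi (Phi a) = phi a }.

Definition automorphism (H : hilbertType R) (M : set (H -> H))
    (Phi : (H -> H) -> (H -> H)) :=
  star_homomorphism M M Phi /\ set_bij M M Phi.

Record reversible_dilation
    (H : hilbertType R) (M : set (H -> H))
    (Phi : (H -> H) -> (H -> H)) (phi : (H -> H) -> R[i])
    (K : hilbertType R) (N : set (K -> K))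
    (Theta : (K -> K) -> (K -> K)) (psi : (K -> K) -> R[i])
    (E : (K -> K) -> (H -> H)) (i : (H -> H) -> (K -> K)) : Prop := {
  dil_system : w_star_system N Theta psi;
  dil_automorphism : automorphism N Theta;
  dil_E_ucp : ucp_map N M E;
  dil_E_normal : normal_map N M E;
  dil_i_hom : star_homomorphism M N i;
  dil_i_normal : normal_map M N i;
  dil_i_inj : set_inj M i;
  dil_module : forall a X, M a -> N X -> E (i a \o X) = a \o E X;
  dil_iter : forall a n, M a -> E (iter n Theta (i a)) = iter n Phi a;
  dil_state : forall X, N X -> psi X = phi (E X) }.

(* Theta^k for k : int, where Theta is a bijection of N onto itself; the
   inverse 'pinv_ takes a default value outside N. *)
Definition iterz (K : hilbertType R) (N : set (K -> K))
    (Theta : (K -> K) -> (K -> K)) (k : int) : (K -> K) -> (K -> K) :=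
  match k with
  | Posz n => iter n Theta
  | Negz n => iter n.+1 ('pinv_(fun=> idfun) N Theta)
  end.

Definition minimal_dilation (H : hilbertType R) (M : set (H -> H))
    (K : hilbertType R) (N : set (K -> K))
    (Theta : (K -> K) -> (K -> K)) (i : (H -> H) -> (K -> K)) :=
  N = vn_generated (\bigcup_(k in [set: int]) [set iterz N Theta k (i a) | a in M]).

Definition admits_minimal_reversible_dilation (H : hilbertType R)
    (M : set (H -> H)) (Phi : (H -> H) -> (H -> H))
    (phi : (H -> H) -> R[i]) :=
  exists (K : hilbertType R) (N : set (K -> K))
    (Theta : (K -> K) -> (K -> K)) (psi : (K -> K) -> R[i])
    (E : (K -> K) -> (H -> H)) (i : (H -> H) -> (K -> K)),
    reversible_dilation M Phi phi N Theta psi E i /\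
    minimal_dilation M N Theta i.

End Systems.

(* Main.v *)
(** Put [V = M] with the inner product [phi (b^* a)]. As [phi] is faithful and [Phi]
    is a left inverse of [Psi], the Kadison-Schwarz inequality makes [Psi] an injective
    *-endomorphism of [M], and [Phi (Psi a x) = a (Phi x)]; moreover [Psi] preserves
    [phi], hence induces an isometry of [V]. The Hilbert space [K] of the dilation is the
    completion of the inductive limit of [V -> V -> V -> ...] along this isometry: it is
    spanned by vectors [e n a] with [e (n+1) (Psi a) = e n a]. At level [n], [M] acts by
    left multiplication, [pi n a (e n b) = e n (a b)], and the shift
    [U (e n a) = e (n+1) a] is unitary with [U (pi n a) U^* = pi (n+1) a]. So
    [N = (union of the pi n M)''], [Theta X = U X U^*], [i = pi 0] and
    [psi X = <X vac, vac>] with [vac = e 0 1].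

    The expectation [E X] is the compression of [X] to the closure of [e 0 M]; one has to
    see that it is given by left multiplication by an element of [M], which is clear for
    [X = pi n a], namely [Phi^n a]. A self-adjoint [X] in [N] is approximated at given
    vectors by elements of the form [pi n c] with [|c| <= 1], after replacing [X] by
    [X (1 + X^2)^-1]; and a bounded sequence of [M] that converges rapidly in the norm of
    [phi] converges strongly, by a noncommutative Egorov theorem. Complete positivity of
    [E] reduces to positivity because [H] is built from cyclic subspaces, [psi] is
    faithful because its restrictions to all levels are, and a positive map between
    algebras with faithful normal states that intertwines the states is normal. *)

From HB Require Import structures.
Require Import Defs.
From mathcomp Require Import all_boot all_order all_algebra.
From mathcomp Require Import complex ring lra zify.
From mathcomp Require Import all_classical all_reals all_analysis.

Set Implicit Arguments.
Unset Strict Implicit.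
Unset Printing Implicit Defensive.

Import Order.TTheory GRing.Theory Num.Theory.
Import numFieldNormedType.Exports.

Local Open Scope classical_set_scope.
Local Open Scope ring_scope.

(** * Semi-inner products and Hilbert spaces *)

(** The obstacle is that [M] acts on a Hilbert space [H] unrelated to [phi]: the compression of an
    element of the dilated algebra is a priori only an operator on the closure of [e 0 M], and must
    be recognized as left multiplication by an operator on [H]. Every return to [H] uses [egorov]:
    positive elements x_k of [M] with bounded sums of phi(x_k) admit elements r_n of [M] such that
    the vectors r_n h approach h and every x_k is controlled at r_n h, uniformly in k. Applied to
    4^k |a_(k+1) - a_k|^2, this produces strong limits ([l2_complete]). Applied to q^-k y^(2k) with
    q > 1, it shows that an inequality y <= 1 seen through [phi] holds on [H] ([l2_order]), and the
    norm bounds and the positivity of the expectation follow from it. Approximation is only ever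
    required at finitely many vectors, so that no topology on operators has to be introduced. *)

Record psd_form (R : realType) (V : lmodType R[i]) (s : V -> V -> R[i]) : Prop := {
  formDl : forall x y z, s (x + y) z = s x z + s y z;
  formZl : forall c x y, s (c *: x) y = c * s x y;
  formC : forall x y, s x y = Num.conj (s y x);
  form_ge0 : forall x, 0 <= s x x }.

Section Form.
Context {R : realType} {V : lmodType R[i]} {s : V -> V -> R[i]}.
Hypothesis sP : psd_form s.
Implicit Types (x y z : V) (t : R) (c : R[i]).

(** Estimates are made on real parts and squared lengths, where they become polynomial inequalities;
    [formE] recovers the complex value from two real parts. *)
Definition rform (s : V -> V -> R[i]) x y : R := complex.Re (s x y).
Definition qform (s : V -> V -> R[i]) x : R := rform s x x.

Lemma formDr x y z : s x (y + z) = s x y + s x z.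
Proof. by rewrite formC // formDl // rmorphD /= -!formC. Qed.

Lemma formZr c x y : s x (c *: y) = Num.conj c * s x y.
Proof. by rewrite formC // formZl // rmorphM /= -formC. Qed.

Lemma formNl x y : s (- x) y = - s x y.
Proof. by rewrite -scaleN1r formZl // mulN1r. Qed.

Lemma formNr x y : s x (- y) = - s x y.
Proof. by rewrite -scaleN1r formZr rmorphN1 mulN1r. Qed.

Lemma formxx x : s x x = (qform s x)%:C%C.
Proof.
rewrite /qform /rform; have := form_ge0 sP x.
by case: (s x x) => a b; rewrite lecE /= => /andP[/eqP -> _].
Qed.

Lemma qform_ge0 x : 0 <= qform s x.
Proof. by have := form_ge0 sP x; rewrite formxx ler0c. Qed.

Lemma rformDl x y z : rform s (x + y) z = rform s x z + rform s y z.
Proof. by rewrite /rform formDl // raddfD. Qed.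

Lemma rformDr x y z : rform s x (y + z) = rform s x y + rform s x z.
Proof. by rewrite /rform formDr raddfD. Qed.

Lemma rformNl x y : rform s (- x) y = - rform s x y.
Proof. by rewrite /rform formNl raddfN. Qed.

Lemma rformNr x y : rform s x (- y) = - rform s x y.
Proof. by rewrite /rform formNr raddfN. Qed.

Lemma rformC x y : rform s x y = rform s y x.
Proof. by rewrite /rform formC //; case: (s y x). Qed.

Lemma rformZl t x y : rform s (t%:C%C *: x) y = t * rform s x y.
Proof. by rewrite /rform formZl //; case: (s x y) => a b /=; rewrite mul0r subr0. Qed.

Lemma formE x y : s x y = Complex (rform s x y) (rform s x ('i%C *: y)).
Proof.
rewrite /rform formZr; case: (s x y) => a b /=.
by rewrite mul0r sub0r mulN1r opprK.
Qed.

Lemma rformii x y : rform s ('i%C *: x) ('i%C *: y) = rform s x y.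
Proof.
rewrite /rform formZl // formZr; case: (s x y) => a b /=.
by congr (_); ring.
Qed.

Lemma rformi x y : rform s ('i%C *: x) y = - rform s x ('i%C *: y).
Proof.
rewrite /rform formZl // formZr; case: (s x y) => a b /=.
by congr (_); ring.
Qed.

Lemma qformD x y : qform s (x + y) = qform s x + 2 * rform s x y + qform s y.
Proof. by rewrite /qform rformDl !rformDr (rformC y x); ring. Qed.

Lemma qformB x y : qform s (x - y) = qform s x - 2 * rform s x y + qform s y.
Proof. by rewrite qformD rformNr /qform rformNl rformNr; ring. Qed.

Lemma qformZ c x : qform s (c *: x) = (complex.Re c ^+ 2 + complex.Im c ^+ 2) * qform s x.
Proof.
rewrite /qform /rform formZl // formZr formxx; case: c => a b /=.
by rewrite -/(rform s x x) -/(qform s x); ring.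
Qed.

Lemma qformZr t x : qform s (t%:C%C *: x) = t ^+ 2 * qform s x.
Proof. by rewrite qformZ /= expr0n addr0. Qed.

Lemma qformN x : qform s (- x) = qform s x.
Proof. by rewrite /qform rformNl rformNr opprK. Qed.

Lemma qform0 : qform s 0 = 0.
Proof. by have := qformZr 0 0; rewrite expr0n mul0r scaler0. Qed.

(** Evaluation at the minimum [- b / a]. Vanishing coefficients are allowed: with [c = 0] the
    conclusion forces [b = 0], which is how equality cases are exploited later. *)
Lemma quad_disc (a b c : R) :
  (forall t, 0 <= a * t ^+ 2 + 2 * b * t + c) -> 0 <= a -> b ^+ 2 <= a * c.
Proof.
move=> h a0; have [az|an0] := eqVneq a 0.
  rewrite az in h *; rewrite mul0r; have [->|bn0] := eqVneq b 0; first by rewrite expr0n.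
  (* The form is affine in [t] here, and this [t] gives it the value -1. *)
  have := h (- (c + 1) / (2 * b)); rewrite mul0r add0r.
  rewrite (_ : 2 * b * _ + c = - 1); last by field.
  by rewrite lerNr oppr0 ler10.
have ap : 0 < a by rewrite lt_def an0.
have := h (- b / a).
rewrite (_ : _ + c = (a * c - b ^+ 2) / a); last by field.
by rewrite pmulr_lge0 ?invr_gt0 // subr_ge0.
Qed.

Lemma rform_CS x y : rform s x y ^+ 2 <= qform s x * qform s y.
Proof.
apply: quad_disc (qform_ge0 x) => t; have := qform_ge0 (t%:C%C *: x + y).
by rewrite qformD qformZr rformZl; congr (_ <= _); ring.
Qed.

Lemma qformD_le x y : qform s (x + y) <= 2 * qform s x + 2 * qform s y.
Proof.
by have := qform_ge0 (x - y); rewrite qformB qformD; lra.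
Qed.

End Form.

(** * Real inner product and squared norm of a Hilbert space *)

Section Inner.
Context {R : realType} {H : hilbertType R}.
Implicit Types (x y z : H) (t : R) (c : R[i]).

Lemma ip_psd : psd_form (ip : H -> H -> R[i]).
Proof.
split=> [x y z|c x y|x y|x].
- by rewrite linearDl.
- by rewrite linearZl_LR.
- by rewrite hermC /= expr0 mul1r.
- exact: dnorm_ge0.
Qed.

Definition rip x y : R := rform ip x y.
Definition sq x : R := qform ip x.

Definition ipDl := formDl ip_psd.
Definition ipDr := formDr ip_psd.
Definition ipNl := formNl ip_psd.
Definition ipNr := formNr ip_psd.
Definition ipZl := formZl ip_psd.
Definition ipZr := formZr ip_psd.
Definition ipC := formC ip_psd.

Lemma ipxx x : ip x x = (sq x)%:C%C. Proof. exact: (formxx ip_psd). Qed.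
Lemma ipE x y : ip x y = Complex (rip x y) (rip x ('i%C *: y)).
Proof. exact: (formE ip_psd). Qed.
Lemma sq_ge0 x : 0 <= sq x. Proof. exact: (qform_ge0 ip_psd). Qed.
Lemma ripDl x y z : rip (x + y) z = rip x z + rip y z.
Proof. exact: (rformDl ip_psd). Qed.
Lemma ripDr x y z : rip x (y + z) = rip x y + rip x z.
Proof. exact: (rformDr ip_psd). Qed.
Lemma ripNl x y : rip (- x) y = - rip x y.
Proof. exact: (rformNl ip_psd). Qed.
Lemma ripNr x y : rip x (- y) = - rip x y.
Proof. exact: (rformNr ip_psd). Qed.
Lemma ripBl x y z : rip (x - y) z = rip x z - rip y z.
Proof. by rewrite ripDl ripNl. Qed.
Lemma ripBr x y z : rip x (y - z) = rip x y - rip x z.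
Proof. by rewrite ripDr ripNr. Qed.
Lemma ripC x y : rip x y = rip y x. Proof. exact: (rformC ip_psd). Qed.
Lemma ripZl t x y : rip (t%:C%C *: x) y = t * rip x y.
Proof. exact: (rformZl ip_psd). Qed.
Lemma ripii x y : rip ('i%C *: x) ('i%C *: y) = rip x y.
Proof. exact: (rformii ip_psd). Qed.
Lemma ripi x y : rip ('i%C *: x) y = - rip x ('i%C *: y).
Proof. exact: (rformi ip_psd). Qed.
Lemma ripxx x : rip x x = sq x. Proof. by []. Qed.
Lemma rip0l x : rip 0 x = 0. Proof. by rewrite -(subrr x) ripBl subrr. Qed.
Lemma rip0r x : rip x 0 = 0. Proof. by rewrite ripC rip0l. Qed.
Lemma ip0l x : ip 0 x = 0. Proof. by rewrite ipE !rip0l. Qed.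
Lemma ip0r x : ip x 0 = 0. Proof. by rewrite ipE scaler0 !rip0r. Qed.
Lemma sqD x y : sq (x + y) = sq x + 2 * rip x y + sq y.
Proof. exact: (qformD ip_psd). Qed.
Lemma sqB x y : sq (x - y) = sq x - 2 * rip x y + sq y.
Proof. exact: (qformB ip_psd). Qed.
Lemma sqZ c x : sq (c *: x) = (complex.Re c ^+ 2 + complex.Im c ^+ 2) * sq x.
Proof. exact: (qformZ ip_psd). Qed.
Lemma sqZr t x : sq (t%:C%C *: x) = t ^+ 2 * sq x.
Proof. exact: (qformZr ip_psd). Qed.
Lemma sqN x : sq (- x) = sq x. Proof. exact: (qformN ip_psd). Qed.
Lemma sq0 : sq (0 : H) = 0. Proof. exact: (qform0 ip_psd). Qed.
Lemma sqC x y : sq (x - y) = sq (y - x). Proof. by rewrite -sqN opprB. Qed.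
Lemma rip_CS x y : rip x y ^+ 2 <= sq x * sq y. Proof. exact: (rform_CS ip_psd). Qed.
Lemma sqD_le x y : sq (x + y) <= 2 * sq x + 2 * sq y.
Proof. exact: (qformD_le ip_psd). Qed.

Lemma sq_eq0 x : sq x = 0 -> x = 0.
Proof. by move=> x0; apply/eqP; rewrite -(dnorm_eq0 ip) ipxx x0. Qed.

Lemma ip_eq x y : (forall z, rip x z = rip y z) -> x = y.
Proof.
move=> h; apply/eqP; rewrite -subr_eq0; apply/eqP/sq_eq0.
by rewrite -ripxx ripBl h subrr.
Qed.

Lemma normE x : `|x| = (Num.sqrt (sq x))%:C%C.
Proof.
apply: (@pexpIrn _ 2); rewrite ?nnegrE //.
  by rewrite ler0c sqrtr_ge0.
by rewrite ip_normE ipxx -rmorphXn /= sqr_sqrtr ?sq_ge0.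
Qed.

Lemma norm_lt x (e : R) : 0 < e -> (`|x| < e%:C%C) = (sq x < e ^+ 2).
Proof.
move=> e0; rewrite normE ltcR -[in LHS](ger0_norm (ltW e0)) -sqrtr_sqr.
by rewrite ltr_sqrt ?exprn_gt0.
Qed.

Lemma sq_le_small x : (forall e, 0 < e -> sq x <= e) -> x = 0.
Proof.
move=> h; apply: sq_eq0; apply/eqP; rewrite eq_le sq_ge0 andbT.
by apply/ler_addgt0Pl => e e0; rewrite addr0 h.
Qed.

Definition cvgs (u : nat -> H) x :=
  forall e : R, 0 < e -> exists N, forall n, (N <= n)%N -> sq (u n - x) < e.

Lemma gtC0 (e : R[i]) : 0 < e -> exists2 d : R, 0 < d & e = d%:C%C.
Proof.
case: e => a b; rewrite ltcE /= => /andP[/eqP -> a0]; by exists a.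
Qed.

Lemma hilbert_complete (u : nat -> H) :
  (forall e : R, 0 < e -> exists N, forall m n, (N <= m)%N -> (N <= n)%N ->
     sq (u m - u n) < e) ->
  exists x, cvgs u x.
Proof.
move=> uC.
have /cauchy_cvg /cvg_ex [x ux] : cauchy (u @ \oo).
  apply/cauchy_exP => /= e /gtC0 [d d0 ->].
  have [N hN] := uC (d ^+ 2) (exprn_gt0 _ d0).
  exists (u N); exists N => // n /= Nn.
  rewrite -ball_normE /= norm_lt //; exact: hN.
exists x => e e0.
have se : 0 < Num.sqrt e by rewrite sqrtr_gt0.
have /cvgrPdist_lt /(_ (Num.sqrt e)%:C%C) := ux.
rewrite ltcR => /(_ se) [N _ hN]; exists N => n Nn.
by have /= := hN n Nn; rewrite norm_lt // sqr_sqrtr ?ltW // sqC.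
Qed.

End Inner.

Lemma ltr0c (R : realType) (k : R) : (0 < k%:C%C) = (0 < k).
Proof. exact: (ltcR 0). Qed.

Record hilbert_form (R : realType) (V : lmodType R[i]) (s : V -> V -> R[i]) : Prop := {
  hform_psd : psd_form s;
  hform_eq0 : forall x, qform s x = 0 -> x = 0;
  hform_complete : forall u : nat -> V,
    (forall e : R, 0 < e -> exists N, forall m n, (N <= m)%N -> (N <= n)%N ->
      qform s (u m - u n) < e) ->
    exists x, forall e : R, 0 < e -> exists N, forall n, (N <= n)%N ->
      qform s (u n - x) < e }.

(** A copy of [V] that carries the proof [sH] as a parameter, so that norm, completeness and inner
    product, which all depend on [sH], can be attached to the type. *)
Definition form_carrier (R : realType) (V : lmodType R[i]) (s : V -> V -> R[i])
  (sH : hilbert_form s) : Type := V.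

Section FormHilbert.
Variables (R : realType) (V : lmodType R[i]) (s : V -> V -> R[i]).
Variable sH : hilbert_form s.
Let sP := hform_psd sH.
Local Notation K := (form_carrier sH).

HB.instance Definition _ := GRing.Lmodule.on K.

Definition form_norm (x : K) : R[i] := (Num.sqrt (qform s x))%:C%C.

Lemma form_normD (x y : K) : form_norm (x + y) <= form_norm x + form_norm y.
Proof.
rewrite /form_norm -rmorphD /= lecR.
have ge := qform_ge0 sP; set a := Num.sqrt (qform s x); set b := Num.sqrt (qform s y).
have a0 : 0 <= a by exact: sqrtr_ge0.
have b0 : 0 <= b by exact: sqrtr_ge0.
have ab0 : 0 <= a + b by rewrite addr_ge0.
rewrite -(ger0_norm ab0) -sqrtr_sqr; apply: ler_wsqrtr.
rewrite (qformD sP) sqrrD !sqr_sqrtr ?ge //.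
suff : rform s x y <= a * b by rewrite -mulr_natl; lra.
rewrite -(ger0_norm (mulr_ge0 a0 b0)) -sqrtr_sqr.
apply: (le_trans (ler_norm _)); rewrite -sqrtr_sqr.
by apply: ler_wsqrtr; rewrite exprMn !sqr_sqrtr ?ge // rform_CS.
Qed.

Lemma form_normZ (c : R[i]) (x : K) : form_norm (c *: x) = `|c| * form_norm x.
Proof.
rewrite /form_norm (qformZ sP) normc_def -rmorphM /= sqrtrM //.
by rewrite addr_ge0 ?sqr_ge0.
Qed.

Lemma form_norm0_eq0 (x : K) : form_norm x = 0 -> x = 0.
Proof.
move=> [] /eqP; rewrite sqrtr_eq0 => h; apply: (hform_eq0 sH).
by apply/eqP; rewrite eq_le h (qform_ge0 sP).
Qed.

HB.instance Definition _ :=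
  Lmodule_isNormed.Build R[i] K form_normD form_normZ form_norm0_eq0.

Lemma form_ballE (x y : V) (e : R) : 0 < e ->
  ball (x : K) e%:C%C (y : K) <-> qform s (x - y) < e ^+ 2.
Proof.
move=> e0; rewrite -ball_normE /= ltcR -[ltRHS](ger0_norm (ltW e0)) -sqrtr_sqr.
by rewrite ltr_sqrt ?exprn_gt0.
Qed.

(** A Cauchy filter contains balls of radius 1/(n+1); their centres form a Cauchy sequence because
    any two members of [F] meet. This reduces completeness for filters to the sequential one in
    [hilbert_form]. *)
Lemma form_cauchy_cvg (F : set_system K) : ProperFilter F -> cauchy F -> cvg F.
Proof.
move=> FF /cauchyP hF.
have hF' (n : nat) : exists x : V, F (ball (x : K) (n.+1%:R^-1 : R)%:C%C).
  by apply: hF; rewrite ltr0c invr_gt0.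
have [u hu] := choice hF'.
have [x ux] : exists x : V, forall e : R, 0 < e -> exists N, forall n, (N <= n)%N ->
      qform s (u n - x) < e.
  apply: (hform_complete sH) => e e0.
  have m0 : 0 < Num.min 1 (e / 4) by rewrite lt_min ltr01 divr_gt0.
  have [N] := ltr_add_invr m0.
  rewrite add0r lt_min => /andP[N1 Ne]; exists N => m n Nm Nn.
  have bd k : (N <= k)%N -> (k.+1%:R^-1 : R) ^+ 2 < e / 4.
    move=> Nk; apply: le_lt_trans Ne; apply: (@le_trans _ _ (k.+1%:R^-1)).
      by rewrite expr2 ger_pMr ?invr_gt0 // invf_le1 // ler1n.
    by rewrite lef_pV2 ?posrE // ler_nat.
  have [z [mz nz]] := filter_ex (filterI (hu m) (hu n)).
  move: (z : V) mz nz => {}z.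
  move=> /form_ballE; rewrite invr_gt0 ltr0n => /(_ isT) mz.
  move=> /form_ballE; rewrite invr_gt0 ltr0n => /(_ isT) nz.
  have := qformD_le sP (u m - z) (z - u n); rewrite subrKA.
  rewrite -(opprB (u n) z) (qformN sP).
  have := lt_trans mz (bd m Nm); have := lt_trans nz (bd n Nn); lra.
apply/cvg_ex; exists (x : K); apply/cvg_ballP => /= _ /gtC0 [d d0 ->].
have d2 : 0 < d ^+ 2 / 4 by rewrite divr_gt0 ?exprn_gt0.
have [N hN] := ux _ d2.
have [M] := ltr_add_invr (divr_gt0 d0 (ltr0Sn _ 1)).
rewrite add0r => Md.
pose k := maxn N M; apply: filterS (hu k) => y.
move: (y : V) => {}y.
move=> /form_ballE; rewrite invr_gt0 ltr0n => /(_ isT) ky.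
apply/form_ballE => //.
have := qformD_le sP (x - u k) (u k - y); rewrite subrKA.
have := hN k (leq_maxl _ _); rewrite -(opprB x (u k)) (qformN sP) => h1 h2.
have kd : (k.+1%:R^-1 : R) <= d / 2.
  apply: le_trans (ltW Md); rewrite lef_pV2 ?posrE // ler_nat ltnS.
  exact: leq_maxr.
have : (k.+1%:R^-1 : R) ^+ 2 <= (d / 2) ^+ 2.
  by rewrite lerXn2r // nnegrE ?invr_ge0 // divr_ge0 // ltW.
move=> /(lt_le_trans ky); move: h1 h2; rewrite expr_div_n; lra.
Qed.

HB.instance Definition _ := Uniform_isComplete.Build K form_cauchy_cvg.

Definition form_ip (x y : K) : R[i] := s x y.

Lemma form_ip_zmodl (y : K) : zmod_morphism (form_ip ^~ y).
Proof. by move=> u v; rewrite /form_ip (formDl sP) (formNl sP). Qed.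

Lemma form_ip_zmodr (x : K) : zmod_morphism (form_ip x).
Proof. by move=> u v; rewrite /form_ip (formDr sP) (formNr sP). Qed.

Lemma form_ip_scalel (y : K) : scalable_for *%R (form_ip ^~ y).
Proof. by move=> c u; exact: (formZl sP). Qed.

Lemma form_ip_scaler (x : K) : scalable_for (Num.conj \; *%R) (form_ip x).
Proof. by move=> c u; exact: (formZr sP). Qed.

HB.instance Definition _ := @isBilinear.Build R[i] K K R[i] *%R (Num.conj \; *%R) form_ip
  form_ip_zmodl form_ip_zmodr form_ip_scalel form_ip_scaler.

Lemma form_ip_herm (x y : K) : form_ip x y = (-1) ^+ false * Num.conj (form_ip y x).
Proof. by rewrite expr0 mul1r; exact: (formC sP). Qed.

HB.instance Definition _ :=
  @isHermitianSesquilinear.Build R[i] K false Num.conj form_ip form_ip_herm.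

Lemma form_ip_gt0 (x : K) : x != 0 -> 0 < form_ip x x.
Proof.
move=> x0; rewrite /form_ip (formxx sP) ltr0c lt_def (qform_ge0 sP) andbT.
by apply: contra x0 => /eqP /(hform_eq0 sH) ->.
Qed.

HB.instance Definition _ := @isDotProduct.Build R[i] K form_ip form_ip_gt0.

Lemma form_ip_normE (x : K) : `|x| ^+ 2 = form_ip x x.
Proof.
by rewrite /form_ip (formxx sP) -rmorphXn /= sqr_sqrtr // (qform_ge0 sP).
Qed.

Definition form_hilbert : hilbertType R := HilbertType form_ip_normE.
End FormHilbert.

Lemma hilbert_of_form (R : realType) (V : lmodType R[i]) (s : V -> V -> R[i]) :
  hilbert_form s -> exists (K : hilbertType R) (f : V -> K) (g : K -> V),
    [/\ cancel f g, cancel g f, linear f & forall x y, ip (f x) (f y) = s x y].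
Proof. by move=> sH; exists (form_hilbert sH), id, id. Qed.

Record submodule_set (R : realType) (V : lmodType R[i]) (P : set V) : Prop := {
  submod0 : P 0;
  submodP : forall c x y, P x -> P y -> P (c *: x + y) }.

(** As for [form_carrier], the proof [hP] is a parameter so that the module structure of the subtype
    can be inferred. *)
Definition sub_pred (R : realType) (V : lmodType R[i]) (P : set V)
  (hP : submodule_set P) : {pred V} := fun x => `[< P x >].

Section SubCarrier.
Variables (R : realType) (V : lmodType R[i]) (P : set V) (hP : submodule_set P).

Lemma sub_pred_submod_closed : GRing.submod_closed (sub_pred hP).
Proof.
split; first by apply/asboolP; exact: submod0 hP.
by move=> c x y /asboolP Px /asboolP Py; apply/asboolP/(submodP hP).
Qed.

HB.instance Definition _ :=
  GRing.isSubmodClosed.Build R[i] V (sub_pred hP) sub_pred_submod_closed.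

Record sub_carrier : Type := SubCarrier {
  sub_val : V; sub_valP : sub_val \in sub_pred hP }.
HB.instance Definition _ := [isSub for sub_val].
HB.instance Definition _ := [Choice of sub_carrier by <:].
HB.instance Definition _ := [SubChoice_isSubLmodule of sub_carrier by <:].
End SubCarrier.

Lemma submodule_type (R : realType) (V : lmodType R[i]) (P : set V) :
  submodule_set P -> exists (U : lmodType R[i]) (v : U -> V),
    [/\ linear v, injective v, forall u, P (v u) & forall x, P x -> exists u, v u = x].
Proof.
move=> hP; exists (sub_carrier hP), (@sub_val _ _ _ hP); split=> //.
- exact: val_inj.
- by case=> x /= /asboolP.
- by move=> x /asboolP Px; exists (SubCarrier Px).
Qed.

(** * Completion of a semi-inner product space *)

Lemma real_complete (R : realType) (u : nat -> R) :
  (forall e : R, 0 < e -> exists N, forall m n, (N <= m)%N -> (N <= n)%N ->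
     `|u m - u n| < e) ->
  exists l : R, u @ \oo --> l.
Proof.
move=> uC; suff /cauchy_cvg /cvg_ex [l ul] : cauchy (u @ \oo) by exists l.
apply/cauchy_exP => /= e e0; have [N hN] := uC e e0.
by exists (u N); exists N => // n /= Nn; rewrite /ball /=; exact: hN.
Qed.

Section Completion.
Variables (R : realType) (V : lmodType R[i]) (s : V -> V -> R[i]).
Hypothesis sP : psd_form s.
Implicit Types (f g h : V -> R[i]^o) (v w : V) (t : R) (c : R[i]).

(** The completion of [V] is realized inside its bounded antilinear functionals, through v -> [s v]:
    they are complete for the dual norm, and null vectors of [s] become 0, so that neither Cauchy
    sequences nor a quotient are needed. *)
Definition antidual : set (V -> R[i]^o) := [set f |
  (forall c v w, f (c *: v + w) = Num.conj c * f v + f w) /\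
  exists C : R, forall v, complex.Re (f v) ^+ 2 <= C * qform s v].

(** The squared dual norm of [f], written as a Legendre transform: no division by the length of [v]
    occurs, and adding [s v] to [f] amounts to a translation. *)
Definition dualq f : R :=
  sup (range (fun v => 2 * complex.Re (f v) - qform s v)).

Lemma antidual0 f : antidual f -> f 0 = 0.
Proof.
move=> [fl _]; have := fl 1 0 0; rewrite scaler0 addr0 rmorph1 mul1r => /eqP.
by rewrite -subr_eq subrr eq_sym => /eqP.
Qed.

Lemma antidualZ f c v : antidual f -> f (c *: v) = Num.conj c * f v.
Proof. by move=> fA; have := proj1 fA c v 0; rewrite antidual0 // !addr0. Qed.

Lemma antidualD f v w : antidual f -> f (v + w) = f v + f w.
Proof. by move=> [fl _]; have := fl 1 v w; rewrite scale1r rmorph1 mul1r. Qed.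

Lemma antidualN f v : antidual f -> f (- v) = - f v.
Proof. by move=> fA; rewrite -scaleN1r antidualZ // rmorphN1 mulN1r. Qed.

Lemma antidualB f v w : antidual f -> f (v - w) = f v - f w.
Proof. by move=> fA; rewrite antidualD // antidualN. Qed.

Lemma antidual_sub : submodule_set antidual.
Proof.
split.
  split=> [c v w|]; first by rewrite mulr0 addr0.
  by exists 0 => v; rewrite mul0r expr0n.
move=> c f g fA gA; split=> [d v w|].
  change (c * f (d *: v + w) + g (d *: v + w) =
    Num.conj d * (c * f v + g v) + (c * f w + g w)).
  by rewrite (proj1 fA) (proj1 gA); ring.
have [[_ [C hC]] [_ [D hD]]] := (fA, gA).
exists (2 * (C * (complex.Re c ^+ 2 + complex.Im c ^+ 2)) + 2 * D) => v.
have -> : (c *: f + g) v = f (Num.conj c *: v) + g v.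
  by rewrite antidualZ // conjCK.
rewrite raddfD /=; set a := complex.Re (f _); set b := complex.Re (g v).
have ha : a ^+ 2 <= C * (complex.Re c ^+ 2 + complex.Im c ^+ 2) * qform s v.
  apply: (le_trans (hC _)); rewrite (qformZ sP) mulrA.
  by case: c {a} => x y /=; rewrite sqrrN.
have hb : b ^+ 2 <= D * qform s v by exact: hD.
have := sqr_ge0 (a - b); rewrite !expr2; lra.
Qed.

Lemma dualq_has_sup f : antidual f ->
  has_sup (range (fun v => 2 * complex.Re (f v) - qform s v)).
Proof.
move=> [_ [C hC]]; split; first by exists (2 * complex.Re (f 0) - qform s 0), 0.
exists `|C| => _ [v _ <-]; have q0 := qform_ge0 sP v.
have hC' : complex.Re (f v) ^+ 2 <= `|C| * qform s v.
  by apply: le_trans (hC v) _; apply: ler_wpM2r => //; exact: ler_norm.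
have C0 := normr_ge0 C; set a := complex.Re (f v) in hC' *.
rewrite lerBlDr.
have sum0 : 0 <= `|C| + qform s v by rewrite addr_ge0.
rewrite -(ger0_norm sum0) -[leRHS]sqrtr_sqr; apply: (le_trans (ler_norm _)).
rewrite -sqrtr_sqr; apply: ler_wsqrtr.
have := sqr_ge0 (`|C| - qform s v); rewrite !expr2; lra.
Qed.

Lemma dualq_ub f v : antidual f -> 2 * complex.Re (f v) - qform s v <= dualq f.
Proof. by move=> fA; apply: sup_upper_bound (dualq_has_sup fA) _ _; exists v. Qed.

Lemma dualq_le f (C : R) : (forall v, 2 * complex.Re (f v) - qform s v <= C) ->
  dualq f <= C.
Proof.
move=> h; apply: ge_sup; first by exists (2 * complex.Re (f 0) - qform s 0), 0.
by move=> _ [v _ <-].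
Qed.

Lemma dualq_ge0 f : antidual f -> 0 <= dualq f.
Proof.
move=> fA; apply: le_trans (dualq_ub 0 fA).
by rewrite (qform0 sP) antidual0 // /= mulr0 subrr.
Qed.

Lemma dualq0 : dualq 0 = 0.
Proof.
apply/eqP; rewrite eq_le (dualq_ge0 (submod0 antidual_sub)) andbT.
by apply: dualq_le => w /=; rewrite mulr0 sub0r oppr_le0 (qform_ge0 sP).
Qed.

Lemma dualq_bnd f v : antidual f -> complex.Re (f v) ^+ 2 <= dualq f * qform s v.
Proof.
move=> fA; rewrite mulrC; apply: quad_disc (qform_ge0 sP v) => t.
have := dualq_ub ((- t)%:C%C *: v) fA.
rewrite antidualZ // (qformZr sP).
rewrite (_ : complex.Re _ = - t * complex.Re (f v)); last first.
  by case: (f v) => a b /=; ring.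
by rewrite sqrrN; lra.
Qed.

Lemma antidual_form v : antidual (s v).
Proof.
split=> [c x y|]; first by rewrite (formDr sP) (formZr sP).
by exists (qform s v) => w; exact: (rform_CS sP).
Qed.

Lemma antidual_lin c f g : antidual f -> antidual g -> antidual (c *: f + g).
Proof. exact: submodP antidual_sub c f g. Qed.

Lemma antidualDf f g : antidual f -> antidual g -> antidual (f + g).
Proof. by move=> fA gA; rewrite -[f]scale1r; exact: antidual_lin. Qed.

Lemma antidualZf c f : antidual f -> antidual (c *: f).
Proof.
by move=> fA; rewrite -[_ *: _]addr0; apply: antidual_lin => //; exact: submod0 antidual_sub.
Qed.

Lemma antidualNf f : antidual f -> antidual (- f).
Proof. by move=> fA; rewrite -scaleN1r; exact: antidualZf. Qed.

Lemma antidualBf f g : antidual f -> antidual g -> antidual (f - g).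
Proof. by move=> fA gA; apply: antidualDf => //; exact: antidualNf. Qed.

(** Completing the square: translate by [v] the vector over which the supremum is taken. *)
Lemma dualq_form f v : antidual f ->
  dualq (f + s v) = dualq f + 2 * complex.Re (f v) + qform s v.
Proof.
move=> fA.
have E w : complex.Re ((f + s v) w) = complex.Re (f w) + rform s v w.
  by rewrite /rform -raddfD.
apply/eqP; rewrite eq_le; apply/andP; split.
  apply: dualq_le => w; have := dualq_ub (w - v) fA.
  rewrite E antidualB //.
  by rewrite (qformB sP) raddfB /= (rformC sP v w); lra.
rewrite -lerBrDr -lerBrDr; apply: dualq_le => w.
have := dualq_ub (w + v) (antidualDf fA (antidual_form v)).
rewrite E antidualD // (qformD sP) (rformDr sP) raddfD /=.
by rewrite (rformC sP v w) -/(qform s v); lra.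
Qed.

(** Test [f + g] at [v] and [f - g] at [w]; then [f] tested at (v + w)/2 and [g] at (v - w)/2 give
    the same value, by the parallelogram law of [s]. *)
Lemma dualq_para_le f g : antidual f -> antidual g ->
  dualq (f + g) + dualq (f - g) <= 2 * dualq f + 2 * dualq g.
Proof.
move=> fA gA; rewrite -lerBrDr; apply: dualq_le => v.
rewrite lerBrDr addrC -lerBrDr; apply: dualq_le => w.
have := dualq_ub ((2^-1)%:C%C *: (v + w)) fA.
have := dualq_ub ((2^-1)%:C%C *: (v - w)) gA.
rewrite !antidualZ // (antidualD _ _ fA) (antidualB _ _ gA).
rewrite !(qformZr sP) (qformB sP) (qformD sP) !fctE.
case: (f v) => a ?; case: (f w) => b ?; case: (g v) => a' ?; case: (g w) => b' ? /=.
rewrite expr2; set q := qform s v; set q' := qform s w; set r := rform s v w.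
by lra.
Qed.

Lemma dualqZ_le c f : antidual f ->
  dualq (c *: f) <= (complex.Re c ^+ 2 + complex.Im c ^+ 2) * dualq f.
Proof.
move=> fA; apply: dualq_le => v.
set k := complex.Re c ^+ 2 + complex.Im c ^+ 2; have k0 : 0 <= k by rewrite addr_ge0 ?sqr_ge0.
have -> : (c *: f) v = f (Num.conj c *: v) by rewrite antidualZ // conjCK.
have := dualq_bnd (Num.conj c *: v) fA; rewrite (qformZ sP).
have -> : complex.Re (Num.conj c) ^+ 2 + complex.Im (Num.conj c) ^+ 2 = k.
  by rewrite /k; case: (c) => a b /=; rewrite sqrrN.
set a := complex.Re _; set q := qform s v; have q0 : 0 <= q by exact: qform_ge0.
have := dualq_ge0 fA; set Q := dualq f => Q0 h.
rewrite lerBlDr.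
have sum0 : 0 <= k * Q + q by rewrite addr_ge0 ?mulr_ge0.
rewrite -(ger0_norm sum0) -[leRHS]sqrtr_sqr; apply: (le_trans (ler_norm _)).
rewrite -sqrtr_sqr; apply: ler_wsqrtr.
by have := sqr_ge0 (k * Q - q); rewrite !expr2; lra.
Qed.

Lemma dualqZ c f : antidual f ->
  dualq (c *: f) = (complex.Re c ^+ 2 + complex.Im c ^+ 2) * dualq f.
Proof.
move=> fA; have [->|c0] := eqVneq c 0.
  apply/eqP; rewrite eq_le dualqZ_le //= expr0n addr0 mul0r.
  exact: dualq_ge0 (antidualZf _ fA).
apply/eqP; rewrite eq_le dualqZ_le //=.
have := dualqZ_le c^-1 (antidualZf c fA); rewrite scalerA mulVf // scale1r.
have n0 : complex.Re c ^+ 2 + complex.Im c ^+ 2 != 0.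
  by move: c0; case: c => a b; rewrite eq_complex /= paddr_eq0 ?sqr_ge0 // !sqrf_eq0.
have np : 0 < complex.Re c ^+ 2 + complex.Im c ^+ 2.
  by rewrite lt_def n0 addr_ge0 ?sqr_ge0.
have -> : complex.Re c^-1 ^+ 2 + complex.Im c^-1 ^+ 2 =
          (complex.Re c ^+ 2 + complex.Im c ^+ 2)^-1.
  by move: n0; case: c {c0 np} => a b /= n0; field.
by rewrite mulrC ler_pdivlMr // mulrC.
Qed.

Lemma dualqN f : antidual f -> dualq (- f) = dualq f.
Proof.
by move=> fA; rewrite -scaleN1r dualqZ //= oppr0 expr0n addr0 sqrrN expr1n mul1r.
Qed.

(** The reverse inequality is [dualq_para_le] for the pair [f + g], [f - g]. *)
Lemma dualq_para f g : antidual f -> antidual g ->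
  dualq (f + g) + dualq (f - g) = 2 * dualq f + 2 * dualq g.
Proof.
move=> fA gA; apply/eqP; rewrite eq_le dualq_para_le //=.
have := dualq_para_le (antidualDf fA gA) (antidualBf fA gA).
have -> : f + g + (f - g) = f + f by rewrite addrACA subrr addr0.
have -> : f + g - (f - g) = g + g by rewrite opprB addrC addrA subrK.
have two h : antidual h -> dualq (h + h) = 4 * dualq h.
  move=> hA; have -> : h + h = (2 : R)%:C%C *: h.
    by rewrite rmorphD /= rmorph1 scalerDl scale1r.
  by rewrite dualqZ //= expr0n addr0; congr (_ * _); ring.
by rewrite !two //; lra.
Qed.

(** By [dualq_form], the amount by which [v] misses the supremum is exactly [dualq (f - s v)]. *)
Lemma dualq_dense f (e : R) : antidual f -> 0 < e -> exists v, dualq (f - s v) < e.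
Proof.
move=> fA e0; have [_ [v _ <-]] := sup_adherent e0 (dualq_has_sup fA).
rewrite -/(dualq f) => h; exists v.
have -> : f - s v = f + s (- v) by congr (_ + _); apply/funext => w; rewrite (formNl sP).
rewrite dualq_form // (qformN sP) antidualN // raddfN /=.
by lra.
Qed.

End Completion.

(** * The inner product of the completion, by the Jordan-von Neumann theorem *)

Section Polarization.
Variables (R : realType) (V : lmodType R[i]) (s : V -> V -> R[i]).
Hypothesis sP : psd_form s.
Implicit Types (f g h : V -> R[i]^o) (v w : V) (t : R) (c : R[i]).
Local Notation antidual := (antidual s).
Local Notation Q := (dualq s).

Definition polar f g : R := (Q (f + g) - Q (f - g)) / 4.

Local Notation adD := (antidualDf sP).
Local Notation adB := (antidualBf sP).
Local Notation adN := (antidualNf sP).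
Local Notation adZ := (antidualZf sP).

Lemma polarC f g : antidual f -> antidual g -> polar f g = polar g f.
Proof.
by move=> fA gA; rewrite /polar (addrC g f) -(dualqN sP (adB gA fA)) opprB.
Qed.

Lemma dualqD f g : antidual f -> antidual g -> Q (f + g) = Q f + 2 * polar f g + Q g.
Proof. by move=> fA gA; have := dualq_para sP fA gA; rewrite /polar; lra. Qed.

Lemma polarDl f g h : antidual f -> antidual g -> antidual h ->
  polar (f + g) h = polar f h + polar g h.
Proof.
(* the parallelogram law, applied to [f + h/2] and [g + h/2] and to the same
   pair with [h] replaced by [- h] *)
suff half f' g' h' : antidual f' -> antidual g' -> antidual h' ->
    polar (f' + g') (h' + h') = 2 * (polar f' h' + polar g' h').
  move=> fA gA hA; pose k := (2^-1 : R)%:C%C *: h.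
  have kA : antidual k by exact: adZ.
  have kk : k + k = h.
    rewrite -scalerDl -rmorphD /= (_ : 2^-1 + 2^-1 = 1 :> R); last by field.
    by rewrite rmorph1 scale1r.
  have a0 : antidual 0 by exact: submod0 (antidual_sub sP).
  have p0 : polar 0 k = 0 by rewrite /polar add0r sub0r (dualqN sP) // subrr mul0r.
  have := half f g k fA gA kA; have := half f 0 k fA a0 kA.
  by have := half 0 g k a0 gA kA; rewrite kk p0 !addr0 !add0r; lra.
move=> fA gA hA; rewrite /polar.
have := dualq_para sP (adD fA hA) (adD gA hA).
have := dualq_para sP (adB fA hA) (adB gA hA).
have -> : f' + h' + (g' + h') = f' + g' + (h' + h') by rewrite addrACA.
have -> : f' - h' + (g' - h') = f' + g' - (h' + h') by rewrite addrACA -opprD.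
have -> : f' + h' - (g' + h') = f' - g' by rewrite opprD addrACA subrr addr0.
have -> : f' - h' - (g' - h') = f' - g'.
  by rewrite opprB subrKA.
lra.
Qed.

Lemma polarNl f g : antidual f -> antidual g -> polar (- f) g = - polar f g.
Proof.
move=> fA gA; rewrite /polar -(dualqN sP (adD (adN fA) gA)).
rewrite -[Q (- f - g)](dualqN sP (adB (adN fA) gA)) !opprD !opprK; lra.
Qed.

Lemma polar_form v g : antidual g -> polar (s v) g = complex.Re (g v).
Proof.
move=> gA; have fA := antidual_form sP v.
have Qs : Q (s v) = qform s v.
  have := dualq_form sP v (submod0 (antidual_sub sP)).
  by rewrite add0r /= mulr0 (dualq0 sP) !add0r.
by have := dualqD fA gA; rewrite polarC // addrC (dualq_form sP) // Qs; lra.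
Qed.

(** A substitute for Cauchy-Schwarz that uses additivity only: [g] is written as [N.+1] times a
    vector [k], so that only an integer has to be moved out of [polar]. *)
Lemma polar_small f g N : antidual f -> antidual g ->
  `|polar f g| <= N.+1%:R * Q f + Q g / N.+1%:R.
Proof.
move=> fA gA; have N0 : 0 < N.+1%:R :> R by rewrite ltr0n.
pose k := (N.+1%:R^-1 : R)%:C%C *: g.
have kA : antidual k by exact: adZ.
have iter m : polar (k *+ m) f = m%:R * polar k f /\ antidual (k *+ m).
  elim: m => [|m [IH mA]].
    have a0 := submod0 (antidual_sub sP).
    by rewrite mulr0n /polar add0r sub0r (dualqN sP) // subrr !mul0r.
  rewrite mulrS; split; last exact: adD.
  by rewrite polarDl // IH -natr1; ring.
have gk : g = k *+ N.+1.
  rewrite /k -scaler_nat scalerA -(rmorph_nat (real_complex R)) -rmorphM /=.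
  by rewrite divff ?gt_eqF // rmorph1 scale1r.
have -> : polar f g = N.+1%:R * polar f k.
  by rewrite polarC // [in LHS]gk (proj1 (iter _)) polarC.
have Qk : Q k = Q g / N.+1%:R ^+ 2.
  by rewrite /k (dualqZ sP) //= expr0n addr0 mulrC exprVn.
have := dualqD fA kA; have := dualq_ge0 sP (adD fA kA).
have := dualq_ge0 sP (adB fA kA); have := dualqD fA (adN kA).
have pN : polar f (- k) = - polar f k.
  by rewrite polarC ?polarNl // 1?polarC //; exact: adN.
rewrite pN (dualqN sP) // => -> h1 h2 E; rewrite E in h2.
have := dualq_ge0 sP fA; have := dualq_ge0 sP kA => k0 f0.
have : `|polar f k| <= Q f + Q k by rewrite ler_norml; apply/andP; split; lra.
rewrite (normrM N.+1%:R) (gtr0_norm N0) -(ler_pM2l N0) => /le_trans; apply.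
rewrite mulrDr lerD2l Qk le_eqVlt; apply/orP; left; apply/eqP.
by move: (lt0r_neq0 N0); set n := N.+1%:R => n0; field.
Qed.

(** Homogeneity is exact when [g] is of the form [s v], by [polar_form]; such elements are dense,
    and [polar_small] controls the remainder [h]. *)
Lemma polarZl t f g : antidual f -> antidual g ->
  polar (t%:C%C *: f) g = t * polar f g.
Proof.
move=> fA gA; apply/eqP; rewrite -subr_eq0 -normr_le0.
apply/ler_addgt0Pl => e e0; rewrite addr0.
(* [C] collects the coefficients of 1/(N+1) in the two uses of [polar_small]; [d] then bounds [Q h]
   so that the terms in N+1 contribute at most e/2, as do those in 1/(N+1). *)
pose C := (t ^+ 2 + `|t|) * Q f + 1.
have C0 : 0 < C.
  by rewrite ltr_wpDl // mulr_ge0 ?addr_ge0 ?sqr_ge0 // (dualq_ge0 sP).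
have [N hN] := ltr_add_invr (divr_gt0 e0 (mulr_gt0 (ltr0Sn R 1) C0)).
rewrite add0r in hN; have N0 : 0 < N.+1%:R :> R by rewrite ltr0n.
pose d := e / (2 * (N.+1%:R * (1 + `|t|))).
have t1 : 0 < 1 + `|t| by rewrite ltr_wpDr.
have d0 : 0 < d by rewrite divr_gt0 // !mulr_gt0.
have [v hv] := dualq_dense sP gA d0.
set h := g - s v in hv; have sA := antidual_form sP v.
have hA : antidual h by exact: adB.
have gE : g = h + s v by rewrite /h subrK.
have lin k : antidual k -> polar k g = polar k h + complex.Re (k v).
  move=> kA; rewrite polarC // [in LHS]gE polarDl // polar_form //.
  by rewrite polarC.
rewrite !lin //; last exact: adZ.
have -> : complex.Re ((t%:C%C *: f) v) = t * complex.Re (f v).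
  by rewrite /= ; change (complex.Re (t%:C%C * f v) = t * complex.Re (f v));
  case: (f v) => a b /=; ring.
rewrite mulrDr opprD addrACA subrr addr0.
apply: le_trans (ler_normB _ _) _; rewrite (normrM t).
have b1 := @polar_small _ _ N hA (adZ t%:C%C fA).
have b2 := @polar_small _ _ N hA fA.
rewrite (dualqZ sP) //= expr0n addr0 in b1.
rewrite -(polarC hA fA) -(polarC hA (adZ _ fA)).
have h0 := dualq_ge0 sP hA.
have e1 : N.+1%:R * Q h * (1 + `|t|) <= e / 2.
  rewrite mulrAC -ler_pdivlMl ?mulr_gt0 // mulrC -mulrA -invfM; exact: ltW.
have e2 : C / N.+1%:R <= e / 2.
  rewrite ler_pdivrMr // -ler_pdivrMl ?divr_gt0 //.
  rewrite -lef_pV2 ?posrE ?mulr_gt0 ?invr_gt0 ?divr_gt0 //.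
  by rewrite invfM !invrK; apply: le_trans (ltW hN) _; rewrite !invfM; lra.
have e3 : `|t| * `|polar h f| <= `|t| * (N.+1%:R * Q h + Q f / N.+1%:R).
  by rewrite ler_wpM2l.
have Ni : 0 < N.+1%:R^-1 :> R by rewrite invr_gt0.
move: b1 e1 e2 e3; rewrite /C; set n := N.+1%:R^-1 in Ni *; lra.
Qed.

Lemma polar_ii f g : antidual f -> antidual g ->
  polar ('i%C *: f) ('i%C *: g) = polar f g.
Proof.
move=> fA gA; rewrite /polar -scalerDr -scalerBr !(dualqZ sP) /=; [|exact: adB|exact: adD].
by rewrite expr0n add0r expr1n !mul1r.
Qed.

Lemma polar_ff f : antidual f -> polar f f = Q f.
Proof.
move=> fA; have := dualqD fA fA.
have -> : f + f = (2 : R)%:C%C *: f by rewrite rmorphD /= rmorph1 scalerDl scale1r.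
by rewrite (dualqZ sP) //= expr0n addr0; lra.
Qed.

Lemma polar_i f g : antidual f -> antidual g ->
  polar ('i%C *: f) g = - polar f ('i%C *: g).
Proof.
move=> fA gA; rewrite -[in RHS](polar_ii fA (adZ 'i%C gA)) scalerA.
rewrite (_ : 'i%C * 'i%C = -1 :> R[i]); last by rewrite -expr2 sqr_i.
rewrite scaleN1r (polarC (adZ _ fA) (adN gA)) polarNl ?opprK //; last exact: adZ.
by rewrite polarC //; exact: adZ.
Qed.

End Polarization.

Section CompletionTheorem.
Variables (R : realType) (V : lmodType R[i]) (s : V -> V -> R[i]).
Hypothesis sP : psd_form s.
Variables (U : lmodType R[i]) (val : U -> V -> R[i]^o).
Hypotheses (val_lin : linear val) (val_inj : injective val).
Hypotheses (val_ad : forall u, antidual s (val u)).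
Hypothesis val_sur : forall f, antidual s f -> exists u, val u = f.

Local Notation polar := (polar s).
Local Notation Q := (dualq s).

Let valD x y : val (x + y) = val x + val y.
Proof. by rewrite -[x]scale1r val_lin !scale1r. Qed.

Let val0 : val 0 = 0.
Proof. by apply: (addIr (val 0)); rewrite add0r -valD addr0. Qed.

Let valZ c x : val (c *: x) = c *: val x.
Proof. by rewrite -[c *: x]addr0 val_lin val0 addr0. Qed.

Let valB x y : val (x - y) = val x - val y.
Proof. by rewrite -scaleN1r valD valZ scaleN1r. Qed.

Definition completion_form (x y : U) : R[i] :=
  Complex (polar (val x) (val y)) (polar (val x) ('i%C *: val y)).

Let ad_i x : antidual s ('i%C *: val x).
Proof. exact: (antidualZf sP). Qed.

Let polarZc c x y : antidual s y -> polar (c *: val x) y =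
  complex.Re c * polar (val x) y - complex.Im c * polar (val x) ('i%C *: y).
Proof.
move=> yA; have -> : c *: val x =
    (complex.Re c)%:C%C *: val x + (complex.Im c)%:C%C *: ('i%C *: val x).
  by rewrite scalerA -scalerDl mulrC -complexE.
rewrite (polarDl sP) //; try exact: (antidualZf sP).
by rewrite !(polarZl sP) // (polar_i sP) // mulrN.
Qed.

Lemma completion_form_psd : psd_form completion_form.
Proof.
split=> [x y z|c x y|x y|x]; rewrite /completion_form.
- by rewrite valD !(polarDl sP).
- rewrite valZ !polarZc //; case: c => a b /=; rewrite scalerA.
  rewrite (_ : 'i%C * 'i%C = -1 :> R[i]); last by rewrite -expr2 sqr_i.
  rewrite scaleN1r (polarC sP _ (antidualNf sP _)) // (polarNl sP) // (polarC sP (val_ad y)) //.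
  by congr Complex; ring.
- rewrite (polarC sP) // (polarC sP (val_ad x) (ad_i y)) (polar_i sP) //=.
- rewrite lecE /= (polar_ff sP) // (dualq_ge0 sP) // andbT.
  have := polar_i sP (val_ad x) (val_ad x).
  rewrite (polarC sP (ad_i x)) // => /eqP; rewrite -subr_eq0 opprK -mulr2n.
  by rewrite mulrn_eq0.
Qed.

Lemma qform_completion x : qform completion_form x = Q (val x).
Proof. by rewrite /qform /rform /= (polar_ff sP). Qed.

Lemma completion_form_hilbert : hilbert_form completion_form.
Proof.
split; first exact: completion_form_psd.
  move=> x; rewrite qform_completion => x0.
  apply: val_inj; rewrite val0; apply/funext => v /=.
  have re0 w : complex.Re (val x w) = 0.
    apply/eqP; rewrite -sqrf_eq0 eq_le sqr_ge0 andbT.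
    by apply: le_trans (dualq_bnd sP w (val_ad x)) _; rewrite x0 mul0r.
  have := re0 ('i%C *: v); rewrite (antidualZ _ _ (val_ad _)); have := re0 v.
  by case: (val x v) => a b /= -> h; congr Complex; move: h; lra.
move=> u uC; pose r n v := complex.Re (val (u n) v).
have rB m n v : r m v - r n v = complex.Re (val (u m - u n) v).
  by rewrite valB /r -raddfB.
have rcv v : exists l : R, (r n v @[n --> \oo]) --> l.
  apply: real_complete => e e0; have q0 := qform_ge0 sP v.
  have d0 : 0 < e ^+ 2 / (qform s v + 1) by rewrite divr_gt0 ?exprn_gt0 ?ltr_wpDl.
  have [N hN] := uC _ d0; exists N => m n Nm Nn.
  have := hN m n Nm Nn; rewrite qform_completion ltr_pdivlMr ?ltr_wpDl // => h.
  rewrite rB -(ger0_norm (ltW e0)) -ltr_sqr ?nnegrE // !real_normK ?num_real //.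
  apply: le_lt_trans (dualq_bnd sP v (val_ad _)) _; apply: le_lt_trans h.
  by rewrite ler_wpM2l ?lerDl // (dualq_ge0 sP).
have [l hl] := choice rcv.
have l_uniq v a : (r n v @[n --> \oo]) --> a -> a = l v.
  by move=> ha; exact: (cvg_unique _ ha (hl v)).
have lD v w : l (v + w) = l v + l w.
  apply/esym/l_uniq; rewrite (_ : (fun n => _) = (fun n => r n v + r n w)).
    exact: cvgD.
  by apply/funext => n; rewrite /r (antidualD _ _ (val_ad _)) raddfD.
have lZ (t : R) v : l (t%:C%C *: v) = t * l v.
  apply/esym/l_uniq; rewrite (_ : (fun n => _) = (fun n => t * r n v)).
    exact: cvgMr.
  apply/funext => n; rewrite /r (antidualZ _ _ (val_ad _)).
  by case: (val (u n) v) => a b /=; ring.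
have lii v : l ('i%C *: ('i%C *: v)) = - l v.
  rewrite scalerA (_ : 'i%C * 'i%C = (-1)%:C%C :> R[i]); last first.
    by rewrite -expr2 sqr_i rmorphN1.
  by rewrite lZ mulN1r.
(* Only real parts were passed to the limit: for an antilinear functional the imaginary part at v is
   the real part at i v. *)
pose f : V -> R[i]^o := fun v => Complex (l v) (l ('i%C *: v)).
(* Letting m tend to infinity in the Cauchy condition gives a bound uniform in [v], hence
   convergence for [dualq] and not only pointwise. *)
have key e : 0 < e -> exists N, forall n, (N <= n)%N -> forall v,
    2 * (r n v - l v) - qform s v <= e.
  move=> e0; have [N hN] := uC e e0; exists N => n Nn v.
  have cv : (2 * (r n v - r m v) - qform s v) @[m --> \oo] -->
      2 * (r n v - l v) - qform s v.
    by apply: cvgB; [apply: cvgMr; apply: cvgB; [exact: cvg_cst|exact: hl]|exact: cvg_cst].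
  rewrite -(cvg_lim _ cv) //; apply: limr_le; first by apply/cvg_ex; eexists; exact: cv.
  exists N => // m Nm; rewrite rB.
  apply: le_trans (dualq_ub sP v (val_ad _)) _.
  by rewrite -qform_completion; apply/ltW/hN.
have fA : antidual s f.
  split=> [c v w|].
    rewrite /f scalerDr !lD.
    have E (x : V) : c *: x = (complex.Re c)%:C%C *: x + (complex.Im c)%:C%C *: ('i%C *: x).
      by rewrite scalerA -scalerDl mulrC -complexE.
    rewrite (E v) scalerDr !lD !scalerA ![ 'i%C * _]mulrC -!scalerA !lZ lii.
    by case: c {E} => a b /=; congr Complex; rewrite /=; ring.
  have [N hN] := key 1 ltr01.
  have [_ [C hC]] := val_ad (u N).
  exists (2 * C + 2) => v; rewrite /=.
  have h1 : (r N v - l v) ^+ 2 <= 1 * qform s v.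
    rewrite mulrC; apply: quad_disc (qform_ge0 sP v) => t.
    have := hN N (leqnn N) ((- t)%:C%C *: v); rewrite lZ (qformZr sP) sqrrN.
    rewrite (_ : r N _ = - t * r N v); first by lra.
    by rewrite /r (antidualZ _ _ (val_ad _)); case: (val (u N) v) => a b /=; ring.
  have h2 : r N v ^+ 2 <= C * qform s v by exact: hC.
  by have := sqr_ge0 (2 * r N v - l v); move: h1 h2; rewrite !expr2; lra.
have [x xf] := val_sur fA; exists x => e e0.
have e2 : 0 < e / 2 by rewrite divr_gt0.
have [N hN] := key _ e2; exists N => n Nn.
rewrite qform_completion valB; apply: (@le_lt_trans _ _ (e / 2)); last by lra.
by apply: dualq_le => v; rewrite raddfB /= xf; exact: hN.
Qed.

End CompletionTheorem.

Lemma hilbert_completion (R : realType) (V : lmodType R[i]) (s : V -> V -> R[i]) :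
  psd_form s -> exists (K : hilbertType R) (j : V -> K),
    [/\ linear j, forall v w, ip (j v) (j w) = s v w
      & forall x (e : R), 0 < e -> exists v, sq (x - j v) < e].
Proof.
move=> sP.
have [U [val [val_lin val_inj val_ad val_sur]]] := submodule_type (antidual_sub sP).
have [K [F [G [FK GK Flin Fip]]]] :=
  hilbert_of_form (completion_form_hilbert sP val_lin val_inj val_ad val_sur).
have [j hj] := choice (fun v => val_sur _ (antidual_form sP v)).
have jlin : linear j.
  move=> c v w; apply: val_inj; rewrite val_lin !hj; apply/funext => x.
  by rewrite (formDl sP) (formZl sP).
exists K, (fun v => F (j v)); split.
- by move=> c v w; rewrite jlin Flin.
- move=> v w; rewrite Fip /completion_form !hj !(polar_form sP) //.
    have -> : ('i%C *: s w) v = 'i%C * s w v by [].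
    by rewrite (formC sP v w); case: (s w v) => a b /=; congr Complex; ring.
  - exact/(antidualZf sP)/(antidual_form sP).
  - exact: (antidual_form sP).
move=> x e e0; have [v hv] := dualq_dense sP (val_ad (G x)) e0; exists v.
have FB a b : F (a - b) = F a - F b.
  by rewrite -scaleN1r addrC Flin scaleN1r addrC.
have valB a b : val (a - b) = val a - val b.
  by rewrite -scaleN1r addrC val_lin scaleN1r addrC.
rewrite -[x]GK -FB /sq /qform /rform Fip -/(rform _ _ _) -/(qform _ _).
by rewrite (qform_completion sP val_ad) valB hj.
Qed.

(** * Bounded operators, von Neumann algebras and suprema *)

Lemma invn_small (R : realType) (e : R) : 0 < e ->
  exists N, forall n, (N <= n)%N -> n.+1%:R^-1 < e.
Proof.
move=> e0; have [N] := ltr_add_invr e0; rewrite add0r => Ne; exists N => n Nn.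
by apply: le_lt_trans Ne; rewrite lef_pV2 ?posrE // ler_nat.
Qed.

Section LinearMaps.
Context {R : realType} {U V : lmodType R[i]} (a : U -> V).
Implicit Types (x y : U) (c : R[i]).

Lemma linear0f : linear a -> a 0 = 0.
Proof.
by move=> al; apply: (addIr (a 0)); rewrite add0r -[X in X + _]scale1r -al scale1r addr0.
Qed.

Lemma linearDf x y : linear a -> a (x + y) = a x + a y.
Proof. by move=> al; rewrite -[x]scale1r al !scale1r. Qed.

Lemma linearZf c x : linear a -> a (c *: x) = c *: a x.
Proof. by move=> al; rewrite -[_ *: x]addr0 al (linear0f al) addr0. Qed.

Lemma linearNf x : linear a -> a (- x) = - a x.
Proof. by move=> al; rewrite -scaleN1r linearZf // scaleN1r. Qed.

Lemma linearBf x y : linear a -> a (x - y) = a x - a y.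
Proof. by move=> al; rewrite linearDf // linearNf. Qed.

End LinearMaps.

Section Operators.
Context {R : realType} {H : hilbertType R}.
Implicit Types (x y z : H) (t : R) (c : R[i]) (a b : H -> H).

(** [C] bounds the square of the operator norm. *)
Definition bdd a (C : R) := forall x, sq (a x) <= C * sq x.

Lemma bounded_opP a : bounded_op a <-> linear a /\ exists2 C, 0 <= C & bdd a C.
Proof.
split=> [[al ac]|[al [C C0 hC]]].
  split=> //; have /cvgrPdist_lt /(_ 1 ltr01) := ac 0.
  rewrite linear0f // => /nbhs_ballP [_ /gtC0 [d d0 ->] hd].
  have d20 : 0 < d ^+ 2 by rewrite exprn_gt0.
  exists (4 / d ^+ 2) => [|x]; first by rewrite divr_ge0 // ltW.
  have [->|x0] := eqVneq x 0; first by rewrite linear0f // sq0 mulr0.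
  have sx : 0 < sq x.
    by rewrite lt_def sq_ge0 andbT; apply: contra x0 => /eqP /sq_eq0 ->.
  (* Scales [x] to length d/2, inside the ball provided by continuity at 0. *)
  pose t := d / (2 * Num.sqrt (sq x)).
  have s0 : 0 < Num.sqrt (sq x) by rewrite sqrtr_gt0.
  have t0 : 0 < t by rewrite divr_gt0 // mulr_gt0.
  have t2 : t ^+ 2 = d ^+ 2 / (4 * sq x).
    rewrite /t expr_div_n exprMn sqr_sqrtr ?sq_ge0 //.
    by congr (_ / (_ * _)); ring.
  have /hd : ball (0 : H) d%:C%C (t%:C%C *: x).
    rewrite -ball_normE /= sub0r normrN norm_lt // sqZr t2.
    rewrite invfM mulrA divfK ?gt_eqF // ltr_pdivrMr //; lra.
  rewrite /= sub0r normrN linearZf // -(rmorph1 (real_complex R)) norm_lt // sqZr.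
  rewrite t2 expr1n mulrAC ltr_pdivrMr ?mulr_gt0 // mul1r => h.
  by rewrite mulrAC ler_pdivlMr // mulrC ltW.
split=> // x; apply/cvgrPdist_lt => _ /gtC0 [e e0 ->].
have C1 : 0 < C + 1 by rewrite ltr_wpDl.
have d0 : 0 < e / Num.sqrt (C + 1) by rewrite divr_gt0 // sqrtr_gt0.
apply/nbhs_ballP; exists (e / Num.sqrt (C + 1))%:C%C => /=.
  by rewrite ltr0c.
move=> y; rewrite -ball_normE /= !norm_lt // -linearBf //.
rewrite expr_div_n sqr_sqrtr ?ltW // ltr_pdivlMr // => h.
apply: le_lt_trans (hC _) _; apply: le_lt_trans h.
by rewrite mulrC ler_wpM2l ?sq_ge0 // lerDl.
Qed.

Definition adh (L : set H) : set H :=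
  [set y | forall e, 0 < e -> exists2 x, L x & sq (y - x) < e].

Lemma sq_tri x y z (e : R) : sq (x - y) < e / 4 -> sq (y - z) < e / 4 -> sq (x - z) < e.
Proof. by have := sqD_le (x - y) (y - z); rewrite subrKA; lra. Qed.

Lemma rip_adh0 (L : set H) x z : (forall l, L l -> rip l z = 0) -> adh L x -> rip x z = 0.
Proof.
move=> Lz xL; apply/eqP; rewrite -sqrf_eq0 eq_le sqr_ge0 andbT.
apply/ler_addgt0Pl => e e0; rewrite addr0.
have z1 : 0 < sq z + 1 by rewrite ltr_wpDl ?sq_ge0.
have [l Ll hl] := xL _ (divr_gt0 e0 z1).
have -> : rip x z = rip (x - l) z by rewrite ripBl (Lz _ Ll) subr0.
apply: le_trans (rip_CS _ _) _; move: hl; rewrite ltr_pdivlMr // => /ltW; apply: le_trans.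
by rewrite ler_wpM2l ?sq_ge0 // lerDl.
Qed.

(** Riesz representation by maximizing 2 f(x) - |x|^2. It is stated over the reals and for a
    subspace that need not be closed, so as to apply to self-adjoint elements ([sa_density]). *)
Lemma real_riesz (L : set H) (f : H -> R) (C : R) :
  L 0 -> (forall t x y, L x -> L y -> L (t%:C%C *: x + y)) ->
  (forall t x y, L x -> L y -> f (t%:C%C *: x + y) = t * f x + f y) ->
  (forall x, L x -> f x ^+ 2 <= C * sq x) ->
  exists2 y, adh L y & forall x, L x -> f x = rip x y.
Proof.
move=> L0 LP fP fC.
have f0 : f 0 = 0 by have := fP 1 0 0 L0 L0; rewrite scaler0 addr0 mul1r; lra.
pose g x := 2 * f x - sq x.
have gP x y t : L x -> L y ->
    g (t%:C%C *: y + x) = g x + 2 * t * (f y - rip y x) - t ^+ 2 * sq y.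
  by move=> Lx Ly; rewrite /g fP // sqD sqZr ripZl; ring.
have gub x : L x -> g x <= `|C|.
  move=> Lx; rewrite /g lerBlDr.
  have s0 : 0 <= `|C| + sq x by rewrite addr_ge0 ?sq_ge0.
  rewrite -(ger0_norm s0) -[leRHS]sqrtr_sqr; apply: (le_trans (ler_norm _)).
  rewrite -sqrtr_sqr; apply: ler_wsqrtr.
  have h : f x ^+ 2 <= `|C| * sq x.
    by apply: le_trans (fC x Lx) _; rewrite ler_wpM2r ?sq_ge0 // ler_norm.
  by have := sqr_ge0 (`|C| - sq x); rewrite !expr2 in h *; lra.
have gsup : has_sup (g @` L).
  by split; [exists (g 0), 0|exists `|C| => _ [x Lx <-]; exact: gub].
set S := sup (g @` L) in gsup.
have gS x : L x -> g x <= S by move=> Lx; apply: sup_upper_bound => //; exists x.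
have app (n : nat) : exists x, L x /\ S - n.+1%:R^-1 < g x.
  have n0 : 0 < n.+1%:R^-1 :> R by rewrite invr_gt0 ltr0n.
  have [_ [x Lx <-] h] := sup_adherent n0 gsup.
  by exists x.
have [u hu] := choice app.
have slope n y : L y -> (f y - rip y (u n)) ^+ 2 <= n.+1%:R^-1 * sq y.
  move=> Ly; rewrite mulrC; apply: quad_disc (sq_ge0 y) => t.
  have [Lu hS] := hu n; have := gS _ (LP (- t) _ _ Ly Lu); rewrite gP //.
  by rewrite sqrrN; move: (n.+1%:R^-1) hS => q; lra.
have [y hy] : exists y, cvgs u y.
  apply: hilbert_complete => e e0; have [N hN] := invn_small (divr_gt0 e0 (ltr0Sn R 3)).
  exists N => m n Nm Nn; have [Lm hm] := hu m; have [Ln hn] := hu n.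
  have LB : L (u m - u n) by have := LP (-1) _ _ Ln Lm; rewrite rmorphN1 scaleN1r addrC.
  (* Both lines test the midpoint of [u m] and [u n], expanded once around each of them: two
     near-maximizers of a strictly concave function are close. *)
  have := gS _ (LP (- 2^-1) _ _ LB Lm); rewrite gP //.
  have := gS _ (LP (2^-1) _ _ LB Ln); rewrite gP //.
  have := hN m Nm; have := hN n Nn.
  have -> : rip (u m - u n) (u m) = rip (u m - u n) (u n) + sq (u m - u n).
    by rewrite -ripxx -ripDr subrKC.
  by move: (n.+1%:R^-1) (m.+1%:R^-1) hm hn => p q; lra.
exists y.
  move=> e e0; have [N hN] := hy e e0; exists (u N); first by case: (hu N).
  by rewrite sqC; apply: hN.
move=> x Lx; apply/eqP; rewrite -subr_eq0 -sqrf_eq0 eq_le sqr_ge0 andbT.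
apply/ler_addgt0Pl => e e0; rewrite addr0.
have x1 : 0 < sq x + 1 by rewrite ltr_wpDl ?sq_ge0.
have d0 : 0 < e / (4 * (sq x + 1)) by rewrite divr_gt0 // mulr_gt0.
have [N hN] := hy _ d0; have [M hM] := invn_small d0.
pose n := maxn N M; have := slope n x Lx.
have := hN n (leq_maxl _ _); have := hM n (leq_maxr _ _).
have := rip_CS x (u n - y); rewrite ripBr.
set q := n.+1%:R^-1; set p := sq (u n - y); rewrite !ltr_pdivlMr ?mulr_gt0 // => h1 h2 h3 h4.
have q0 : 0 <= q by rewrite invr_ge0.
have p0 : 0 <= p by exact: sq_ge0.
have := sqr_ge0 ((f x - rip x (u n)) - (rip x (u n) - rip x y)).
by move: h1 h4; rewrite !expr2; lra.
Qed.

(** If y represents the functional of x on [L], then x - y is orthogonal to [L], hence to y and, by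
    hypothesis, to x; so x = y. *)
Lemma adh_criterion (L : set H) x :
  L 0 -> (forall t x y, L x -> L y -> L (t%:C%C *: x + y)) ->
  (forall z, (forall l, L l -> rip l z = 0) -> rip x z = 0) -> adh L x.
Proof.
move=> L0 LP h.
have [t u v Lu Lv|l Ll|y yL hy] := @real_riesz L (rip ^~ x) (sq x) L0 LP.
- by rewrite ripDl ripZl.
- by rewrite mulrC; exact: rip_CS.
have z0 l : L l -> rip l (x - y) = 0 by move=> Ll; rewrite ripBr hy // subrr.
suff -> : x = y by [].
apply/eqP; rewrite -subr_eq0; apply/eqP/sq_eq0.
by rewrite -ripxx ripBl (h _ z0) (rip_adh0 z0 yL) subrr.
Qed.

Lemma orth_decomposition (L : set H) x :
  L 0 -> (forall t x y, L x -> L y -> L (t%:C%C *: x + y)) ->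
  exists2 y, adh L y & forall l, L l -> rip l (x - y) = 0.
Proof.
move=> L0 LP.
have [t u v Lu Lv|l Ll|y yL hy] := @real_riesz L (rip ^~ x) (sq x) L0 LP.
- by rewrite ripDl ripZl.
- by rewrite mulrC; exact: rip_CS.
by exists y => // l Ll; rewrite ripBr hy // subrr.
Qed.

Lemma adjoint_rip a b : linear a -> (forall x y, rip (a x) y = rip x (b y)) -> adjoint a b.
Proof.
move=> al h x y; rewrite (ipE (a x)) h [RHS]ipE; congr Complex.
by rewrite -[LHS]opprK -ripi -linearZf // h ripi opprK.
Qed.

Lemma adjointC a b : adjoint a b -> adjoint b a.
Proof. by move=> h x y; rewrite ipC -h -ipC. Qed.

Lemma rip_adj a b x y : adjoint a b -> rip (a x) y = rip x (b y).
Proof. by move=> h; rewrite /rip /rform h. Qed.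

Lemma adjoint_uniq a b b' : adjoint a b -> adjoint a b' -> b = b'.
Proof.
move=> h h'; apply/funext => x; apply: ip_eq => z.
by rewrite ripC -(rip_adj _ _ h) (rip_adj _ _ h') ripC.
Qed.

Lemma adjoint_linear a b : adjoint a b -> linear b.
Proof.
move=> h c x y; apply: ip_eq => z; rewrite ripC [RHS]ripC /rip /rform -h.
by rewrite !ipDr !ipZr !h.
Qed.

Lemma bdd_adjoint a b C : 0 <= C -> adjoint a b -> bdd a C -> bdd b C.
Proof.
move=> C0 h aC x; have [->|bx] := eqVneq (sq (b x)) 0; first by rewrite mulr_ge0 ?sq_ge0.
have b0 : 0 < sq (b x) by rewrite lt_def bx sq_ge0.
rewrite -(ler_pM2l b0) -expr2 -{1}ripxx -(rip_adj _ _ h).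
apply: le_trans (rip_CS _ _) _; rewrite mulrCA mulrA.
by rewrite ler_wpM2r ?sq_ge0 //; exact: aC.
Qed.

Lemma bounded_adjoint a b : adjoint a b -> bounded_op a -> bounded_op b.
Proof.
move=> h /bounded_opP [al [C C0 aC]]; apply/bounded_opP; split.
  exact: adjoint_linear h.
by exists C => //; exact: bdd_adjoint h aC.
Qed.

Lemma adjoint_ex a : bounded_op a -> exists2 b, bounded_op b & adjoint a b.
Proof.
move=> /[dup] ab /bounded_opP [al [C C0 aC]].
have ex y : exists z, forall x, rip (a x) y = rip x z.
  have [//|//|t u v _ _|x _|z _ hz] := @real_riesz setT (fun x => rip (a x) y) (C * sq y).
  - by rewrite al ripDl ripZl.
  - apply: le_trans (rip_CS _ _) _; rewrite mulrAC.
    by rewrite ler_wpM2r ?sq_ge0 //; exact: aC.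
  by exists z => x; exact: hz.
have [b hb] := choice ex.
have adj : adjoint a b by apply: adjoint_rip.
by exists b => //; exact: bounded_adjoint adj ab.
Qed.

Lemma bounded_lin a : bounded_op a -> linear a. Proof. by case. Qed.

Lemma bounded_id : bounded_op (idfun : H -> H).
Proof.
apply/bounded_opP; split=> //; exists 1 => // x.
by rewrite mul1r.
Qed.

Lemma bounded_comb c a b : bounded_op a -> bounded_op b -> bounded_op (c *: a + b).
Proof.
move=> /bounded_opP [al [C C0 aC]] /bounded_opP [bl [D D0 bD]].
apply/bounded_opP; split.
  move=> d x y; rewrite !fctE al bl -!/(c *: a).
  change (c *: (d *: a x + a y) + (d *: b x + b y) = d *: (c *: a x + b x) + (c *: a y + b y)).
  by rewrite !scalerDr !scalerA [c * d]mulrC addrACA.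
pose k := complex.Re c ^+ 2 + complex.Im c ^+ 2.
have k0 : 0 <= k by rewrite addr_ge0 ?sqr_ge0.
exists (2 * (k * C) + 2 * D) => [|x]; first by rewrite addr_ge0 ?mulr_ge0.
have := sqD_le (c *: a x) (b x); rewrite sqZ -/k => /le_trans; apply.
have := bD x; have := ler_wpM2l k0 (aC x); lra.
Qed.

Lemma bounded_comp a b : bounded_op a -> bounded_op b -> bounded_op (a \o b).
Proof.
move=> /bounded_opP [al [C C0 aC]] /bounded_opP [bl [D D0 bD]].
apply/bounded_opP; split; first by move=> d x y /=; rewrite bl al.
exists (C * D) => [|x]; first by rewrite mulr_ge0.
by apply: le_trans (aC _) _; rewrite -mulrA ler_wpM2l.
Qed.

Lemma adjoint_comp a a' b b' : adjoint a a' -> adjoint b b' ->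
  adjoint (a \o b) (b' \o a').
Proof. by move=> ha hb x y /=; rewrite ha hb. Qed.

Lemma adjoint_comb c a a' b b' : adjoint a a' -> adjoint b b' ->
  adjoint (c *: a + b) (Num.conj c *: a' + b').
Proof.
move=> ha hb x y; change (ip (c *: a x + b x) y = ip x (Num.conj c *: a' y + b' y)).
by rewrite ipDl ipZl ipDr ipZr conjCK ha hb.
Qed.

End Operators.

(** * Positive operators *)

Section Positive.
Context {R : realType} {H : hilbertType R}.
Implicit Types (x y z : H) (t : R) (c : R[i]) (a b : H -> H).

Lemma pos_rip a x : positive_op a -> 0 <= rip (a x) x.
Proof. by move=> /(_ x); rewrite ipE lecE /= => /andP[]. Qed.

Lemma rip_pos a : adjoint a a -> (forall x, 0 <= rip (a x) x) -> positive_op a.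
Proof.
move=> aa h x; rewrite ipE lecE /= h andbT.
have := ipC (a x) x; rewrite -aa (ipE (a x) x) => -[] /eqP.
by rewrite -subr_eq0 opprK -mulr2n mulrn_eq0.
Qed.

(** Complex polarization: the imaginary part of [ip (a z) z] vanishes at z = x - i y. *)
Lemma pos_adj a : linear a -> positive_op a -> adjoint a a.
Proof.
move=> al ap; apply: adjoint_rip => // x y.
have h z : rip (a z) ('i%C *: z) = 0.
  by have := ap z; rewrite ipE lecE /= => /andP[/eqP].
have ii : 'i%C *: ('i%C *: - y) = y.
  by rewrite scalerA -expr2 sqr_i scaleN1r opprK.
have := h (x + 'i%C *: - y).
rewrite linearDf // scalerDr !ripDl !ripDr !h add0r addr0 ii.
by rewrite linearZf // ripii linearNf // ripNl (ripC (a y)); lra.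
Qed.

Lemma op_form_psd a : linear a -> positive_op a -> psd_form (fun x y => ip (a x) y).
Proof.
move=> al ap; split=> [x y z|c x y|x y|x].
- by rewrite linearDf // ipDl.
- by rewrite linearZf // ipZl.
- by rewrite (pos_adj al ap) ipC.
- exact: ap.
Qed.

Lemma pos_CS a x y : linear a -> positive_op a ->
  rip (a x) y ^+ 2 <= rip (a x) x * rip (a y) y.
Proof. by move=> al ap; exact: (rform_CS (op_form_psd al ap)). Qed.

(** That 0 <= a <= C implies a^2 <= C a: Cauchy-Schwarz for the form of [a] at [x] and [a x]. *)
Lemma pos_sq a (C : R) x : linear a -> positive_op a ->
  (forall x, rip (a x) x <= C * sq x) -> sq (a x) <= C * rip (a x) x.
Proof.
move=> al ap aC; have [->|ax] := eqVneq (sq (a x)) 0.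
  have [C0|C0] := leP 0 C; first by rewrite mulr_ge0 ?pos_rip.
  have := aC x; have := pos_rip x ap; have := sq_ge0 x => h1 h2 h3.
  have -> : rip (a x) x = 0 by apply/eqP; rewrite eq_le h2 andbT; apply: le_trans h3 _; rewrite nmulr_rle0.
  by rewrite mulr0.
have a0 : 0 < sq (a x) by rewrite lt_def ax sq_ge0.
rewrite -(ler_pM2l a0) -expr2 -{1}ripxx.
apply: le_trans (pos_CS _ _ al ap) _.
by rewrite mulrC [leRHS]mulrA ler_wpM2r ?pos_rip // mulrC; exact: aC.
Qed.

Lemma bounded_rip a : bounded_op a -> exists2 C, 0 <= C & forall x, `|rip (a x) x| <= C * sq x.
Proof.
move=> /bounded_opP [al [C C0 aC]]; exists (C + 1) => [|x]; first by rewrite addr_ge0.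
have := aC x; have := sq_ge0 x; have := sq_ge0 (a x + x); have := sq_ge0 (a x - x).
rewrite sqB sqD => h1 h2 h3 h4.
by rewrite ler_norml; apply/andP; split; lra.
Qed.

Definition ole a b := forall x, rip (a x) x <= rip (b x) x.

Lemma oleP a b : adjoint a a -> adjoint b b -> op_le a b <-> ole a b.
Proof.
move=> aa bb; split=> [h x|h].
  have := pos_rip x h; change (0 <= rip (b x - a x) x -> rip (a x) x <= rip (b x) x).
  by rewrite ripBl subr_ge0.
apply: rip_pos => [|x].
  move=> x y; change (ip (b x - a x) y = ip x (b y - a y)).
  by rewrite ipDl ipNl ipDr ipNr aa bb.
change (0 <= rip (b x - a x) x).
by rewrite ripBl subr_ge0.
Qed.

Lemma rip_lim_le x y (k : R) :
  (forall e, 0 < e -> exists2 x', sq (x - x') < e & k <= rip x' y) -> k <= rip x y.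
Proof.
move=> h; apply/ler_addgt0Pl => e e0.
have y1 : 0 < sq y + 1 by rewrite ltr_wpDl ?sq_ge0.
have [x' hx kx] := h _ (divr_gt0 (exprn_gt0 2 e0) y1).
apply: le_trans kx _; rewrite -lerBlDr -ripBl.
apply: le_trans (ler_norm _) _; rewrite -(ger0_norm (ltW e0)) -ler_sqr ?nnegrE //.
rewrite !real_normK ?num_real //; apply: le_trans (rip_CS _ _) _.
rewrite sqC; move: hx; rewrite ltr_pdivlMr // => /ltW; apply: le_trans.
by rewrite ler_wpM2l ?sq_ge0 // lerDl.
Qed.

End Positive.

(** * Elementary operations in a von Neumann algebra, and resolvents *)

Section VonNeumann.
Context {R : realType} {H : hilbertType R}.
Implicit Types (x y z : H) (t : R) (c : R[i]) (a b : H -> H).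

Lemma commutant_anti (S T : set (H -> H)) : S `<=` T -> commutant T `<=` commutant S.
Proof. by move=> ST b [bb bT]; split=> // a /ST; exact: bT. Qed.

Lemma bicommutant_sub (S : set (H -> H)) :
  (forall a, S a -> bounded_op a) -> S `<=` commutant (commutant S).
Proof. by move=> Sb a Sa; split; [exact: Sb|move=> b [_ bS]; rewrite bS]. Qed.

Lemma commutant_adj (S : set (H -> H)) :
  (forall a, S a -> exists2 b, S b & adjoint a b) ->
  forall a, commutant S a -> exists2 b, commutant S b & adjoint a b.
Proof.
move=> Sadj a [ab aS]; have [a' ab' aa'] := adjoint_ex ab; exists a' => //; split=> // s Ss.
have [s' Ss' ss'] := Sadj s Ss.
apply: (@adjoint_uniq _ _ (a \o s')); first exact: adjoint_comp aa' (adjointC ss').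
by rewrite -(aS _ Ss'); exact: adjoint_comp (adjointC ss') aa'.
Qed.

Lemma bicommutant_vn (S : set (H -> H)) :
  (forall a, S a -> exists2 b, S b & adjoint a b) ->
  (forall a, S a -> bounded_op a) -> von_neumann (commutant (commutant S)).
Proof.
move=> Sadj Sb; split.
  by apply: commutant_adj; exact: commutant_adj.
apply/seteqP; split; first by apply/commutant_anti/bicommutant_sub => a [].
by apply: bicommutant_sub => a [].
Qed.

Variable M : set (H -> H).
Hypothesis vM : von_neumann M.

Lemma vn_bounded a : M a -> bounded_op a.
Proof. by case: vM => _ <- []. Qed.

Lemma vn_linear a : M a -> linear a.
Proof. by move/vn_bounded/bounded_lin. Qed.

Lemma vn_intro a : bounded_op a -> (forall b, commutant M b -> b \o a = a \o b) -> M a.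
Proof. by move=> ab h; case: vM => _ <-; split. Qed.

Lemma vn_comm a b x : M a -> commutant M b -> b (a x) = a (b x).
Proof. by move=> Ma [_ /(_ a Ma)] h; rewrite -[LHS]/((b \o a) x) -h. Qed.

Lemma vn_id : M idfun.
Proof. by apply: vn_intro; [exact: bounded_id|move=> b _; apply/funext]. Qed.

Lemma vn_comb c a b : M a -> M b -> M (c *: a + b).
Proof.
move=> Ma Mb; apply: vn_intro; first by apply: bounded_comb; exact: vn_bounded.
move=> d dM; apply/funext => x; have dl := bounded_lin (proj1 dM).
change (d (c *: a x + b x) = c *: a (d x) + b (d x)).
by rewrite dl (vn_comm x Ma dM) (vn_comm x Mb dM).
Qed.

Lemma vn_comp a b : M a -> M b -> M (a \o b).
Proof.
move=> Ma Mb; apply: vn_intro; first by apply: bounded_comp; exact: vn_bounded.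
by move=> d dM; apply/funext => x /=; rewrite (vn_comm _ Ma dM) (vn_comm _ Mb dM).
Qed.

Lemma vn_adj a : M a -> exists2 b, M b & adjoint a b.
Proof. by case: vM => h _; exact: h. Qed.

Lemma vn_adj' a b : M a -> adjoint a b -> M b.
Proof. by move=> Ma ab; have [b' Mb' /(adjoint_uniq ab) ->] := vn_adj Ma. Qed.

Lemma vn_scale c a : M a -> M (c *: a).
Proof.
move=> Ma; have := vn_comb c Ma (vn_comb (-1) vn_id vn_id).
by rewrite scaleN1r addNr addr0.
Qed.

Lemma vn_add a b : M a -> M b -> M (a + b).
Proof. by move=> Ma Mb; rewrite -[a]scale1r; exact: vn_comb. Qed.

Lemma vn_sub a b : M a -> M b -> M (a - b).
Proof. by move=> Ma Mb; rewrite addrC -scaleN1r; exact: vn_comb. Qed.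

Lemma vn_0 : M 0.
Proof. by rewrite -(subrr idfun); apply: vn_sub; exact: vn_id. Qed.

Lemma vn_iter_comp a n : M a -> M (iter n (fun b => a \o b) idfun).
Proof. by move=> Ma; elim: n => [|n IH] /=; [exact: vn_id|exact: vn_comp]. Qed.

(** To see that [a] commutes with [b] at [x], approximation at the two vectors [x] and [b x]
    suffices; hence a pair of vectors in the hypothesis. *)
Lemma vn_strong a : bounded_op a ->
  (forall x y e, 0 < e -> exists2 m, M m & sq (m x - a x) < e /\ sq (m y - a y) < e) -> M a.
Proof.
move=> ab h; apply: vn_intro => // b bM; apply/funext => x /=.
apply/eqP; rewrite -subr_eq0; apply/eqP/sq_le_small => e e0.
have /bounded_opP [bl [C C0 bC]] := proj1 bM.
have C1 : 0 < C + 1 by rewrite ltr_wpDl.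
have d0 : 0 < e / (4 * (C + 1)) by rewrite divr_gt0 // mulr_gt0.
have [m Mm [h1 h2]] := h x (b x) _ d0.
rewrite -(subrKA (b (m x))) -linearBf // (vn_comm _ Mm bM).
apply: le_trans (sqD_le _ _) _; have := bC (a x - m x); rewrite sqC in h1.
move: h1 h2; rewrite !ltr_pdivlMr ?mulr_gt0 //.
have := sq_ge0 (m (b x) - a (b x)); have := sq_ge0 (a x - m x).
set p := sq (a x - m x); set q := sq (m (b x) - _); set s := sq (b _) => p0 q0 h1 h2 h3.
have := mulr_ge0 C0 q0; have := mulr_ge0 C0 p0; lra.
Qed.

(** [T] is 1 + y. Since |x| <= |T x|, it is injective with closed range; a vector z orthogonal to
    the range satisfies |z|^2 <= <T z, z> = 0, so the range is dense. *)
Lemma resolvent_ex (y : H -> H) : M y -> positive_op y -> exists r, [/\ M r, positive_op r,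
  forall h, r h + y (r h) = h & forall h, r (h + y h) = h].
Proof.
move=> My yp; have yl := vn_linear My; have /bounded_opP [_ [C C0 yC]] := vn_bounded My.
pose T x := x + y x.
have Tl : linear T by move=> c u v; rewrite /T yl scalerDr addrACA.
have Tge x : sq x <= sq (T x).
  by rewrite /T sqD; have := pos_rip x yp; rewrite ripC; have := sq_ge0 (y x); lra.
have Tinj u v : T u = T v -> u = v.
  move=> uv; apply/eqP; rewrite -subr_eq0; apply/eqP/sq_eq0/eqP.
  rewrite eq_le sq_ge0 andbT; apply: le_trans (Tge _) _.
  by rewrite linearBf // uv subrr sq0.
have Tsur h : exists x, T x = h.
  have hT : adh (range T) h.
    apply: adh_criterion.
    - by exists 0 => //; rewrite linear0f.
    - by move=> t _ _ [u _ <-] [v _ <-]; exists (t%:C%C *: u + v) => //; rewrite Tl.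
    move=> z hz; suff -> : z = 0 by rewrite rip0r.
    apply: sq_eq0; apply/eqP; rewrite eq_le sq_ge0 andbT.
    have := hz (T z); rewrite /T ripDl => <-; last by exists z.
    by rewrite ripxx lerDl; exact: pos_rip.
  have ex (n : nat) : exists x, sq (h - T x) < n.+1%:R^-1.
    have n0 : 0 < n.+1%:R^-1 :> R by rewrite invr_gt0 ltr0n.
    by have [_ [x _ <-] hx] := hT _ n0; exists x.
  have [u hu] := choice ex.
  have [x ux] : exists x, cvgs u x.
    apply: hilbert_complete => e e0; have [N hN] := invn_small (divr_gt0 e0 (ltr0Sn R 3)).
    exists N => m n Nm Nn; apply: le_lt_trans (Tge _) _; rewrite linearBf //.
    apply: (@sq_tri _ _ _ h); last exact: lt_trans (hu n) (hN n Nn).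
    by rewrite sqC; exact: lt_trans (hu m) (hN m Nm).
  exists x; apply/eqP; rewrite -subr_eq0; apply/eqP/sq_le_small => e e0; apply/ltW.
  have C1 : 0 < C + 1 by rewrite ltr_wpDl.
  have d0 : 0 < e / 4 / (2 * (C + 1)) by rewrite !divr_gt0 // mulr_gt0.
  have [N hN] := ux _ d0; have [K hK] := invn_small (divr_gt0 e0 (ltr0Sn R 3)).
  pose n := maxn N K.
  apply: (@sq_tri _ _ _ (T (u n))); last first.
    by rewrite sqC; exact: lt_trans (hu n) (hK n (leq_maxr _ _)).
  rewrite -linearBf //; have := hN n (leq_maxl _ _); rewrite ltr_pdivlMr ?mulr_gt0 // sqC.
  apply: le_lt_trans; rewrite /T; apply: le_trans (sqD_le _ _) _.
  by have := yC (x - u n); lra.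
have [r hr] := choice Tsur.
have rT h : r (T h) = h by apply: Tinj; rewrite hr.
have rl : linear r by move=> c u v; apply: Tinj; rewrite Tl !hr.
have rb : bounded_op r.
  apply/bounded_opP; split=> //; exists 1 => // h.
  by rewrite mul1r -{2}(hr h); exact: Tge.
have yadj := pos_adj yl yp.
have radj : adjoint r r.
  apply: adjoint_rip => // u v; rewrite -{2}(hr u) -{1}(hr v) /T ripDl ripDr.
  by rewrite (rip_adj _ _ yadj).
exists r; split.
- apply: vn_intro => // b bM; apply/funext => h /=; apply: Tinj; rewrite hr /T.
  by rewrite -(vn_comm _ My bM) -(linearDf _ _ (bounded_lin (proj1 bM))) -[r h + _]/(T (r h)) hr.
- apply: rip_pos => // h; rewrite -{2}(hr h) /T ripDr addr_ge0 ?sq_ge0 //.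
  by rewrite ripC; exact: pos_rip.
- exact: hr.
- exact: rT.
Qed.

End VonNeumann.

Section Vigier.
Context {R : realType} {H : hilbertType R}.
Implicit Types (x y z h : H) (a b r : H -> H).

(* for invertible [T >= 0], [<T^-1 h, h>] is the maximum of [2 <h, x> - <T x, x>] *)
Lemma resolvent_anti a b r s : linear a -> positive_op a -> ole a b ->
  (forall h, r h + a (r h) = h) -> (forall h, s h + b (s h) = h) ->
  ole s r.
Proof.
move=> al ap ab rE sE h; pose w := r h; pose x := s h.
have := pos_rip (w - x) ap; have := sq_ge0 (w - x); have := ab x.
have e1 : rip h w = sq w + rip (a w) w by rewrite -{1}(rE h) ripDl.
have e2 : rip h x = sq x + rip (b x) x by rewrite -{1}(sE h) ripDl.
have e3 : rip h x = rip w x + rip (a w) x by rewrite -{1}(rE h) ripDl.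
have aa := pos_adj al ap.
rewrite sqB linearBf // ripBl !ripBr (rip_adj x w aa) (ripC x (a w)) => h1 h2 h3.
change (rip x h <= rip w h); rewrite (ripC x h) (ripC w h); lra.
Qed.

Variable M : set (H -> H).
Hypothesis vM : von_neumann M.

(** Vigier's theorem. At each [x] the values [rip (d x) x] approach their supremum, and [pos_sq]
    turns closeness of these values into closeness of the vectors [d x]. *)
Lemma vigier (D : set (H -> H)) u :
  D `<=` self_adjoint_part M -> up_directed op_le D ->
  self_adjoint_part M u -> (forall d, D d -> op_le d u) ->
  exists t, [/\ self_adjoint_part M t, forall d, D d -> ole d t
    & forall x (e : R), 0 < e -> exists2 d, D d & rip (t x) x - rip (d x) x < e].
Proof.
move=> DM [[d0 Dd0] dir] [Mu uu] Du.
have DMb d : D d -> M d by move=> /DM [].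
have Dadj d : D d -> adjoint d d by move=> /DM [].
have Dlin d : D d -> linear d by move=> /DMb /(vn_linear vM).
have Dole c d : D c -> D d -> op_le c d -> ole c d.
  by move=> Dc Dd; rewrite (oleP (Dadj _ Dc) (Dadj _ Dd)).
have Du' d : D d -> ole d u by move=> Dd; rewrite -(oleP (Dadj _ Dd) uu); exact: Du.
(* [K] bounds u - d0, hence every difference c - d with d0 <= d <= c in [D]. *)
have [K K0 hK] : exists2 K, 0 <= K & forall x, rip (u x) x - rip (d0 x) x <= K * sq x.
  have [C C0 hC] := bounded_rip (vn_bounded vM (vn_sub vM Mu (DMb _ Dd0))).
  exists C => // x; rewrite -ripBl; exact: le_trans (ler_norm _) (hC x).
have gap c d x : D c -> D d -> ole d0 d -> ole d c ->
    sq (c x - d x) <= K * (rip (c x) x - rip (d x) x).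
  move=> Dc Dd d0d dc; rewrite -ripBl.
  change (sq ((c - d) x) <= K * rip ((c - d) x) x); apply: pos_sq.
  - exact: (vn_linear vM (vn_sub vM (DMb _ Dc) (DMb _ Dd))).
  - by apply/oleP => //; exact: Dadj.
  move=> y; change (rip (c y - d y) y <= K * sq y); rewrite ripBl.
  by have := hK y; have := Du' _ Dc y; have := d0d y; lra.
have up2 c d : D c -> D d -> exists e, [/\ D e, ole c e & ole d e].
  move=> Dc Dd; have [e [De ce de]] := dir _ _ Dc Dd.
  by exists e; split=> //; apply: Dole.
have lim x : exists t, forall e : R, 0 < e ->
    exists2 d, D d & forall c, D c -> ole d c -> sq (c x - t) < e.
  pose A := [set rip (d x) x | d in D].
  have supA : has_sup A.
    split; first by exists (rip (d0 x) x), d0.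
    by exists (rip (u x) x) => _ [d Dd <-]; exact: Du'.
  have vex (n : nat) : exists d, [/\ D d, ole d0 d & sup A - rip (d x) x < n.+1%:R^-1].
    have n0 : 0 < n.+1%:R^-1 :> R by rewrite invr_gt0 ltr0n.
    have [_ [d Dd <-] hd] := sup_adherent n0 supA.
    have [e [De d0e de]] := up2 _ _ Dd0 Dd; exists e; split=> //.
    by have := de x; move: (n.+1%:R^-1) hd => q; lra.
  have [v hv] := choice vex.
  have dist n c : D c -> ole (v n) c -> sq (c x - v n x) <= K * n.+1%:R^-1.
    move=> Dc vc; have [Dv dv hn] := hv n; apply: le_trans (gap _ _ _ Dc Dv dv vc) _.
    rewrite ler_wpM2l //; apply: le_trans (ltW hn).
    by rewrite lerD2r; apply: sup_upper_bound => //; exists c.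
  have small e : 0 < e -> exists N, forall n, (N <= n)%N -> K * n.+1%:R^-1 < e.
    move=> e0; have K1 : 0 < K + 1 by rewrite ltr_wpDl.
    have [N hN] := invn_small (divr_gt0 e0 K1); exists N => n Nn.
    have := hN n Nn; rewrite ltr_pdivlMr // mulrC; apply: le_lt_trans.
    by rewrite ler_wpM2r ?invr_ge0 // lerDl.
  (* The [v n] need not increase; two of them are compared through a common upper bound in [D]. *)
  have [t ht] : exists t, cvgs (fun n => v n x) t.
    apply: hilbert_complete => e e0; have [N hN] := small _ (divr_gt0 e0 (ltr0Sn R 3)).
    exists N => m n Nm Nn; have [[Dm _ _] [Dn _ _]] := (hv m, hv n).
    have [c [Dc mc nc]] := up2 _ _ Dm Dn; apply: (@sq_tri _ _ _ (c x)).
      by rewrite sqC; exact: le_lt_trans (dist m c Dc mc) (hN m Nm).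
    exact: le_lt_trans (dist n c Dc nc) (hN n Nn).
  exists t => e e0; have e4 := divr_gt0 e0 (ltr0Sn R 3).
  have [N hN] := small _ e4; have [P hP] := ht _ e4; pose n := maxn N P.
  have [Dn _ _] := hv n; exists (v n) => // c Dc nc; apply: (@sq_tri _ _ _ (v n x)).
    exact: le_lt_trans (dist n c Dc nc) (hN n (leq_maxl _ _)).
  exact: hP n (leq_maxr _ _).
have [t ht] := choice lim.
(* A single element of [D] close to [t] at two vectors; linearity, symmetry and bounds pass to [t]
   through it. *)
have app2 x y e d : 0 < e -> D d -> exists c,
    [/\ D c, ole d c, sq (c x - t x) < e & sq (c y - t y) < e].
  move=> e0 Dd; have [d1 D1 h1] := ht x e e0; have [d2 D2 h2] := ht y e e0.
  have [c1 [Dc1 a1 a2]] := up2 _ _ D1 D2; have [c [Dc b1 b2]] := up2 _ _ Dc1 Dd.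
  exists c; split=> //; first by apply: h1 => // z; exact: le_trans (a1 z) (b1 z).
  by apply: h2 => // z; exact: le_trans (a2 z) (b1 z).
have tlin : linear t.
  move=> c x y; apply/eqP; rewrite -subr_eq0; apply/eqP/sq_le_small => e e0.
  pose k := complex.Re c ^+ 2 + complex.Im c ^+ 2.
  have k0 : 0 <= k by rewrite addr_ge0 ?sqr_ge0.
  have q0 : 0 < 4 * (2 * k + 3) by rewrite mulr_gt0 // ltr_wpDl // mulr_ge0.
  have d'0 := divr_gt0 e0 q0.
  have [d [Dd _ h1 h2]] := app2 x y _ _ d'0 Dd0.
  have [f [Df df h3 _]] := app2 (c *: x + y) 0 _ _ d'0 Dd.
  have [d1 D1 h1'] := ht x _ d'0; have [d2 D2 h2'] := ht y _ d'0.
  have [c1 [Dc1 a1 a2]] := up2 _ _ D1 D2.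
  have [g [Dg b1 hg _]] := app2 (c *: x + y) 0 _ _ d'0 Dc1.
  have {h1'} g1 : sq (g x - t x) < e / (4 * (2 * k + 3)).
    by apply: h1' => // z; exact: le_trans (a1 z) (b1 z).
  have {h2'} g2 : sq (g y - t y) < e / (4 * (2 * k + 3)).
    by apply: h2' => // z; exact: le_trans (a2 z) (b1 z).
  have -> : t (c *: x + y) - (c *: t x + t y) =
     (t (c *: x + y) - g (c *: x + y)) + (c *: (g x - t x) + (g y - t y)).
    by rewrite (Dlin _ Dg) scalerBr (addrACA (c *: g x)) -opprD subrKA.
  apply: le_trans (sqD_le _ _) _; rewrite sqC.
  have := sqD_le (c *: (g x - t x)) (g y - t y); rewrite sqZ -/k.
  move: hg g1 g2; rewrite !ltr_pdivlMr //.
  set p := sq (g _ - _); set q := sq (g x - t x); set s := sq (g y - t y) => h4 h5 h6 h7.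
  have p0 : 0 <= p := sq_ge0 _; have q1 : 0 <= q := sq_ge0 _; have s0 : 0 <= s := sq_ge0 _.
  have := mulr_ge0 k0 p0; have := mulr_ge0 k0 q1; have := mulr_ge0 k0 s0; lra.
have tadj : adjoint t t.
  apply: adjoint_rip => // x y; apply/eqP; rewrite -subr_eq0 -sqrf_eq0 eq_le sqr_ge0 andbT.
  apply/ler_addgt0Pl => e e0; rewrite addr0.
  pose k := sq x + sq y + 1; have k0 : 0 < k by rewrite ltr_wpDl // addr_ge0 ?sq_ge0.
  have e'0 : 0 < e / (4 * k) by rewrite divr_gt0 // mulr_gt0.
  have [c [Dc _ hx hy]] := app2 x y _ _ e'0 Dd0.
  have -> : rip (t x) y - rip x (t y) = - rip (c x - t x) y + rip x (c y - t y).
    by rewrite ripBl ripBr (rip_adj _ _ (Dadj _ Dc)); ring.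
  have := rip_CS (c x - t x) y; have := rip_CS x (c y - t y).
  move: hx hy; rewrite !ltr_pdivlMr ?mulr_gt0 // /k.
  set p := sq (c x - _); set q := sq (c y - _); set a := rip _ _; set b := rip _ _.
  have p0 : 0 <= p := sq_ge0 _; have q0 : 0 <= q := sq_ge0 _.
  have := sqr_ge0 (a + b); have := sq_ge0 x; have := sq_ge0 y; rewrite !expr2 => x0 y0.
  have := mulr_ge0 p0 x0; have := mulr_ge0 p0 y0; have := mulr_ge0 q0 x0; have := mulr_ge0 q0 y0.
  lra.
have dt d : D d -> ole d t.
  move=> Dd x; apply: rip_lim_le => e e0.
  have [c [Dc dc h _]] := app2 x x _ _ e0 Dd; exists (c x); last exact: dc.
  by rewrite sqC.
have tu : ole t u.
  move=> x; rewrite -lerN2 -[leRHS]ripNl; apply: rip_lim_le => e e0.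
  have [c [Dc dc h _]] := app2 x x _ _ e0 Dd0; exists (- c x).
    by rewrite opprK addrC.
  by rewrite ripNl lerN2; exact: Du'.
have tb : bounded_op t.
  have d0b := vn_bounded vM (DMb _ Dd0).
  have tdl : linear (t - d0).
    move=> c x y; change (t (c *: x + y) - d0 (c *: x + y) = c *: (t x - d0 x) + (t y - d0 y)).
    by rewrite tlin (Dlin _ Dd0) scalerBr addrACA -opprD.
  have tdp : positive_op (t - d0) by apply/oleP; [exact: Dadj|exact: tadj|exact: dt].
  have tdK x : rip ((t - d0) x) x <= K * sq x.
    change (rip (t x - d0 x) x <= K * sq x); rewrite ripBl.
    by have := hK x; have := tu x; lra.
  rewrite -(subrK d0 t) -[t - d0]scale1r; apply: bounded_comb => //.
  apply/bounded_opP; split=> //; exists (K * K) => [|x]; first by rewrite mulr_ge0.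
  apply: le_trans (pos_sq x tdl tdp tdK) _.
  by rewrite -mulrA ler_wpM2l.
exists t; split=> //.
  split=> //; apply: vn_strong => // x y e e0.
  by have [c [Dc _ hx hy]] := app2 x y _ _ e0 Dd0; exists c => //; exact: DMb.
move=> x e e0; have x1 : 0 < sq x + 1 by rewrite ltr_wpDl ?sq_ge0.
have [c [Dc _ hx _]] := app2 x x _ _ (divr_gt0 (exprn_gt0 2 e0) x1) Dd0.
exists c => //; rewrite -ripBl; apply: le_lt_trans (ler_norm _) _.
rewrite -(ger0_norm (ltW e0)) -ltr_sqr ?nnegrE // !real_normK ?num_real //.
apply: le_lt_trans (rip_CS _ _) _; rewrite sqC; move: hx; rewrite ltr_pdivlMr //.
by apply: le_lt_trans; rewrite ler_wpM2l ?sq_ge0 // lerDl.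
Qed.

(** A supremum in [M] lies below the strong limit given by [vigier]. This is the bridge between
    order-theoretic suprema and vectors. *)
Lemma lub_approx (D : set (H -> H)) s :
  D `<=` self_adjoint_part M -> up_directed op_le D ->
  is_lub (self_adjoint_part M) op_le D s ->
  forall x (e : R), 0 < e -> exists2 d, D d & rip (s x) x - rip (d x) x < e.
Proof.
move=> DM dir [[Ms ss] Ds smin].
have [t [[Mt tt] Dt tapp]] := vigier DM dir (conj Ms ss) Ds.
have st : op_le s t.
  by apply: smin => // d Dd; apply/oleP => //; [case: (DM d Dd)|exact: Dt].
move=> x e e0; have [d Dd hd] := tapp x e e0; exists d => //.
by move: st; rewrite (oleP ss tt) => /(_ x); lra.
Qed.

Lemma lub_ex (D : set (H -> H)) u :
  D `<=` self_adjoint_part M -> up_directed op_le D ->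
  self_adjoint_part M u -> (forall d, D d -> op_le d u) ->
  exists t, is_lub (self_adjoint_part M) op_le D t.
Proof.
move=> DM dir Mu Du; have [t [tM Dt tapp]] := vigier DM dir Mu Du.
exists t; split=> // [d Dd|v [Mv vv] Dv].
  by apply/oleP; [case: (DM d Dd)|case: tM|exact: Dt].
apply/oleP => //; first by case: tM.
move=> x; apply/ler_addgt0Pl => e e0; have [d Dd hd] := tapp x e e0.
have := Dv d Dd; rewrite (oleP (proj2 (DM d Dd)) vv) => /(_ x); lra.
Qed.

End Vigier.

(** * Completely positive maps and states *)

Lemma conjR (R : realType) (t : R) : Num.conj (t%:C%C : R[i]) = t%:C%C.
Proof. exact: conjc_real. Qed.

Lemma Re_ip (R : realType) (H : hilbertType R) (x y : H) : complex.Re (ip x y) = rip x y.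
Proof. by []. Qed.

Section Adj.
Context {R : realType} {H : hilbertType R}.
Implicit Types (x y z : H) (a b : H -> H).

(** A total function, so that adjoints can occur in formulas; bounded operators always have an
    adjoint, and the default is never met on them. *)
Definition adj a : H -> H :=
  if pselect (exists b, adjoint a b) is left e then projT1 (cid e) else idfun.

Lemma adjE a b : adjoint a b -> adj a = b.
Proof.
move=> h; rewrite /adj; case: pselect => [e|[]]; last by exists b.
exact: adjoint_uniq (projT2 (cid e)) h.
Qed.

Lemma adjP a : bounded_op a -> adjoint a (adj a).
Proof. by move=> /adjoint_ex [b _ ab]; rewrite (adjE ab). Qed.

Lemma op_ext a b : linear a -> linear b ->
  (forall x, rip (a x) x = rip (b x) x) ->
  (forall x, rip (a x) ('i%C *: x) = rip (b x) ('i%C *: x)) -> a = b.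
Proof.
move=> al bl h hi; apply/funext => x; apply: ip_eq => y.
have ii : 'i%C *: ('i%C *: y) = - y by rewrite scalerA -expr2 sqr_i scaleN1r.
have := h (x + y); have := hi (x + 'i%C *: y).
rewrite !(linearDf _ _ al, linearDf _ _ bl) !scalerDr !ripDl !ripDr !h !hi.
rewrite ii !(linearZf _ _ al, linearZf _ _ bl) !ripii !ripNr; lra.
Qed.

End Adj.

Section VNAdj.
Context {R : realType} {H : hilbertType R} {M : set (H -> H)}.
Hypothesis vM : von_neumann M.
Implicit Types (a b : H -> H).

Lemma vn_adjP a : M a -> adjoint a (adj a).
Proof. by move=> /(vn_bounded vM)/adjP. Qed.

Lemma vn_adjM a : M a -> M (adj a).
Proof. by move=> Ma; apply: (vn_adj' vM Ma); exact: vn_adjP. Qed.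

Lemma adj_adj a : M a -> adj (adj a) = a.
Proof. by move=> Ma; apply/adjE/adjointC/vn_adjP. Qed.

Lemma adj_comp a b : M a -> M b -> adj (a \o b) = adj b \o adj a.
Proof. by move=> Ma Mb; apply/adjE/adjoint_comp; exact: vn_adjP. Qed.

Lemma adj_comb c a b : M a -> M b -> adj (c *: a + b) = Num.conj c *: adj a + adj b.
Proof. by move=> Ma Mb; apply/adjE/adjoint_comb; exact: vn_adjP. Qed.

Lemma adj_id : adj (idfun : H -> H) = idfun.
Proof. exact: adjE. Qed.

Lemma adj_comp_pos a : M a -> positive_op (adj a \o a).
Proof.
by move=> Ma x /=; rewrite (adjointC (vn_adjP Ma)) ipxx ler0c sq_ge0.
Qed.

Lemma rip_adjl a x y : M a -> rip (adj a x) y = rip x (a y).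
Proof. by move=> Ma; rewrite (rip_adj _ _ (adjointC (vn_adjP Ma))). Qed.

End VNAdj.

(** * Unital completely positive maps: Kadison-Schwarz and the multiplicative domain *)

Section UCP.
Context {R : realType} {H K : hilbertType R}.
Context {M : set (H -> H)} {N : set (K -> K)} {f : (H -> H) -> (K -> K)}.
Hypotheses (vM : von_neumann M) (vN : von_neumann N) (uf : ucp_map M N f).
Implicit Types (a b : H -> H).

Lemma ucpM a : M a -> N (f a). Proof. exact: (ucp_fun uf). Qed.

Lemma ucpD a b : M a -> M b -> f (a + b) = f a + f b.
Proof. by move=> Ma Mb; have := ucp_linear uf 1 Ma Mb; rewrite !scale1r. Qed.

Lemma ucp0 : f 0 = 0.
Proof.
have M0 := vn_0 vM; apply: (addIr (f 0)).
by rewrite add0r -ucpD // addr0.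
Qed.

Lemma ucpZ c a : M a -> f (c *: a) = c *: f a.
Proof.
move=> Ma; have := ucp_linear uf c Ma (vn_0 vM).
by rewrite ucp0 !addr0.
Qed.

Lemma ucpB a b : M a -> M b -> f (a - b) = f a - f b.
Proof.
move=> Ma Mb; have := ucpD Ma (vn_scale vM (-1) Mb).
by rewrite ucpZ // !scaleN1r.
Qed.

Lemma ucp_pos a : M a -> positive_op a -> positive_op (f a).
Proof.
move=> Ma ap x.
have := ucp_cp uf (n := 1) (A := \matrix_(i, j) a).
move/(_ (fun i j => _)) => h.
have := h _ _ (fun=> x).
rewrite !big_ord1 !mxE; apply; first by move=> i j; rewrite mxE.
by move=> y; rewrite !big_ord1 !mxE; exact: ap.
Qed.

(** Complete positivity for the matrix with rows 1, [a] and [adj a], [adj a \o a], which is positive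
    as the adjoint of the row (1, a) times that row. *)
Lemma ucp_form2 a (x y : K) : M a ->
  0 <= ip x x + ip (f a y) x + (ip (f (adj a) x) y + ip (f (adj a \o a) y) y).
Proof.
move=> Ma; have aa := vn_adjP vM Ma.
pose A : 'M[H -> H]_2 := \matrix_(i, j)
  if i == 0 then if j == 0 then idfun else a
  else if j == 0 then adj a else adj a \o a.
have AM i j : M (A i j).
  rewrite mxE; case: ifP => _; case: ifP => _ //.
  - exact: vn_id.
  - exact: vn_adjM.
  - by apply: vn_comp => //; exact: vn_adjM.
have Ap : positive_opmx A.
  move=> u; rewrite !big_ord_recl !big_ord0 !mxE /= !addr0.
  set p := u 0; set q := u _.
  rewrite !(adjointC aa) (ipC (a q)).
  suff -> : ip p p + Num.conj (ip p (a q)) + (ip p (a q) + ip (a q) (a q)) =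
            ip (p + a q) (p + a q) by rewrite ipxx ler0c sq_ge0.
  by rewrite ipDl !ipDr -ipC; ring.
have := ucp_cp uf AM Ap (fun i => if i == 0 then x else y).
by rewrite !big_ord_recl !big_ord0 !mxE /= !addr0 (ucp_unital uf).
Qed.

(** The expression of [ucp_form2] is real; the vanishing of its imaginary part at z = - i y is the
    identity sought. *)
Lemma ucp_adj a : M a -> adjoint (f a) (f (adj a)).
Proof.
move=> Ma; have fal := vn_linear vN (ucpM Ma).
have fl := vn_linear vN (ucpM (vn_adjM vM Ma)).
apply: adjoint_rip => // x y; pose z : K := - ('i%C *: y).
have zi : 'i%C *: z = y by rewrite scalerN scalerA -expr2 sqr_i scaleN1r opprK.
have := ucp_form2 z x Ma.
have := ucp_pos (vn_comp vM (vn_adjM vM Ma) Ma) (adj_comp_pos vM Ma) x.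
rewrite ipxx [ip (f a x) z]ipE [ip (f (adj a) z) x]ipE [ip (f _ x) x]ipE !lecE /= zi.
move=> /andP[/eqP -> _] /andP[/eqP h _]; move: h.
rewrite add0r addr0 /z linearNf // linearZf // ripNl ripii (ripC x).
by lra.
Qed.

Lemma adj_ucp a : M a -> adj (f a) = f (adj a).
Proof. by move=> Ma; apply/adjE/ucp_adj. Qed.

(** [ucp_form2] at the vectors [- f a x] and [x], a choice which completes the square. *)
Lemma ucp_schwarz a x : M a -> sq (f a x) <= rip (f (adj a \o a) x) x.
Proof.
move=> Ma; have := ucp_form2 (- f a x) x Ma.
rewrite lecE /= => /andP[_]; rewrite !raddfD /=.
rewrite !Re_ip ripxx sqN ripNr ripxx (ripC (f (adj a) _)).
by rewrite -(rip_adj _ _ (ucp_adj Ma)) ripNr ripxx; lra.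
Qed.

Lemma ucp_le a b : M a -> M b -> positive_op (b - a) -> positive_op (f b - f a).
Proof. by move=> Ma Mb h; rewrite -ucpB //; apply: ucp_pos => //; exact: vn_sub. Qed.

Lemma ucp_bdd a C : M a -> bdd a C -> bdd (f a) C.
Proof.
move=> Ma aC x; apply: le_trans (ucp_schwarz _ Ma) _.
have Maa := vn_comp vM (vn_adjM vM Ma) Ma.
have M1 := vn_id vM.
have MC : M (C%:C%C *: idfun) by exact: vn_scale.
have : positive_op (C%:C%C *: idfun - (adj a \o a)).
  have saC : adjoint (C%:C%C *: (idfun : H -> H)) (C%:C%C *: idfun).
    move=> u v; change (ip (C%:C%C *: u) v = ip u (C%:C%C *: v)).
    by rewrite ipZl ipZr conjR.
  have saa := pos_adj (vn_linear vM Maa) (adj_comp_pos vM Ma).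
  apply: (proj2 (oleP saa saC)) => u; change (rip (adj a (a u)) u <= rip (C%:C%C *: u) u).
  by rewrite (rip_adjl vM) // ripZl ripxx; exact: aC.
move/(ucp_le Maa MC)/(pos_rip x); rewrite ucpZ // (ucp_unital uf).
change (0 <= rip (C%:C%C *: x - f (adj a \o a) x) x -> rip (f (adj a \o a) x) x <= C * sq x).
by rewrite ripBl ripZl subr_ge0.
Qed.

(** Choi's multiplicative domain. If the Schwarz inequality is an equality at [a], then for
    [t c + a] it is a nonnegative quadratic form in [t] without constant term, so its linear term
    vanishes. Taking [b] and [i b] for [c] gives both components of the product formula. *)
Lemma ucp_mult a b : M a -> M b ->
  (forall x, rip (f (adj a \o a) x) x = sq (f a x)) ->
  f (adj a \o b) = f (adj a) \o f b.
Proof.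
move=> Ma Mb ha.
have cross c x : M c -> rip (f (adj a \o c) x) x = rip (f a x) (f c x).
  move=> Mc; have Mac := vn_comp vM (vn_adjM vM Ma) Mc.
  have Mca := vn_comp vM (vn_adjM vM Mc) Ma.
  have Maa := vn_comp vM (vn_adjM vM Ma) Ma.
  have Mcc := vn_comp vM (vn_adjM vM Mc) Mc.
  pose D := rip (f (adj c \o c) x) x - sq (f c x).
  have D0 : 0 <= D by rewrite subr_ge0; exact: ucp_schwarz.
  suff : (rip (f (adj a \o c) x) x - rip (f a x) (f c x)) ^+ 2 <= D * 0.
    by rewrite mulr0 => h; apply/eqP; rewrite -subr_eq0 -sqrf_eq0 eq_le sqr_ge0 h.
  apply: quad_disc D0 => t; pose d := t%:C%C *: c + a.
  have Md : M d by exact: vn_comb.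
  have := ucp_schwarz x Md.
  have -> : f d = t%:C%C *: f c + f a by exact: (ucp_linear uf).
  have -> : f (adj d \o d) = t%:C%C *: (t%:C%C *: f (adj c \o c) + (f (adj a \o c) + f (adj c \o a)))
      + f (adj a \o a).
    rewrite -(ucpD Mac Mca) -(ucp_linear uf) //; last exact: vn_add.
    rewrite -(ucp_linear uf) //; last by apply: vn_comb => //; exact: vn_add.
    congr (f _); rewrite /d (adj_comb vM) //.
    have cl := vn_linear vM (vn_adjM vM Mc); have al := vn_linear vM (vn_adjM vM Ma).
    apply/funext => y; change (Num.conj t%:C%C *: adj c (t%:C%C *: c y + a y) + adj a (t%:C%C *: c y + a y) =
      t%:C%C *: (t%:C%C *: adj c (c y) + (adj a (c y) + adj c (a y))) + adj a (a y)).
    rewrite cl al conjR !scalerDr -!addrA; congr (_ + _).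
    by rewrite addrCA.
  change (sq (t%:C%C *: f c x + f a x) <= rip (t%:C%C *: (t%:C%C *: f (adj c \o c) x +
     (f (adj a \o c) x + f (adj c \o a) x)) + f (adj a \o a) x) x ->
     0 <= D * t ^+ 2 + 2 * (rip (f (adj a \o c) x) x - rip (f a x) (f c x)) * t + 0).
  have -> : rip (t%:C%C *: (t%:C%C *: f (adj c \o c) x +
     (f (adj a \o c) x + f (adj c \o a) x)) + f (adj a \o a) x) x =
     t * (t * rip (f (adj c \o c) x) x + 2 * rip (f (adj a \o c) x) x) + sq (f a x).
    rewrite ripDl ripZl !ripDl ripZl ha; congr (t * (_ + _) + _).
    have -> : rip (f (adj c \o a) x) x = rip (f (adj a \o c) x) x; last by ring.
    rewrite (rip_adj _ _ (ucp_adj Mca)) (adj_comp vM) // ?(adj_adj vM) // 1?ripC //.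
    exact: vn_adjM.
  by rewrite sqD sqZr ripZl (ripC (f c x)) /D; lra.
have Mab := vn_comp vM (vn_adjM vM Ma) Mb.
apply: op_ext.
- exact (vn_linear vN (ucpM Mab)).
- by apply: (vn_linear vN); apply: vn_comp => //; apply: ucpM => //; exact: vn_adjM.
- by move=> x /=; rewrite cross // [RHS]ripC -(rip_adj x (f b x) (ucp_adj Ma)).
move=> x /=; have := cross ('i%C *: b) x (vn_scale vM _ Mb).
have -> : adj a \o ('i%C *: b) = 'i%C *: (adj a \o b).
  by apply/funext => y /=; exact: (linearZf _ _ (vn_linear vM (vn_adjM vM Ma))).
rewrite !ucpZ //; change (rip ('i%C *: f (adj a \o b) x) x = rip (f a x) ('i%C *: f b x) ->
  rip (f (adj a \o b) x) ('i%C *: x) = rip (f (adj a) (f b x)) ('i%C *: x)).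
rewrite ripi => h.
rewrite [RHS]ripC -(rip_adj _ (f b x) (ucp_adj Ma)).
by rewrite (linearZf _ _ (vn_linear vN (ucpM Ma))) ripi -h opprK.
Qed.

End UCP.

(** * Elementary properties of states *)

Section State.
Context {R : realType} {H : hilbertType R} {M : set (H -> H)} {phi : (H -> H) -> R[i]}.
Hypotheses (vM : von_neumann M) (st : normal_faithful_state M phi).
Implicit Types (a b : H -> H).

Definition rphi (phi : (H -> H) -> R[i]) a : R := complex.Re (phi a).

Lemma stateD a b : M a -> M b -> phi (a + b) = phi a + phi b.
Proof.
by move=> Ma Mb; have := state_linear st 1 Ma Mb; rewrite !scale1r.
Qed.

Lemma state0 : phi 0 = 0.
Proof.
apply: (addIr (phi 0)); rewrite add0r -stateD ?addr0 //; exact: vn_0.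
Qed.

Lemma stateZ c a : M a -> phi (c *: a) = c * phi a.
Proof.
move=> Ma; have := state_linear st c Ma (vn_0 vM).
by rewrite state0 !addr0.
Qed.

Lemma stateB a b : M a -> M b -> phi (a - b) = phi a - phi b.
Proof.
move=> Ma Mb; have := stateD Ma (vn_scale vM (-1) Mb).
by rewrite stateZ // scaleN1r mulN1r.
Qed.

Lemma state_pos a : M a -> positive_op a -> phi a = (rphi phi a)%:C%C.
Proof.
move=> Ma ap; have := state_positive st Ma ap; rewrite /rphi.
by case: (phi a) => x y; rewrite lecE /= => /andP[/eqP -> _].
Qed.

Lemma rphi_ge0 a : M a -> positive_op a -> 0 <= rphi phi a.
Proof. by move=> Ma ap; have := state_positive st Ma ap; rewrite state_pos // ler0c. Qed.

Lemma rphiB a b : M a -> M b -> rphi phi (a - b) = rphi phi a - rphi phi b.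
Proof. by move=> Ma Mb; rewrite /rphi stateB // raddfB. Qed.

Lemma rphiD a b : M a -> M b -> rphi phi (a + b) = rphi phi a + rphi phi b.
Proof. by move=> Ma Mb; rewrite /rphi stateD // raddfD. Qed.

Lemma rphiZ t a : M a -> rphi phi (t%:C%C *: a) = t * rphi phi a.
Proof.
by move=> Ma; rewrite /rphi stateZ //; case: (phi a) => x y /=; ring.
Qed.

Lemma rphi_id : rphi phi idfun = 1.
Proof. by rewrite /rphi (state_unital st). Qed.

Lemma rphi_le a b : M a -> M b -> op_le a b -> rphi phi a <= rphi phi b.
Proof.
by move=> Ma Mb ab; rewrite -subr_ge0 -rphiB //; apply: rphi_ge0 => //; exact: vn_sub.
Qed.

Lemma rphi_faithful a : M a -> positive_op a -> rphi phi a = 0 -> a = 0.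
Proof.
by move=> Ma ap h; apply: (state_faithful st) => //; rewrite state_pos // h.
Qed.

(** [phi] is real at [adj b \o b] for b = c a + 1; the cases c = 1 and c = i determine
    [phi (adj a)]. *)
Lemma state_adj a : M a -> phi (adj a) = Num.conj (phi a).
Proof.
move=> Ma; have Maa := vn_adjM vM Ma; have M1 := vn_id vM.
have Mx := vn_comp vM Maa Ma.
have rl b : M b -> positive_op b -> complex.Im (phi b) = 0.
  by move=> Mb bp; rewrite state_pos.
have key c : complex.Im (c * phi a + Num.conj c * phi (adj a)) = 0.
  pose b := c *: a + idfun; have Mb : M b by exact: vn_comb.
  have := rl _ (vn_comp vM (vn_adjM vM Mb) Mb) (adj_comp_pos vM Mb).
  have -> : adj b \o b = c *: a + (Num.conj c *: adj a + ((Num.conj c * c) *: (adj a \o a) + idfun)).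
    rewrite /b (adj_comb vM) // adj_id.
    apply/funext => x; have al := vn_linear vM Maa.
    change (Num.conj c *: adj a (c *: a x + x) + (c *: a x + x) =
      c *: a x + (Num.conj c *: adj a x + ((Num.conj c * c) *: adj a (a x) + x))).
    rewrite al scalerDr scalerA [X in X + _ = _]addrC addrACA.
    by rewrite [X in X + _ = _]addrC -addrA.
  rewrite (state_linear st) //; last by do !apply: vn_comb => //.
  rewrite (state_linear st) //; last by do !apply: vn_comb => //.
  rewrite (state_linear st) // (state_unital st) (state_pos Mx (adj_comp_pos vM Ma)).
  rewrite /GRing.scale /= !raddfD /= => h; move: h.
  by case: c {b Mb} => x y /=; case: (phi a) => u v; case: (phi (adj a)) => w z /=; lra.
have := key 1; have := key 'i%C.
case: (phi a) => x y; case: (phi (adj a)) => u v /= h1 h2.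
by congr Complex; move: h1 h2; lra.
Qed.

End State.

(** * Consequences of a ucp right inverse of [Phi] *)

Section LeftInverse.
Context {R : realType} {H : hilbertType R} {M : set (H -> H)} {phi : (H -> H) -> R[i]}.
Context {Phi Psi : (H -> H) -> (H -> H)}.
Hypotheses (vM : von_neumann M) (st : normal_faithful_state M phi).
Hypotheses (uPhi : ucp_map M M Phi) (uPsi : ucp_map M M Psi).
Hypothesis phiPhi : forall a, M a -> phi (Phi a) = phi a.
Hypothesis PhiPsi : forall a, M a -> Phi (Psi a) = a.
Implicit Types (a b : H -> H).

Let PsM a : M a -> M (Psi a). Proof. exact: (ucpM uPsi). Qed.
Let PhM a : M a -> M (Phi a). Proof. exact: (ucpM uPhi). Qed.
Let MM a b : M a -> M b -> M (a \o b). Proof. exact: (vn_comp vM). Qed.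
Let Madj a : M a -> M (adj a). Proof. exact: (vn_adjM vM). Qed.

Lemma phiPsi a : M a -> phi (Psi a) = phi a.
Proof. by move=> Ma; rewrite -phiPhi ?PhiPsi //; exact: PsM. Qed.

(** Schwarz for [Psi] gives q <= p, and Schwarz for [Phi] at [Psi a] gives [adj a \o a] <= [Phi q].
    Under [phi] this reads phi(adj a a) <= phi(q) <= phi(p), and both ends agree as [Psi] preserves
    [phi]. Faithfulness turns both operator inequalities into equalities. *)
Let sandwich a : M a -> Psi (adj a \o a) = adj (Psi a) \o Psi a /\
  Phi (adj (Psi a) \o Psi a) = adj a \o a.
Proof.
move=> Ma; set p := Psi (adj a \o a); set q := adj (Psi a) \o Psi a.
have Maa : M (adj a \o a) by apply: MM => //; exact: Madj.
have Mp : M p by exact: PsM.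
have Mq : M q by apply: MM; [apply: Madj|]; exact: PsM.
have padj : adjoint p p := pos_adj (vn_linear vM Mp) (ucp_pos uPsi Maa (adj_comp_pos vM Ma)).
have qadj : adjoint q q := pos_adj (vn_linear vM Mq) (adj_comp_pos vM (PsM Ma)).
have qp : op_le q p.
  apply/oleP => // x; rewrite /q /= (rip_adjl vM); last exact: PsM.
  exact: (ucp_schwarz vM vM uPsi).
have MPq := PhM Mq.
have Pqadj : adjoint (Phi q) (Phi q).
  exact: pos_adj (vn_linear vM MPq) (ucp_pos uPhi Mq (adj_comp_pos vM (PsM Ma))).
have aadj := pos_adj (vn_linear vM Maa) (adj_comp_pos vM Ma).
have aPq : op_le (adj a \o a) (Phi q).
  apply/oleP => // x /=; rewrite (rip_adjl vM) // -{1 2}(PhiPsi Ma).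
  exact: (ucp_schwarz vM vM uPhi) _ (PsM Ma).
have := rphi_le vM st Mq Mp qp; have := rphi_le vM st Maa MPq aPq.
rewrite /rphi (phiPhi Mq) (phiPsi Maa) -/(rphi phi _) -/(rphi phi _) => h1 h2.
split.
  apply/eqP; rewrite -subr_eq0; apply/eqP; apply: (rphi_faithful st) => //.
    exact: vn_sub.
  rewrite (rphiB vM st) // [rphi phi p]/rphi (phiPsi Maa) -/(rphi phi _).
  by apply/eqP; rewrite subr_eq0 eq_le h1 h2.
apply/eqP; rewrite -subr_eq0; apply/eqP; apply: (rphi_faithful st) => //.
  exact: vn_sub.
rewrite (rphiB vM st) // [rphi phi (Phi q)]/rphi (phiPhi Mq) -/(rphi phi _).
by apply/eqP; rewrite subr_eq0 eq_le h1 h2.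
Qed.

Lemma Psi_adj a : M a -> adj (Psi a) = Psi (adj a).
Proof. exact: (adj_ucp vM vM uPsi). Qed.

(** The first half of [sandwich] puts every element of [M] in the multiplicative domain of [Psi]. *)
Lemma Psi_mul a b : M a -> M b -> Psi (a \o b) = Psi a \o Psi b.
Proof.
move=> Ma Mb; have Ma' := Madj Ma.
have := ucp_mult vM vM uPsi Ma' Mb; rewrite (adj_adj vM Ma); apply => x.
have [+ _] := sandwich Ma'; rewrite (adj_adj vM Ma) => ->.
by rewrite /= (rip_adjl vM) //; exact: PsM.
Qed.

(** The second half of [sandwich] puts the range of [Psi] in the multiplicative domain of [Phi]. *)
Lemma Phi_modl a b : M a -> M b -> Phi (Psi a \o b) = a \o Phi b.
Proof.
move=> Ma Mb; have Ma' := Madj Ma; have MPa' := PsM Ma'.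
have := ucp_mult vM vM uPhi MPa' Mb.
rewrite (Psi_adj Ma') (adj_adj vM Ma) (PhiPsi Ma); apply => x.
have [_] := sandwich Ma'; rewrite (Psi_adj Ma') (adj_adj vM Ma) => ->.
by rewrite (PhiPsi Ma') /= -{1}(adj_adj vM Ma) (rip_adjl vM).
Qed.

Lemma Phi_adj a : M a -> adj (Phi a) = Phi (adj a).
Proof. exact: (adj_ucp vM vM uPhi). Qed.

Lemma iterPsM n a : M a -> M (iter n Psi a).
Proof. by move=> Ma; elim: n => //= n; exact: PsM. Qed.

Lemma iterPhM n a : M a -> M (iter n Phi a).
Proof. by move=> Ma; elim: n => //= n; exact: PhM. Qed.

Lemma iterPs_comb n c a b : M a -> M b ->
  iter n Psi (c *: a + b) = c *: iter n Psi a + iter n Psi b.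
Proof.
by move=> Ma Mb; elim: n => //= n ->; rewrite (ucp_linear uPsi) //; exact: iterPsM.
Qed.

Lemma iterPs_mul n a b : M a -> M b -> iter n Psi (a \o b) = iter n Psi a \o iter n Psi b.
Proof. by move=> Ma Mb; elim: n => //= n ->; rewrite Psi_mul //; exact: iterPsM. Qed.

Lemma iterPs_id n : iter n Psi idfun = idfun.
Proof. by elim: n => //= n ->; rewrite (ucp_unital uPsi). Qed.

Lemma iterPs_adj n a : M a -> adj (iter n Psi a) = iter n Psi (adj a).
Proof. by move=> Ma; elim: n => //= n <-; rewrite Psi_adj //; exact: iterPsM. Qed.

Lemma iterPs_phi n a : M a -> phi (iter n Psi a) = phi a.
Proof. by move=> Ma; elim: n => //= n <-; rewrite phiPsi //; exact: iterPsM. Qed.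

Lemma iterPs_bdd n a C : M a -> bdd a C -> bdd (iter n Psi a) C.
Proof.
move=> Ma aC; elim: n => //= n; apply: (ucp_bdd vM vM uPsi); exact: iterPsM.
Qed.

Lemma iterPh_bdd n a C : M a -> bdd a C -> bdd (iter n Phi a) C.
Proof.
move=> Ma aC; elim: n => //= n; apply: (ucp_bdd vM vM uPhi); exact: iterPhM.
Qed.

Lemma iterPh_phi n a : M a -> phi (iter n Phi a) = phi a.
Proof. by move=> Ma; elim: n => //= n <-; rewrite phiPhi //; exact: iterPhM. Qed.

Lemma iterPh_adj n a : M a -> adj (iter n Phi a) = iter n Phi (adj a).
Proof. by move=> Ma; elim: n => //= n <-; rewrite Phi_adj //; exact: iterPhM. Qed.

Lemma iterPh_modl n a b : M a -> M b ->
  iter n Phi (iter n Psi a \o b) = a \o iter n Phi b.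
Proof.
elim: n a => //= n IH a Ma Mb.
rewrite -[Psi (iter n Psi a)]/(iter n.+1 Psi a) iterSr IH ?Phi_modl //.
  exact: iterPhM.
exact: PsM.
Qed.

Lemma iterPh_modr n a b : M a -> M b ->
  iter n Phi (b \o iter n Psi a) = iter n Phi b \o a.
Proof.
move=> Ma Mb.
have MPa : M (iter n Psi a) by exact: iterPsM.
have MPb : M (iter n Phi b) by exact: iterPhM.
have Mx : M (iter n Phi (b \o iter n Psi a)) by apply: iterPhM; exact: MM.
have E : adj (b \o iter n Psi a) = iter n Psi (adj a) \o adj b.
  by rewrite (adj_comp vM Mb MPa) (iterPs_adj _ Ma).
rewrite -(adj_adj vM Mx) (iterPh_adj _ (MM Mb MPa)) E.
rewrite (iterPh_modl _ (Madj Ma) (Madj Mb)).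
rewrite (adj_comp vM (Madj Ma) (iterPhM n (Madj Mb))) (adj_adj vM Ma).
by rewrite (iterPh_adj _ (Madj Mb)) (adj_adj vM Mb).
Qed.

End LeftInverse.

(** The inductive limit is encoded by sequences in [M] with f(n+1) = Psi(f n) for large n. Sequences
    that agree from some index on are at distance 0 and get identified in the completion. *)
Lemma limit_gns (R : realType) (H : hilbertType R) (M : set (H -> H))
    (phi : (H -> H) -> R[i]) (Phi Psi : (H -> H) -> (H -> H)) :
  von_neumann M -> normal_faithful_state M phi ->
  ucp_map M M Phi -> ucp_map M M Psi ->
  (forall a, M a -> phi (Phi a) = phi a) -> (forall a, M a -> Phi (Psi a) = a) ->
  exists (K : hilbertType R) (e : nat -> (H -> H) -> K),
  [/\ forall n c a b, M a -> M b -> e n (c *: a + b) = c *: e n a + e n b,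
      forall n a, M a -> e n.+1 (Psi a) = e n a,
      forall n a b, M a -> M b -> ip (e n a) (e n b) = phi (adj b \o a)
    & forall x (d : R), 0 < d -> exists n a, M a /\ sq (x - e n a) < d].
Proof.
move=> vM st uPhi uPsi phiPhi PhiPsi.
pose D : set (nat -> H -> H) := [set f | (forall n, M (f n)) /\
  exists N, forall n, (N <= n)%N -> f n.+1 = Psi (f n)].
have PsM a : M a -> M (Psi a) by exact: (ucpM uPsi).
have Dsub : submodule_set D.
  split.
    split=> [n|]; first exact: (vn_0 vM).
    by exists 0%N => n _; exact: (esym (ucp0 vM uPsi)).
  move=> c f g [Mf [N hN]] [Mg [P hP]]; split=> [n|]; first exact: (vn_comb vM).
  exists (maxn N P) => n; rewrite geq_max => /andP[Nn Pn].
  change (c *: f n.+1 + g n.+1 = Psi (c *: f n + g n)).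
  by rewrite (ucp_linear uPsi) // hN // hP.
have [U [val [val_lin val_inj val_D val_sur]]] := submodule_type Dsub.
have Mval u n : M (val u n) by case: (val_D u).
have [thr thrP] := choice (fun u => proj2 (val_D u)).
pose g (x y : H -> H) := phi (adj y \o x).
have gPsi x y : M x -> M y -> g (Psi x) (Psi y) = g x y.
  move=> Mx My; have Ma := vn_comp vM (vn_adjM vM My) Mx.
  rewrite /g (Psi_adj vM uPsi) // -(Psi_mul vM st uPhi uPsi) ?(phiPsi uPsi phiPhi) //.
  exact: (vn_adjM vM).
(* The form is read at an index where both sequences have become compatible; [gPsi] makes the choice
   of the index irrelevant. *)
pose s u v := g (val u (maxn (thr u) (thr v))) (val v (maxn (thr u) (thr v))).
have sE u v n : (thr u <= n)%N -> (thr v <= n)%N -> s u v = g (val u n) (val v n).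
  move=> un vn; rewrite /s; set m := maxn _ _.
  have mn : (m <= n)%N by rewrite geq_max un.
  rewrite -(subnK mn); elim: (n - m)%N => [|k IH]; first by rewrite add0n.
  have um : (thr u <= k + m)%N by apply: leq_trans (leq_addl _ _); exact: leq_maxl.
  have vm : (thr v <= k + m)%N by apply: leq_trans (leq_addl _ _); exact: leq_maxr.
  by rewrite IH addSn !thrP // gPsi.
have gl c x y z : M x -> M y -> M z -> g (c *: x + y) z = c * g x z + g y z.
  move=> Mx My Mz; rewrite /g; have Mz' := vn_adjM vM Mz.
  rewrite -(state_linear st); try exact: (vn_comp vM).
  congr (phi _); apply/funext => h; exact: (vn_linear vM Mz').
have sP : psd_form s.
  have lin c x y z : s (c *: x + y) z = c * s x z + s y z.
    pose n := (thr (c *: x + y)%R + thr x + thr y + thr z)%N.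
    rewrite (sE _ _ n) ?(sE x z n) ?(sE y z n) /n; try lia.
    by rewrite val_lin; apply: gl.
  have s0 z : s 0 z = 0.
    have := lin 1 0 0 z; rewrite scaler0 addr0 mul1r => /eqP.
    by rewrite -subr_eq subrr eq_sym => /eqP.
  split=> [x y z|c x y|x y|x].
  - by have := lin 1 x y z; rewrite scale1r mul1r.
  - by have := lin c x 0 y; rewrite s0 !addr0.
  - rewrite (sE x y (maxn (thr x) (thr y))) ?leq_maxl ?leq_maxr //.
    rewrite (sE y x (maxn (thr x) (thr y))) ?leq_maxl ?leq_maxr //.
    set a := val x _; set b := val y _; have [Ma Mb] : M a /\ M b by split; exact: Mval.
    have Mab := vn_comp vM (vn_adjM vM Ma) Mb.
    rewrite /g -(state_adj vM st Mab) (adj_comp vM) ?(adj_adj vM) //.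
    exact: (vn_adjM vM).
  - rewrite (sE x x (thr x)) //; apply: (state_positive st); last exact: (adj_comp_pos vM).
    by apply: (vn_comp vM) => //; exact: (vn_adjM vM).
have [K [j [jlin jip jdense]]] := hilbert_completion sP.
have jB u v : j u - j v = j (u - v).
  by have := jlin (-1) v u; rewrite !scaleN1r ![- _ + _]addrC => ->.
have valB u v : val (u - v) = val u - val v.
  by have := val_lin (-1) v u; rewrite !scaleN1r ![- _ + _]addrC => ->.
have ev_eq u v : (exists N, forall n, (N <= n)%N -> val u n = val v n) -> j u = j v.
  move=> [N hN]; apply/eqP; rewrite -subr_eq0; apply/eqP/sq_eq0.
  rewrite jB /sq /qform /rform jip (sE _ _ (maxn N (thr (u - v)))) ?leq_maxr //.
  have -> : val (u - v) (maxn N (thr (u - v))) = 0.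
    rewrite valB; set n := maxn _ _; change (val u n - val v n = 0).
    by rewrite hN ?leq_maxl // subrr.
  have M0 := vn_0 vM; have := gl (-1) 0 0 0 M0 M0 M0.
  by rewrite scaler0 addr0 mulN1r addNr => ->.
pose sv n (a : H -> H) : nat -> H -> H := fun m => if (m < n)%N then 0 else iter (m - n) Psi a.
have svD n a : M a -> D (sv n a).
  move=> Ma; split=> [m|].
    rewrite /sv; case: ifP => _; first exact: vn_0.
    exact: iterPsM.
  by exists n => m nm; rewrite /sv !ltnNge leqW nm //= subSn.
have ex (p : nat * (H -> H)) : exists u, M p.2 -> val u = sv p.1 p.2.
  have [Mp|nM] := pselect (M p.2); last by exists 0.
  by have [u hu] := val_sur _ (svD p.1 _ Mp); exists u.
have [E hE] := choice ex; pose e n a := j (E (n, a)).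
have svE n a m : M a -> (n <= m)%N -> val (E (n, a)) m = iter (m - n) Psi a.
  by move=> Ma nm; rewrite hE //= /sv ltnNge nm.
exists K, e; split.
- move=> n c a b Ma Mb; rewrite /e -jlin; apply: ev_eq; exists n => m nm.
  rewrite val_lin; change (val (E (n, c *: a + b)) m = c *: val (E (n, a)) m + val (E (n, b)) m).
  by rewrite !svE ?(iterPs_comb uPsi) //; exact: vn_comb.
- move=> n a Ma; apply: ev_eq; exists n.+1 => m nm.
  by rewrite !svE ?(ltnW nm) //; [rewrite -iterSr -subSn // subSS|exact: PsM].
- move=> n a b Ma Mb; rewrite /e jip (sE _ _ (n + thr (E (n, a)) + thr (E (n, b)))%N); try lia.
  set m := (n + _ + _)%N; have nm : (n <= m)%N by lia.
  rewrite !svE // /g (iterPs_adj vM uPsi) // -(iterPs_mul vM st uPhi uPsi) //; last exact: vn_adjM.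
  rewrite (iterPs_phi uPsi phiPhi) //; apply: vn_comp => //; exact: vn_adjM.
move=> x d d0; have [u hu] := jdense x d d0.
exists (thr u), (val u (thr u)); split=> //.
rewrite (_ : e _ _ = j u) //; apply: ev_eq; exists (thr u) => m um.
rewrite svE // -(subnK um); elim: (m - thr u)%N => [|k IH]; first by rewrite add0n subnn.
by rewrite addSn thrP ?leq_addl // -IH subSn ?leq_addl.
Qed.

(** * A noncommutative Egorov theorem *)

Section FastCauchy.
Context {R : realType} {K : hilbertType R}.

Lemma sq_lim_le (x : K) (k : R) : 0 <= k ->
  (forall e, 0 < e -> exists2 y, sq (x - y) < e & sq y <= k) -> sq x <= k.
Proof.
move=> k0 h; have x0 := sq_ge0 x.
have : - Num.sqrt (k * sq x) <= rip (- x) x.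
  apply: rip_lim_le => e e0; have [y xy yk] := h e e0; exists (- y).
    by rewrite -opprD sqN.
  rewrite ripNl lerN2; apply: le_trans (ler_norm _) _; rewrite -sqrtr_sqr.
  by apply: ler_wsqrtr; apply: le_trans (rip_CS _ _) _; rewrite ler_wpM2r.
rewrite ripNl lerN2 ripxx => hx.
have [->//|xn] := eqVneq (sq x) 0; have xp : 0 < sq x by rewrite lt_def xn.
rewrite -(ler_pM2r xp) -expr2 -(sqr_sqrtr (mulr_ge0 k0 x0)).
by rewrite ler_sqr ?nnegrE // sqrtr_ge0.
Qed.

Lemma pow4_small (C e : R) : 0 <= C -> 0 < e -> exists N, forall n, (N <= n)%N -> C / 4 ^+ n < e.
Proof.
move=> C0 e0; have C1 : 0 < C + 1 by rewrite ltr_wpDl.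
have [N hN] := invn_small (divr_gt0 e0 C1); exists N => n Nn.
have h4 : n.+1%:R <= 4 ^+ n :> R by rewrite -natrX ler_nat ltn_expl.
have p4 : 0 < 4 ^+ n :> R by rewrite exprn_gt0.
have := hN n Nn; rewrite ltr_pdivlMr // mulrC => h; apply: le_lt_trans h.
by rewrite ler_pM ?lerDl ?invr_ge0 ?lef_pV2 ?posrE ?ltr0n // ltW.
Qed.

(** The factor 4 is the solution of k = 2 + 2 k / 4: one step costs 2 and the remaining tail costs 2
    k at the next power of 4. *)
Lemma fast_dist (u : nat -> K) (C : R) : 0 <= C ->
  (forall k, sq (u k.+1 - u k) <= C / 4 ^+ k) ->
  forall n p, sq (u (n + p)%N - u n) <= 4 * C / 4 ^+ n.
Proof.
move=> C0 hu n p; elim: p n => [|p IH] n.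
  by rewrite addn0 subrr sq0 divr_ge0 ?mulr_ge0 // exprn_ge0.
rewrite addnS -addSn -(subrKA (u n.+1)); apply: le_trans (sqD_le _ _) _.
have := IH n.+1; have := hu n; rewrite exprS.
have p4 : 0 < 4 ^+ n :> R by rewrite exprn_gt0.
by rewrite invfM; move: (4 ^+ n)^-1 => i; lra.
Qed.

Lemma fast_cvg (u : nat -> K) (C : R) : 0 <= C ->
  (forall k, sq (u k.+1 - u k) <= C / 4 ^+ k) ->
  exists l, forall n, sq (u n - l) <= 4 * C / 4 ^+ n.
Proof.
move=> C0 hu; have D := fast_dist C0 hu.
have [l hl] : exists l, cvgs u l.
  apply: hilbert_complete => e e0.
  have C40 : 0 <= 4 * C by rewrite mulr_ge0.
  have [N hN] := pow4_small C40 (divr_gt0 e0 (ltr0Sn R 3)).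
  exists N => m n Nm Nn; apply: (@sq_tri _ _ _ (u N)).
    by rewrite -(subnKC Nm); exact: le_lt_trans (D _ _) (hN N (leqnn N)).
  by rewrite sqC -(subnKC Nn); exact: le_lt_trans (D _ _) (hN N (leqnn N)).
exists l => n; apply: sq_lim_le.
  by rewrite divr_ge0 ?mulr_ge0 // exprn_ge0.
move=> e e0; have [N hN] := hl e e0; exists (u n - u (n + N)%N).
  by rewrite opprB addrC subrKA; exact: hN (leq_addl _ _).
by rewrite sqC; exact: D.
Qed.

End FastCauchy.

Section Egorov.
Context {R : realType} {H : hilbertType R} {M : set (H -> H)} {phi : (H -> H) -> R[i]}.
Hypotheses (vM : von_neumann M) (st : normal_faithful_state M phi).
Implicit Types (a b r : H -> H) (h : H).

Definition psum (x : nat -> H -> H) m : H -> H := iteri m (fun k s => s + x k) 0.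

Lemma pos_sa a : M a -> positive_op a -> self_adjoint_part M a.
Proof. by move=> Ma ap; split=> //; exact: pos_adj (vn_linear vM Ma) ap. Qed.

Lemma id_sa : self_adjoint_part M (idfun : H -> H).
Proof. by split=> //; exact: vn_id. Qed.

Lemma sub_sa a b : self_adjoint_part M a -> self_adjoint_part M b -> self_adjoint_part M (a - b).
Proof.
move=> [Ma aa] [Mb bb]; split; first exact: vn_sub.
move=> x y; change (ip (a x - b x) y = ip x (a y - b y)).
by rewrite ipDl ipNl ipDr ipNr aa bb.
Qed.

Lemma resolvent_le1 a r : positive_op a -> (forall h, r h + a (r h) = h) ->
  ole r idfun.
Proof.
move=> ap rE h; rewrite /= -{2 3 4}(rE h) ripxx sqD ripDr ripxx.
by have := pos_rip (r h) ap; rewrite ripC; have := sq_ge0 (a (r h)); lra.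
Qed.

Lemma resolvent_ge a r h : M a -> positive_op a -> (forall h, r h + a (r h) = h) ->
  sq h - rip (r h) h <= rip (a h) h.
Proof.
move=> Ma ap rE; set w := r h.
have E : h = w + a w by rewrite rE.
have al := vn_linear vM Ma; have aa := pos_adj al ap.
have := pos_rip (a w) ap; have := sq_ge0 (a w).
rewrite {1 2 3 4}E linearDf // sqD !ripDl !ripDr !ripxx.
by rewrite (rip_adj (a w) w aa) ripxx (ripC w (a w)); lra.
Qed.

Lemma scaled_pos (t : R) a : 0 <= t -> positive_op a -> positive_op (t%:C%C *: a).
Proof.
move=> t0 ap h; change (0 <= ip (t%:C%C *: a h) h).
by rewrite ipZl mulr_ge0 // ler0c.
Qed.

Lemma add_pos a b : positive_op a -> positive_op b -> positive_op (a + b).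
Proof.
by move=> ap bp h; change (0 <= ip (a h + b h) h); rewrite ipDl addr_ge0.
Qed.

Lemma psumP (x : nat -> H -> H) m : (forall k, M (x k) /\ positive_op (x k)) ->
  M (psum x m) /\ positive_op (psum x m).
Proof.
move=> hx; elim: m => [|m [IM Ip]] /=.
  by split; [exact: vn_0|move=> h; change (0 <= ip 0 h); rewrite ip0l].
by have [xM xp] := hx m; split; [exact: vn_add|exact: add_pos].
Qed.

Lemma psum_mono (x : nat -> H -> H) m n : (forall k, M (x k) /\ positive_op (x k)) ->
  (m <= n)%N -> ole (psum x m) (psum x n).
Proof.
move=> hx /subnK <-; elim: (n - m)%N => [|k IH] h //.
rewrite addSn; apply: le_trans (IH h) _.
change (rip (psum x (k + m) h) h <= rip (psum x (k + m) h + x (k + m)%N h) h).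
by rewrite ripDl lerDl; apply: pos_rip; case: (hx (k + m)%N).
Qed.

Lemma psum_ge (x : nat -> H -> H) k : (forall k, M (x k) /\ positive_op (x k)) ->
  ole (x k) (psum x k.+1).
Proof.
move=> hx h; change (rip (x k h) h <= rip (psum x k h + x k h) h).
by rewrite ripDl lerDr; apply: pos_rip; case: (psumP k hx).
Qed.

Lemma psum_phi (x : nat -> H -> H) m : (forall k, M (x k) /\ positive_op (x k)) ->
  rphi phi (psum x m) = \sum_(k < m) rphi phi (x k).
Proof.
move=> hx; elim: m => [|m IH]; first by rewrite big_ord0 /rphi /= (state0 vM st).
rewrite big_ord_recr /= -IH -(rphiD st) //; first by case: (psumP m hx).
by case: (hx m).
Qed.

Lemma up_directed_seq (x : nat -> H -> H) (s : nat -> H -> H) :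
  (forall m n, (m <= n)%N -> op_le (s m) (s n)) -> up_directed op_le (range s).
Proof.
move=> smono; split; first by exists (s 0%N), 0%N.
move=> _ _ [m _ <-] [n _ <-]; exists (s (maxn m n)).
by split; [exists (maxn m n)|apply: smono; exact: leq_maxl|apply: smono; exact: leq_maxr].
Qed.

Lemma rphi_lub (D : set (H -> H)) s (k : R) : D `<=` self_adjoint_part M ->
  up_directed op_le D -> is_lub (self_adjoint_part M) op_le D s ->
  (forall d, D d -> rphi phi d <= k) -> rphi phi s <= k.
Proof.
move=> DM dir slub hk; have [_ _ pmin] := state_normal st DM dir slub.
have real d : D d -> phi d = (rphi phi d)%:C%C.
  move=> Dd; have [Md dd] := DM d Dd.
  have dreal : phi d \is Num.real.
    rewrite CrealE; apply/eqP; rewrite -(state_adj vM st Md); congr (phi _).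
    exact: adjE.
  by rewrite /rphi RRe_real.
have : phi s <= k%:C%C.
  apply: pmin; first by apply/complex_realP; exists k.
  by move=> _ [d Dd <-]; rewrite real // lecR; exact: hk.
by rewrite lecE /= => /andP[].
Qed.

(* [r n] is the infimum over [m] of [(1 + s_m / (n + 1))^-1], where [s_m] is the
   [m]-th partial sum of [x] *)
Lemma egorov (x : nat -> H -> H) (S : R) :
  (forall k, M (x k) /\ positive_op (x k)) -> (forall m, \sum_(k < m) rphi phi (x k) <= S) ->
  exists r : nat -> H -> H,
  [/\ forall n, [/\ M (r n), positive_op (r n) & ole (r n) idfun],
      forall n, 1 - rphi phi (r n) <= S / n.+1%:R,
      forall n k h, rip (x k (r n h)) (r n h) <= n.+1%:R * rip (r n h) h
    & forall h (e : R), 0 < e -> exists n, sq (h - r n h) < e].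
Proof.
move=> hx hS; pose d n : R := n.+1%:R^-1.
have d0 n : 0 < d n by rewrite invr_gt0 ltr0n.
have dge n : 0 <= d n by exact: ltW.
pose y n m := (d n)%:C%C *: psum x m.
have yM n m : M (y n m) by apply: vn_scale => //; case: (psumP m hx).
have yp n m : positive_op (y n m).
  by have [pM pp] := psumP m hx; exact: scaled_pos.
have yE n m h : rip (y n m h) h = d n * rip (psum x m h) h.
  by rewrite -ripZl.
have ex (p : nat * nat) := resolvent_ex vM (yM p.1 p.2) (yp p.1 p.2).
have [q hq] := choice ex; pose rr n m := q (n, m).
have rM n m : M (rr n m) by case: (hq (n, m)).
have rp n m : positive_op (rr n m) by case: (hq (n, m)).
have rE n m h : rr n m h + y n m (rr n m h) = h by case: (hq (n, m)) => _ _ h1 _; exact: h1.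
have rsa n m : self_adjoint_part M (rr n m) by exact: pos_sa.
have csa n m : self_adjoint_part M (idfun - rr n m) by apply: sub_sa => //; exact: id_sa.
have subE a b h : rip ((a - b) h) h = rip (a h) h - rip (b h) h by exact: ripBl.
have rmono n m m' : (m <= m')%N -> ole (rr n m') (rr n m).
  move=> mm; apply: (resolvent_anti (vn_linear vM (yM n m)) (yp n m) _ (rE n m) (rE n m')).
  by move=> h; rewrite !yE (ler_wpM2l (dge n)) //; exact: (psum_mono hx mm h).
have Ddir n : up_directed op_le (range (fun m => idfun - rr n m)).
  apply: (up_directed_seq x) => m m' mm; apply/oleP; [by case: (csa n m)|by case: (csa n m')|].
  by move=> h; rewrite !subE lerD2l lerN2; exact: (rmono n m m' mm h).
have DM n : range (fun m => idfun - rr n m) `<=` self_adjoint_part M.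
  by move=> _ [m _ <-].
have Dub n b : range (fun m => idfun - rr n m) b -> op_le b idfun.
  move=> [m _ <-]; apply/oleP => //; first by case: (csa n m).
  by move=> h; rewrite subE lerBlDr lerDl; exact: pos_rip.
(* The infimum over [m] is taken as [idfun] minus a supremum. *)
have tex n := lub_ex vM (DM n) (Ddir n) id_sa (Dub n).
have [t ht] := choice tex; pose r n : H -> H := idfun - t n.
have tsa n : self_adjoint_part M (t n) by case: (ht n).
have rnsa n : self_adjoint_part M (r n) by apply: sub_sa => //; exact: id_sa.
have rM' n : M (r n) by case: (rnsa n).
have rle n m : ole (r n) (rr n m).
  have [_ ub _] := ht n; have := ub (idfun - rr n m) (ex_intro2 _ _ m I erefl).
  rewrite (oleP (proj2 (csa n m)) (proj2 (tsa n))) => h k.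
  by have := h k; rewrite !subE; lra.
have rglb n a : self_adjoint_part M a -> (forall m, ole a (rr n m)) -> ole a (r n).
  move=> asa ha; have [_ _ lst] := ht n.
  have casa : self_adjoint_part M (idfun - a) by apply: sub_sa => //; exact: id_sa.
  have : op_le (t n) (idfun - a).
    apply: lst => // _ [m _ <-]; apply/oleP; [by case: (csa n m)|by case: casa|].
    by move=> k; rewrite !subE lerD2l lerN2; exact: (ha m k).
  rewrite (oleP (proj2 (tsa n)) (proj2 casa)) => h k.
  by have := h k; rewrite !subE; lra.
have rpos n : positive_op (r n).
  apply: rip_pos; first by case: (rnsa n).
  move=> h; have z0 : ole 0 (r n).
    apply: rglb; last by move=> m k; rewrite rip0l; exact: pos_rip.
    by split; [exact: vn_0|move=> u v; change (ip 0 v = ip u 0); rewrite ip0l ip0r].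
  by have := z0 h; rewrite rip0l.
have rle1 n : ole (r n) idfun.
  by move=> h; apply: le_trans (rle n 0%N h) _; exact: resolvent_le1 (yp n 0%N) (rE n 0%N) h.
(* From 1 - (1 + y)^-1 <= y, whose value under [phi] is at most S/(n+1); normality of [phi] carries
   the bound over to the supremum. *)
have rphi1 n : 1 - rphi phi (r n) <= S / n.+1%:R.
  rewrite (rphiB vM st) ?(rphi_id st); [|exact: vn_id|by case: (tsa n)].
  have M1 := vn_id vM.
  rewrite opprB addrC subrK; apply: (rphi_lub (DM n) (Ddir n) (ht n)) => _ [m _ <-].
  have [pM pp] := psumP m hx.
  apply: (@le_trans _ _ (rphi phi (y n m))).
    apply: (rphi_le vM st) => //; first by case: (csa n m).
    apply/oleP; [by case: (csa n m)|by case: (pos_sa (yM n m) (yp n m))|].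
    by move=> h; rewrite subE; exact: (resolvent_ge h (yM n m) (yp n m) (rE n m)).
  rewrite (rphiZ vM st) // psum_phi // [leLHS]mulrC; exact: (ler_wpM2r (dge n) (hS m)).
exists r; split=> //.
  move=> n k h; have [xM xp] := hx k.
  pose u := d n * rip (x k (r n h)) (r n h) + sq (r n h).
  have u0 : 0 <= u by rewrite addr_ge0 ?sq_ge0 ?mulr_ge0 ?pos_rip ?ltW.
  have rh0 : 0 <= rip (r n h) h by exact: pos_rip.
  suff uh : u <= rip (r n h) h.
    rewrite -ler_pdivrMl ?ltr0n //; apply: le_trans uh.
    by rewrite -/(d n) lerDl sq_ge0.
  pose m := k.+1; pose w := r n h; pose z := w + y n m w.
  (* [r <= (1 + y)^-1], so Cauchy-Schwarz for [r] at [h] and [(1 + y) w] *)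
  have e1 : rip (rr n m z) z = sq w + rip (y n m w) w.
    have -> : rr n m z = w by case: (hq (n, m)) => _ _ _ h1; exact: h1.
    by rewrite ripDr ripxx ripC.
  have CS := pos_CS h z (vn_linear vM (rM' n)) (rpos n).
  have e2 : rip w z = sq w + rip (y n m w) w by rewrite ripDr ripxx ripC.
  have A0 : 0 <= sq w + rip (y n m w) w by rewrite addr_ge0 ?sq_ge0 ?pos_rip.
  have uA : u <= sq w + rip (y n m w) w.
    rewrite /u addrC lerD2l yE (ler_wpM2l (dge n)) //; exact: (psum_ge k hx w).
  apply: le_trans uA _.
  have := ler_wpM2l rh0 (rle n m z); rewrite e1 => /(le_trans CS).
  rewrite -/w e2; set A := sq w + _ in A0 *.
  have [->|An] := eqVneq A 0; first by rewrite pos_rip.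
  by rewrite expr2 ler_pM2r // lt_def An.
move=> h e e0.
have smono m n : (m <= n)%N -> ole (r m) (r n).
  move=> mn; apply: rglb => // p k; apply: le_trans (rle m p k) _.
  apply: (resolvent_anti (vn_linear vM (yM n p)) (yp n p) _ (rE n p) (rE m p)).
  move=> z; rewrite !yE ler_wpM2r //; first by apply: pos_rip; case: (psumP p hx).
  by rewrite /d lef_pV2 ?posrE ?ltr0n // ler_nat ltnS.
have Rdir : up_directed op_le (range r).
  apply: (up_directed_seq x) => m n mn; apply/oleP; [by case: (rnsa m)|by case: (rnsa n)|].
  exact: smono.
have RM : range r `<=` self_adjoint_part M by move=> _ [n _ <-].
have Rub b : range r b -> op_le b idfun.
  by move=> [n _ <-]; apply/oleP => //; case: (rnsa n).
have [T Tlub] := lub_ex vM RM Rdir id_sa Rub.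
have [Tsa Tub Tmin] := Tlub.
have T1 : op_le T idfun by apply: Tmin => //; exact: id_sa.
(* The value of [phi] at 1 - T is at most S/(n+1) for every n, and faithfulness concludes: the
   increasing [r n] have supremum 1. *)
have ST : idfun - T = 0.
  have MT : M T by case: Tsa. have M1 := vn_id vM.
  apply: (rphi_faithful st) => //; first exact: vn_sub.
  apply/eqP; rewrite eq_le (rphi_ge0 st) ?andbT //; last exact: vn_sub.
  apply/ler_addgt0Pl => f f0; rewrite addr0.
  have S0 : 0 <= S by have := hS 0%N; rewrite big_ord0.
  have S1 : 0 < S + 1 by rewrite ltr_wpDl.
  have [N hN] := invn_small (divr_gt0 f0 S1).
  rewrite (rphiB vM st) // (rphi_id st).
  apply: (@le_trans _ _ (1 - rphi phi (r N))).
    rewrite lerD2l lerN2; apply: (rphi_le vM st) => //.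
    by apply: Tub; exists N.
  apply: le_trans (rphi1 N) _; have := hN N (leqnn N); rewrite ltr_pdivlMr // => /ltW.
  apply: le_trans; rewrite mulrC ler_wpM2l ?invr_ge0 //.
  by rewrite lerDl.
have [_ [n _ <-] hn] := lub_approx vM RM Rdir Tlub h e0.
exists n; apply: le_lt_trans hn.
have -> : T = idfun by apply/esym/eqP; rewrite -subr_eq0 ST.
have cp : positive_op (idfun - r n).
  by apply: (proj2 (oleP _ _)) => //; case: (rnsa n).
have cl : linear (idfun - r n) by apply: (vn_linear vM); apply: vn_sub => //; exact: vn_id.
have := pos_sq h cl cp (C := 1).
rewrite mul1r subE; apply => k; rewrite subE mul1r ripxx lerBlDr lerDl; exact: pos_rip.
Qed.

End Egorov.

(** * Transfer from the norm of [phi] to operators on [H] *)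

Section L2.
Context {R : realType} {H K : hilbertType R} {M : set (H -> H)} {phi : (H -> H) -> R[i]}.
Context {e : (H -> H) -> K}.
Hypotheses (vM : von_neumann M) (st : normal_faithful_state M phi).
Hypothesis eL : forall c a b, M a -> M b -> e (c *: a + b) = c *: e a + e b.
Hypothesis eip : forall a b, M a -> M b -> ip (e a) (e b) = phi (adj b \o a).
Implicit Types (a b w y : H -> H) (h : H).

Lemma eD a b : M a -> M b -> e (a + b) = e a + e b.
Proof. by move=> Ma Mb; have := eL 1 Ma Mb; rewrite !scale1r. Qed.

Lemma eB a b : M a -> M b -> e (a - b) = e a - e b.
Proof. by move=> Ma Mb; have := eL (-1) Mb Ma; rewrite !scaleN1r ![- _ + _]addrC. Qed.

Lemma sq_e a : M a -> sq (e a) = rphi phi (adj a \o a).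
Proof. by move=> Ma; rewrite /sq /qform /rform eip. Qed.

Lemma sq_e_comp b w C : M b -> M w -> bdd b C -> sq (e (b \o w)) <= C * sq (e w).
Proof.
move=> Mb Mw bC; have Mbw := vn_comp vM Mb Mw.
have pM a : M a -> M (adj a \o a) by move=> Ma; apply: vn_comp => //; exact: vn_adjM.
rewrite !sq_e // -(rphiZ vM st); last exact: pM.
apply: (rphi_le vM st); [exact: pM|by apply: vn_scale => //; exact: pM|].
have [_ saa] := pos_sa vM (pM _ Mbw) (adj_comp_pos vM Mbw).
have [_ sw] := pos_sa vM (pM _ Mw) (adj_comp_pos vM Mw).
apply: (proj2 (oleP saa _)) => [x z|h].
  by change (ip (C%:C%C *: (adj w \o w) x) z = ip x (C%:C%C *: (adj w \o w) z));
    rewrite ipZl ipZr conjR sw.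
change (rip (adj (b \o w) ((b \o w) h)) h <= rip (C%:C%C *: adj w (w h)) h).
by rewrite ripZl !(rip_adjl vM) //; exact: bC.
Qed.

Lemma bdd_sub a b C : bdd a C -> bdd b C -> bdd (a - b) (4 * C).
Proof.
move=> aC bC h; change (sq (a h - b h) <= 4 * C * sq h).
by have := sqD_le (a h) (- b h); rewrite sqN; have := aC h; have := bC h; lra.
Qed.

(** [egorov] is applied to x_n = 4^n |a_(n+1) - a_n|^2, with phi(x_n) <= 4^n / 8^n = 2^-n. At a
    vector r_n h the increments of the sequence decay like 2^-k, so it converges there; such vectors
    approximate all of [H], and the common bound [C] extends the convergence. *)
Lemma l2_complete (a : nat -> H -> H) (C : R) : 0 <= C ->
  (forall n, M (a n)) -> (forall n, bdd (a n) C) ->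
  (forall n, sq (e (a n.+1) - e (a n)) <= 1 / 8 ^+ n) ->
  exists c, [/\ M c, bdd c C,
    forall d : R, 0 < d -> exists N, forall n, (N <= n)%N -> sq (e (a n) - e c) < d
  & forall h (d : R), 0 < d -> exists N, forall n, (N <= n)%N -> sq (a n h - c h) < d].
Proof.
move=> C0 aM aC fast.
pose D n := a n.+1 - a n; have DM n : M (D n) by exact: vn_sub.
have DDM n : M (adj (D n) \o D n) by apply: vn_comp => //; exact: vn_adjM.
pose x n := (4 ^+ n)%:C%C *: (adj (D n) \o D n).
have xP n : M (x n) /\ positive_op (x n).
  split; first exact: vn_scale.
  apply: scaled_pos; first by rewrite exprn_ge0.
  exact: (adj_comp_pos vM (DM n)).
have xE n h : rip (x n h) h = 4 ^+ n * sq (a n.+1 h - a n h).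
  change (rip ((4 ^+ n)%:C%C *: adj (D n) (D n h)) h = 4 ^+ n * sq (a n.+1 h - a n h)).
  by rewrite ripZl (rip_adjl vM).
have xS m : \sum_(k < m) rphi phi (x k) <= 2.
  suff : \sum_(k < m) rphi phi (x k) <= 2 - 2 / 2 ^+ m.
    by move=> /le_trans; apply; rewrite lerBlDr lerDl divr_ge0 ?exprn_ge0.
  elim: m => [|m IH]; first by rewrite big_ord0 expr0 divr1 subrr.
  rewrite big_ord_recr /=.
  have : sq (e (D m)) <= 1 / 8 ^+ m by rewrite eB.
  rewrite (sq_e (DM m)) => h.
  have -> : rphi phi (x m) = 4 ^+ m * rphi phi (adj (D m) \o D m) by rewrite (rphiZ vM st).
  have p2 : 0 < 2 ^+ m :> R by rewrite exprn_gt0.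
  have p4 : 0 < 4 ^+ m :> R by rewrite exprn_gt0.
  have := ler_wpM2l (ltW p4) h.
  have -> : 4 ^+ m * (1 / 8 ^+ m) = 1 / 2 ^+ m :> R.
    rewrite (_ : 8 = 4 * 2 :> R); last by ring.
    by rewrite exprMn; field; rewrite !gt_eqF.
  by move: IH; rewrite exprS invfM; move: ((2 ^+ m)^-1) => i; lra.
have [r [rP rphi1 rx rdense]] := egorov vM st xP xS.
have rM n : M (r n) by case: (rP n).
have step n h k : sq (a k.+1 (r n h) - a k (r n h)) <= n.+1%:R * sq h / 4 ^+ k.
  have p4 : 0 < 4 ^+ k :> R by rewrite exprn_gt0.
  rewrite ler_pdivlMr // mulrC -xE; apply: le_trans (rx n k h) _.
  by rewrite ler_wpM2l //; case: (rP n) => _ _; apply.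
have nh0 n h : 0 <= n.+1%:R * sq h by rewrite mulr_ge0 ?sq_ge0.
have al n := vn_linear vM (aM n).
have lim h : exists l, forall d : R, 0 < d -> exists N, forall n, (N <= n)%N -> sq (a n h - l) < d.
  apply: hilbert_complete => d d0.
  have C1 : 0 < C + 1 by rewrite ltr_wpDl.
  have d'0 : 0 < d / (32 * (C + 1)) by rewrite divr_gt0 // mulr_gt0.
  have [n hn] := rdense h _ d'0.
  have [l hl] := fast_cvg (nh0 n h) (step n h).
  have C40 : 0 <= 4 * (n.+1%:R * sq h) by rewrite mulr_ge0.
  have d320 : 0 < d / 32 by rewrite divr_gt0.
  have [N hN] := pow4_small C40 d320.
  have app m : (N <= m)%N -> sq (a m h - l) < d / 4.
    move=> Nm; rewrite -(subrKA (a m (r n h))) -linearBf //.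
    apply: le_lt_trans (sqD_le _ _) _.
    have := aC m (h - r n h); have := hl m; have := hN m Nm.
    move: hn; rewrite ltr_pdivlMr ?mulr_gt0 //; have := sq_ge0 (h - r n h).
    move: (sq (h - r n h)) (sq (a m (h - r n h))) => p q p0 h1 h2 h3 h4.
    by have := mulr_ge0 C0 p0; lra.
  exists N => m p Nm Np; apply: (@sq_tri _ _ _ l); first exact: app.
  by rewrite sqC; exact: app.
have [c hc] := choice lim.
have cl : linear c.
  move=> k x1 x2; apply/eqP; rewrite -subr_eq0; apply/eqP/sq_le_small => d d0.
  pose s := complex.Re k ^+ 2 + complex.Im k ^+ 2.
  have s0 : 0 <= s by rewrite addr_ge0 ?sqr_ge0.
  have q0 : 0 < 4 * (2 * s + 3) by rewrite mulr_gt0 // ltr_wpDl // mulr_ge0.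
  have d'0 := divr_gt0 d0 q0.
  have [N1 h1] := hc (k *: x1 + x2) _ d'0; have [N2 h2] := hc x1 _ d'0.
  have [N3 h3] := hc x2 _ d'0; pose n := maxn N1 (maxn N2 N3).
  have g1 := h1 n (leq_maxl _ _); have g2 := h2 n (leq_trans (leq_maxl _ _) (leq_maxr _ _)).
  have g3 := h3 n (leq_trans (leq_maxr _ _) (leq_maxr _ _)).
  have -> : c (k *: x1 + x2) - (k *: c x1 + c x2) =
     (c (k *: x1 + x2) - a n (k *: x1 + x2)) + (k *: (a n x1 - c x1) + (a n x2 - c x2)).
    by rewrite al scalerBr (addrACA (k *: a n x1)) -opprD subrKA.
  apply: le_trans (sqD_le _ _) _; rewrite sqC.
  have := sqD_le (k *: (a n x1 - c x1)) (a n x2 - c x2); rewrite sqZ -/s.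
  move: g1 g2 g3; rewrite !ltr_pdivlMr //.
  set p := sq (a n (k *: x1 + x2) - _); set q := sq (a n x1 - _); set u := sq (a n x2 - _) => h4 h5 h6 h7.
  have p0 : 0 <= p := sq_ge0 _; have q1 : 0 <= q := sq_ge0 _; have u0 : 0 <= u := sq_ge0 _.
  have := mulr_ge0 s0 p0; have := mulr_ge0 s0 q1; have := mulr_ge0 s0 u0; lra.
have cC : bdd c C.
  move=> h; apply: sq_lim_le; first by rewrite mulr_ge0 ?sq_ge0.
  move=> d d0; have [N hN] := hc h d d0; exists (a N h); last exact: aC.
  by rewrite sqC; exact: hN.
have Mc : M c.
  apply: vn_strong => //; first by apply/bounded_opP; split=> //; exists C.
  move=> x1 x2 d d0; have [N hN] := hc x1 d d0; have [P hP] := hc x2 d d0.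
  by exists (a (maxn N P)) => //; split; [apply: hN; exact: leq_maxl|apply: hP; exact: leq_maxr].
exists c; split=> // d d0.
have C1 : 0 < C + 1 by rewrite ltr_wpDl.
have d'0 : 0 < d / (32 * (C + 1)) by rewrite divr_gt0 // mulr_gt0.
have [n hn] := invn_small d'0.
have Cn0 : 0 <= 4 * n.+1%:R :> R by rewrite mulr_ge0.
have d40 : 0 < d / 4 by rewrite divr_gt0.
have [N hN] := pow4_small Cn0 d40; exists N => k Nk.
have M1 := vn_id vM.
pose z := a k - c; have Mz : M z by exact: vn_sub.
have zC : bdd z (4 * C) by exact: bdd_sub.
have Mr' : M (idfun - r n) by exact: vn_sub.
(* Composed with [r n], the difference [z] is small in operator norm once [k] is large. On the
   complement it is only bounded, but there (1 - r)^2 <= 1 - r has value at most 2/(n+1) under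
   [phi]. *)
have zE : z = (z \o r n) + (z \o (idfun - r n)).
  apply/funext => h; change (z h = z (r n h) + z (h - r n h)).
  by rewrite -linearDf ?subrKC //; exact: vn_linear vM _ Mz.
have b1 : sq (e (z \o r n)) <= 4 * n.+1%:R / 4 ^+ k.
  have : bdd (z \o r n) (4 * n.+1%:R / 4 ^+ k).
    move=> h; have [l hl] := fast_cvg (nh0 n h) (step n h).
    have -> : (z \o r n) h = a k (r n h) - c (r n h) by [].
    suff -> : c (r n h) = l by apply: le_trans (hl k) _; rewrite mulrA mulrAC.
    apply/eqP; rewrite -subr_eq0; apply/eqP/sq_le_small => f f0.
    have f40 : 0 < f / 4 by rewrite divr_gt0.
    have C40 : 0 <= 4 * (n.+1%:R * sq h) by rewrite mulr_ge0.
    have [N1 h1] := hc (r n h) _ f40; have [N2 h2] := pow4_small C40 f40.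
    pose m := maxn N1 N2; apply/ltW; apply: (@sq_tri _ _ _ (a m (r n h))).
      by rewrite sqC; apply: h1; exact: leq_maxl.
    by apply: le_lt_trans (hl m) (h2 m (leq_maxr _ _)).
  move=> /(sq_e_comp (vn_comp vM Mz (rM n)) M1).
  have -> : (z \o r n) \o idfun = z \o r n by [].
  move=> /le_trans; apply; rewrite sq_e // adj_id (rphi_id st) mulr1.
  by [].
have b2 : sq (e (z \o (idfun - r n))) <= 4 * C * (2 / n.+1%:R).
  apply: le_trans (sq_e_comp Mz Mr' zC) _.
  rewrite ler_wpM2l ?mulr_ge0 // sq_e //.
  apply: le_trans (rphi1 n); rewrite -(rphi_id st) -(rphiB vM st) //.
  have [rnM rp r1] := rP n.
  have cp : positive_op (idfun - r n).
    by apply: (proj2 (oleP _ _)) => //; case: (pos_sa vM rnM rp).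
  have cadj := pos_adj (vn_linear vM Mr') cp.
  have Mcc : M (adj (idfun - r n) \o (idfun - r n)) by apply: vn_comp => //; exact: vn_adjM.
  apply: (rphi_le vM st) => //; apply: (proj2 (oleP _ _)) => //.
    by case: (pos_sa vM Mcc (adj_comp_pos vM Mr')).
  move=> h; change (rip (adj (idfun - r n) ((idfun - r n) h)) h <= rip ((idfun - r n) h) h).
  rewrite (rip_adjl vM) // ripxx -[leRHS]mul1r.
  apply: pos_sq => //; first exact: vn_linear vM _ Mr'.
  move=> g; change (rip (g - r n g) g <= 1 * sq g).
  by rewrite mul1r ripBl ripxx lerBlDr lerDl; exact: pos_rip.
rewrite -eB // -/z {1}zE eD; [|exact: vn_comp|exact: vn_comp].
apply: le_lt_trans (sqD_le _ _) _.
have h3 := hN k Nk; have := hn n (leqnn n); rewrite ltr_pdivlMr ?mulr_gt0 // => h4.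
have i0 : 0 <= n.+1%:R^-1 :> R by rewrite invr_ge0.
move: (n.+1%:R^-1) i0 h4 b2 => i i0 h4 b2.
by have := mulr_ge0 C0 i0; lra.
Qed.

(** The hypothesis says that left multiplication by [y] is at most 1 for the inner product of [phi];
    the conclusion concerns [H]. It is the source of [expectable_bdd]. *)
Lemma l2_order y : M y -> positive_op y ->
  (forall b, M b -> rphi phi (adj b \o (y \o b)) <= rphi phi (adj b \o b)) ->
  ole y idfun.
Proof.
move=> My yp hy.
have yl := vn_linear vM My; have [_ yadj] := pos_sa vM My yp.
have yE : adj y = y by exact: adjE.
have yM b : M b -> M (adj b \o (y \o b)).
  by move=> Mb; apply: vn_comp; [|exact: vn_adjM|exact: vn_comp].
have Mb2 b : M b -> M (adj b \o b) by move=> Mb; apply: vn_comp => //; exact: vn_adjM.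
(* That y <= 1 implies y^2 <= y, seen through [phi]: Cauchy-Schwarz for the form of [y] gives q^2 <=
   p s, and the hypothesis at [y \o b] gives s <= q. *)
have contr b : M b -> sq (e (y \o b)) <= sq (e b).
  move=> Mb; have Myb := vn_comp vM My Mb; have Myyb := vn_comp vM My Myb.
  pose p := rphi phi (adj b \o (y \o b)).
  pose q := sq (e (y \o b)).
  pose s := rphi phi (adj (y \o b) \o (y \o (y \o b))).
  have pos b' : M b' -> 0 <= rphi phi (adj b' \o (y \o b')).
    move=> Mb'; apply: (rphi_ge0 st); first exact: yM.
    by move=> h /=; rewrite (adjointC (vn_adjP vM Mb')); exact: yp.
  have qE : rphi phi (adj b \o (y \o (y \o b))) = q.
    by rewrite /q sq_e // (adj_comp vM) // yE.
  have CS : q ^+ 2 <= p * s.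
    apply: quad_disc; last exact: pos.
    move=> t; pose d := t%:C%C *: b + (y \o b).
    have Md : M d by exact: vn_comb.
    have := pos d Md.
    have -> : adj d \o (y \o d) = (t%:C%C) *: (t%:C%C *: (adj b \o (y \o b)) +
        ((adj b \o (y \o (y \o b))) + (adj b \o (y \o (y \o b)))))
        + (adj (y \o b) \o (y \o (y \o b))).
      rewrite /d (adj_comb vM) // conjR (adj_comp vM) // yE.
      have bl := vn_linear vM (vn_adjM vM Mb).
      apply/funext => h; change (t%:C%C *: adj b (y (t%:C%C *: b h + y (b h))) +
         adj b (y (y (t%:C%C *: b h + y (b h)))) =
         t%:C%C *: (t%:C%C *: adj b (y (b h)) + (adj b (y (y (b h))) + adj b (y (y (b h))))) +
         adj b (y (y (y (b h))))).
      rewrite !yl !bl !scalerDr -!addrA; congr (_ + (_ + _)).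
    have M1 := yM _ Mb; have M3 := yM _ Myb.
    have M2 : M (adj b \o (y \o (y \o b))) by apply: vn_comp => //; exact: vn_adjM.
    rewrite (rphiD st) //; last by apply: vn_scale => //; apply: vn_comb => //; exact: vn_add.
    rewrite (rphiZ vM st); last by apply: vn_comb => //; exact: vn_add.
    rewrite (rphiD st) ?(rphiZ vM st) ?(rphiD st) //; [|exact: vn_scale|exact: vn_add].
    by rewrite qE -/p -/s; lra.
  have sq' : s <= q by rewrite /q sq_e //; exact: hy.
  have pb : p <= sq (e b) by rewrite sq_e //; exact: hy.
  have p0 : 0 <= p by exact: pos.
  have q0 : 0 <= q by exact: sq_ge0.
  have : q ^+ 2 <= p * q by apply: le_trans CS _; rewrite ler_wpM2l.
  have [qz|qn] := eqVneq q 0; first by rewrite -/q qz => _; exact: sq_ge0.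
  by rewrite expr2 ler_pM2r ?lt_def ?qn // => /le_trans; apply.
pose P k := iter k (fun b => y \o b) idfun.
have PM k : M (P k) by exact: vn_iter_comp.
have Psq k : sq (e (P k)) <= 1.
  elim: k => [|k IH]; last exact: le_trans (contr _ (PM k)) IH.
  have -> : P 0%N = idfun by [].
  by rewrite sq_e ?adj_id ?(rphi_id st) //; exact: vn_id.
have PS k h : P k.+1 h = y (P k h) by [].
(* the growth rate of [y^k h] is at most [1] on a dense set of [h], while
   [|y^k h|] is logarithmically convex in [k] *)
have bound q h : 1 < q -> forall d, 0 < d -> exists2 v, sq (h - v) < d & sq (y v) <= q ^+ 2 * sq v.
  move=> q1 d d0; have q0 : 0 < q by apply: lt_trans q1.
  have qi0 : 0 <= q^-1 by rewrite invr_ge0 ltW.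
  (* The values under [phi] are at most q^-k, with sum at most q/(q - 1); [egorov] then yields
     vectors v = r_n h with |y^k v|^2 <= C q^k for all k. *)
  pose x k := (q^-1 ^+ k)%:C%C *: (adj (P k) \o P k).
  have xP k : M (x k) /\ positive_op (x k).
    split; first by apply: vn_scale => //; exact: Mb2.
    by apply: scaled_pos; [rewrite exprn_ge0|exact: (adj_comp_pos vM (PM k))].
  have q10 : 0 < q - 1 by rewrite subr_gt0.
  have xS m : \sum_(k < m) rphi phi (x k) <= q / (q - 1).
    suff : \sum_(k < m) rphi phi (x k) <= q / (q - 1) * (1 - q^-1 ^+ m).
      move=> /le_trans; apply; rewrite ger_pMr ?divr_gt0 // lerBlDr lerDl exprn_ge0 //.
    elim: m => [|m IH]; first by rewrite big_ord0 expr0 subrr mulr0.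
    rewrite big_ord_recr /= (rphiZ vM st); last exact: Mb2.
    have := ler_wpM2l (exprn_ge0 m qi0) (Psq m); rewrite sq_e // mulr1.
    have -> : q / (q - 1) * (1 - q^-1 ^+ m.+1) = q / (q - 1) * (1 - q^-1 ^+ m) + q^-1 ^+ m.
      rewrite exprS; move: (q^-1 ^+ m) => i; field.
      by rewrite !gt_eqF.
    by move: IH; lra.
  have [r [rP _ rx rdense]] := egorov vM st xP xS.
  have [n hn] := rdense h d d0; exists (r n h) => //.
  set v := r n h; pose s k := sq (P k v).
  pose C := n.+1%:R * rip (r n h) h.
  have sC k : s k <= C * q ^+ k.
    have qk : 0 < q ^+ k by rewrite exprn_gt0.
    have := rx n k h; rewrite -/v -/C.
    change (rip ((q^-1 ^+ k)%:C%C *: adj (P k) (P k v)) v <= C -> s k <= C * q ^+ k).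
    by rewrite ripZl (rip_adjl vM) // ripxx -/(s k) exprVn mulrC ler_pdivrMr.
  have sconv k : s k.+1 ^+ 2 <= s k * s k.+2.
    rewrite /s -{1}ripxx {1}PS (rip_adj _ _ yadj) -PS.
    exact: rip_CS.
  change (s 1%N <= q ^+ 2 * s 0%N).
  (* If s_1 > q^2 s_0, log-convexity keeps all later ratios above q^2, so that s_k grows like
     q^(2k), against the bound C q^k. Bernoulli's inequality makes the contradiction explicit. *)
  rewrite leNgt; apply/negP => s01.
  have s0 k : 0 <= s k by exact: sq_ge0.
  have q20 : 0 < q ^+ 2 by rewrite exprn_gt0.
  have grow k : q ^+ 2 * s k < s k.+1.
    elim: k => [//|k IH]; have sk1 : 0 < s k.+1.
      by apply: le_lt_trans IH; rewrite mulr_ge0 // ltW.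
    have [sk|skn] := eqVneq (s k) 0.
      by have := sconv k; rewrite sk mul0r leNgt exprn_gt0.
    have sk0 : 0 < s k by rewrite lt_def skn s0.
    rewrite -(ltr_pM2l sk0); apply: lt_le_trans (sconv k).
    by rewrite mulrCA mulrA expr2 ltr_pM2r.
  have s10 : 0 < s 1%N by apply: le_lt_trans s01; rewrite mulr_ge0 // ltW.
  have grow' k : (q ^+ 2) ^+ k * s 1%N <= s k.+1.
    elim: k => [|k IH]; first by rewrite expr0 mul1r.
    rewrite exprS -mulrA; apply: le_trans (ltW (grow k.+1)).
    by rewrite ler_pM2l.
  have C0 : 0 <= C by have := sC 0%N; rewrite expr0 mulr1; exact: le_trans.
  have qs k : q ^+ k * s 1%N <= C * q.
    have qk : 0 < q ^+ k by rewrite exprn_gt0.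
    have := le_trans (grow' k) (sC k.+1).
    have -> : (q ^+ 2) ^+ k = q ^+ k * q ^+ k by rewrite -exprM mulnC exprM expr2.
    by rewrite exprS; move: (q ^+ k) qk => w w0 h1; rewrite -(ler_pM2r w0); lra.
  have bern k : 1 + k%:R * (q - 1) <= q ^+ k.
    elim: k => [|k IH]; first by rewrite mul0r addr0 expr0.
    rewrite exprS -natr1; have := ler_wpM2l (ltW q0) IH; apply: le_trans.
    by have := mulr_ge0 (ler0n R k) (sqr_ge0 (q - 1)); rewrite expr2; lra.
  have e0 : 0 < s 1%N * (q - 1) / (C * q + 1).
    by rewrite divr_gt0 ?mulr_gt0 // ltr_wpDl // mulr_ge0 // ltW.
  have [N hN] := invn_small e0; have := hN N (leqnn N).
  rewrite ltr_pdivlMr; last by rewrite ltr_wpDl // mulr_ge0 // ltW.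
  rewrite mulrC ltr_pdivrMr ?ltr0n // => hlt.
  have := qs N.+1; have := ler_wpM2r (ltW s10) (bern N.+1).
  by move: (N.+1%:R) (q ^+ N.+1) hlt => i w hlt; lra.
have sqy h : sq (y h) <= sq h.
  have /bounded_opP [_ [C C0 yC]] := vn_bounded vM My.
  have h0 := sq_ge0 h; have C1 : 0 < C + 1 by rewrite ltr_wpDl.
  (* Two factors 1 + t come from [bound] with q = 1 + t, the third from replacing |v|^2 by |h|^2;
     the tolerance f t / (1 + t)^3 on |h - v|^2 absorbs the cross term into [f]. *)
  have cube t f : 0 < t -> 0 < f -> sq (y h) <= (1 + t) ^+ 3 * sq h + f.
    move=> t0 f0; have q1 : 1 < 1 + t by rewrite ltrDl.
    have q3 : 0 < (1 + t) ^+ 3 by rewrite exprn_gt0 // addr_gt0.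
    have b0 : 0 <= (1 + t) ^+ 3 * sq h + f := addr_ge0 (mulr_ge0 (ltW q3) h0) (ltW f0).
    apply: (sq_lim_le b0) => d d0.
    have m0 : 0 < Num.min (d / (C + 1)) (f * t / (1 + t) ^+ 3).
      by rewrite lt_min !divr_gt0 // mulr_gt0.
    have [v hv yv] := bound (1 + t) h q1 _ m0; move: hv; rewrite lt_min => /andP[].
    rewrite !ltr_pdivlMr // => hv1 hv2; exists (y v).
      rewrite -linearBf //; apply: le_lt_trans (yC _) _; apply: le_lt_trans hv1.
      by rewrite mulrC ler_wpM2l ?sq_ge0 // lerDl.
    apply: le_trans yv _.
    have vh : t * sq v <= t * (1 + t) * sq h + (1 + t) * sq (h - v).
      have vE : sq v = sq h - 2 * rip h (h - v) + sq (h - v).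
        by rewrite -sqB subKr.
      by have := sq_ge0 (t%:C%C *: h + (h - v)); rewrite (sqD (t%:C%C *: h)) sqZr ripZl vE expr2; lra.
    have q20 : 0 < (1 + t) ^+ 2 by rewrite exprn_gt0 // addr_gt0.
    rewrite -(ler_pM2l t0); have := ler_wpM2l (ltW q20) vh.
    by move: hv2; rewrite !exprS expr0; lra.
  apply/ler_addgt0Pl => f f0.
  (* For t <= 1 one has (1 + t)^3 <= 1 + 7 t; with 14 instead of 7 the excess is at most f/2, and
     the other half is spent in [cube]. *)
  pose t := Num.min 1 (f / (14 * (sq h + 1))).
  have k0 : 0 < 14 * (sq h + 1) by rewrite mulr_gt0 // ltr_wpDl.
  have t0 : 0 < t by rewrite lt_min ltr01 divr_gt0.
  have t1 : t <= 1 by rewrite ge_min lexx.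
  have tf : t * (14 * (sq h + 1)) <= f.
    by rewrite -ler_pdivlMr // ge_min lexx orbT.
  have f20 : 0 < f / 2 by rewrite divr_gt0.
  apply: le_trans (cube t (f / 2) t0 f20) _.
  have c3 : (1 + t) ^+ 3 <= 1 + 7 * t.
    have tt : t * t <= t by rewrite ger_pMl.
    have ttt : t * t * t <= t by apply: le_trans tt; rewrite ger_pMr // mulr_gt0.
    by rewrite !exprS expr0; lra.
  have := ler_wpM2r h0 c3; have := mulr_ge0 (ltW t0) h0; move: tf; lra.
move=> h; have := rip_CS (y h) h; have := sqy h => h1 h2.
rewrite /= ripxx; apply: (le_trans (ler_norm _)).
rewrite -ler_sqr ?nnegrE ?sq_ge0 // real_normK ?num_real //; apply: le_trans h2 _.
by rewrite expr2 ler_wpM2r ?sq_ge0.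
Qed.

End L2.

(** * Extension, projections and density *)

Section Extension.
Context {R : realType} {K : hilbertType R}.

Lemma dense_eq (G : set K) (S T : K -> K) : (forall x, adh G x) ->
  bounded_op S -> bounded_op T -> (forall x, G x -> S x = T x) -> S = T.
Proof.
move=> dG /bounded_opP [Sl [C C0 SC]] /bounded_opP [Tl [D D0 TD]] h; apply/funext => x.
apply/eqP; rewrite -subr_eq0; apply/eqP/sq_le_small => d d0.
have k0 : 0 < 2 * C + 2 * D + 1 by rewrite ltr_wpDl // addr_ge0 ?mulr_ge0.
have [g Gg hg] := dG x _ (divr_gt0 d0 k0).
rewrite -(subrKA (S g)) -linearBf // (h g Gg) -linearBf // .
apply: le_trans (sqD_le _ _) _; have := SC (x - g); have := TD (g - x).
rewrite (sqC g x); move: hg; rewrite ltr_pdivlMr //; have := sq_ge0 (x - g).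
move: (sq (x - g)) (sq (S _)) (sq (T _)) => p s t p0 h1 h2 h3; lra.
Qed.

Lemma dense_adjoint (G : set K) (S T : K -> K) : (forall x, adh G x) ->
  bounded_op S -> bounded_op T ->
  (forall x y, G x -> G y -> rip (S x) y = rip x (T y)) -> adjoint S T.
Proof.
move=> dG Sb Tb h; have [S' S'b SS'] := adjoint_ex Sb.
suff <- : S' = T by [].
apply: (dense_eq dG) => // y Gy; apply/eqP; rewrite -subr_eq0; apply/eqP.
apply: sq_eq0; rewrite -ripxx; apply: (@rip_adh0 _ _ G) => // g Gg.
by rewrite ripBr -(rip_adj _ _ SS') h // subrr.
Qed.

(** The data are indexed by names of vectors, since [e n a] has many names; the bound shows that
    [t i] depends on [g i] only. *)
Lemma extension (I : Type) (D : set I) (g t : I -> K) (C : R) : 0 <= C ->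
  (forall c i j, D i -> D j -> exists k, [/\ D k, g k = c *: g i + g j & t k = c *: t i + t j]) ->
  (forall i, D i -> sq (t i) <= C * sq (g i)) ->
  (forall x d, 0 < d -> exists2 i, D i & sq (x - g i) < d) ->
  exists T : K -> K, bounded_op T /\ forall i, D i -> T (g i) = t i.
Proof.
move=> C0 comb bd dense.
have C1 : 0 < C + 1 by rewrite ltr_wpDl.
have lip i j : D i -> D j -> sq (t i - t j) <= C * sq (g i - g j).
  move=> Di Dj; have [k [Dk gk tk]] := comb (-1) j i Dj Di.
  by have := bd k Dk; rewrite gk tk !scaleN1r ![- _ + _]addrC.
have lim x : exists y, forall d : R, 0 < d -> exists2 f : R, 0 < f &
    forall i, D i -> sq (x - g i) < f -> sq (y - t i) < d.
  have ex (n : nat) : exists i, D i /\ sq (x - g i) < n.+1%:R^-1.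
    have n0 : 0 < n.+1%:R^-1 :> R by rewrite invr_gt0.
    by have [i Di hi] := dense x _ n0; exists i.
  have [u hu] := choice ex.
  have near i j f : D i -> D j -> sq (x - g i) < f / (4 * (C + 1)) ->
      sq (x - g j) < f / (4 * (C + 1)) -> sq (t i - t j) < f.
    move=> Di Dj hi hj; apply: le_lt_trans (lip i j Di Dj) _.
    have := sqD_le (g i - x) (x - g j); rewrite subrKA (sqC (g i)).
    move: hi hj; rewrite !ltr_pdivlMr ?mulr_gt0 //.
    move: (sq_ge0 (x - g i)) (sq_ge0 (x - g j)) (sq_ge0 (g i - g j)).
    move: (sq (x - g i)) (sq (x - g j)) (sq (g i - g j)) => p q r p0 q0 r0 h1 h2 h3.
    by have := ler_wpM2l C0 h3; lra.
  have [y hy] : exists y, cvgs (fun n => t (u n)) y.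
    apply: hilbert_complete => d d0.
    have d'0 : 0 < d / (4 * (C + 1)) by rewrite divr_gt0 // mulr_gt0.
    have [N hN] := invn_small d'0; exists N => m n Nm Nn.
    have [[Dm hm] [Dn hn]] := (hu m, hu n).
    by apply: near => //; [exact: lt_trans hm (hN m Nm)|exact: lt_trans hn (hN n Nn)].
  exists y => d d0; have d4 : 0 < d / 4 by rewrite divr_gt0.
  have d'0 : 0 < d / 4 / (4 * (C + 1)) by rewrite divr_gt0 // mulr_gt0.
  exists (d / 4 / (4 * (C + 1))) => // i Di hi.
  have [N hN] := invn_small d'0; have [P hP] := hy _ d4; pose n := maxn N P.
  have [Dn hn] := hu n; apply: (@sq_tri _ _ _ (t (u n))).
    by rewrite sqC; apply: hP; exact: leq_maxr.
  by apply: near => //; apply: lt_trans hn (hN n _); exact: leq_maxl.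
have [T hT] := choice lim.
have Tg i : D i -> T (g i) = t i.
  move=> Di; apply/eqP; rewrite -subr_eq0; apply/eqP/sq_le_small => d d0; apply/ltW.
  by have [f f0 hf] := hT (g i) d d0; apply: hf; rewrite ?subrr ?sq0.
exists T; split=> //; apply/bounded_opP; split.
  move=> c x y; apply/eqP; rewrite -subr_eq0; apply/eqP/sq_le_small => d d0.
  pose s := complex.Re c ^+ 2 + complex.Im c ^+ 2.
  have s0 : 0 <= s by rewrite addr_ge0 ?sqr_ge0.
  have q0 : 0 < 4 * (2 * s + 3) by rewrite mulr_gt0 // ltr_wpDl // mulr_ge0.
  have d'0 := divr_gt0 d0 q0.
  have [f1 f10 h1] := hT (c *: x + y) _ d'0; have [f2 f20 h2] := hT x _ d'0.
  have [f3 f30 h3] := hT y _ d'0.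
  have m0 : 0 < Num.min (f1 / (4 * s + 4)) (Num.min f2 f3).
    by rewrite !lt_min f20 f30 andbT divr_gt0 // ltr_wpDl // mulr_ge0.
  have [i Di] := dense x _ m0; have [j Dj] := dense y _ m0.
  rewrite !lt_min => /andP[j1 /andP[_ j3]] /andP[i1 /andP[i2 _]].
  have [k [Dk gk tk]] := comb c i j Di Dj.
  have g2 := h2 i Di i2; have g3 := h3 j Dj j3.
  have g1 : sq (T (c *: x + y) - t k) < d / (4 * (2 * s + 3)).
    apply: h1 => //; have -> : c *: x + y - g k = c *: (x - g i) + (y - g j).
      by rewrite gk scalerBr opprD addrACA.
    apply: le_lt_trans (sqD_le _ _) _; rewrite sqZ -/s.
    move: i1 j1; rewrite !ltr_pdivlMr; [|by rewrite ltr_wpDl // mulr_ge0|by rewrite ltr_wpDl // mulr_ge0].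
    have := sq_ge0 (x - g i); have := sq_ge0 (y - g j).
    move: (sq (x - g i)) (sq (y - g j)) => p r r0 p0 h4 h5.
    have := mulr_ge0 s0 p0; have := mulr_ge0 s0 r0; lra.
  have -> : T (c *: x + y) - (c *: T x + T y) =
     (T (c *: x + y) - t k) + (c *: (t i - T x) + (t j - T y)).
    by rewrite tk scalerBr (addrACA (c *: t i)) -opprD subrKA.
  apply: le_trans (sqD_le _ _) _.
  have := sqD_le (c *: (t i - T x)) (t j - T y); rewrite sqZ -/s (sqC (t i)) (sqC (t j)).
  move: g1 g2 g3; rewrite !ltr_pdivlMr //.
  set p := sq (T (c *: x + y) - _); set q := sq (T x - _); set u := sq (T y - _) => h4 h5 h6 h7.
  have p0 : 0 <= p := sq_ge0 _; have q1 : 0 <= q := sq_ge0 _; have u0 : 0 <= u := sq_ge0 _.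
  have := mulr_ge0 s0 p0; have := mulr_ge0 s0 q1; have := mulr_ge0 s0 u0; lra.
exists (4 * C) => [|x]; first by rewrite mulr_ge0.
apply/ler_addgt0Pl => d d0.
have k0 : 0 < 4 * (C + 1) by rewrite mulr_gt0.
have d4 : 0 < d / 4 by rewrite divr_gt0.
have [f f0 hf] := hT x _ d4.
have m0 : 0 < Num.min f (d / (8 * (C + 1))) by rewrite lt_min f0 divr_gt0 // mulr_gt0.
have [i Di] := dense x _ m0; rewrite lt_min => /andP[i1 i2].
have h1 := hf i Di i1; have h2 := bd i Di.
have := sqD_le (T x - t i) (t i); have := sqD_le (g i - x) x; rewrite !subrK (sqC (g i)).
move: i2; rewrite ltr_pdivlMr ?mulr_gt0 //; have := sq_ge0 (x - g i); move: h1 h2.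
move: (sq (x - g i)) (sq (g i)) (sq (T x - t i)) (sq (t i)) => p q u v h1 h2 p0 h3 h4 h5.
have := ler_wpM2l C0 h4; have := mulr_ge0 C0 p0; lra.
Qed.

End Extension.

(** * Orthogonal projection on the closure of a subspace *)

Section Projection.
Context {R : realType} {H : hilbertType R}.
Variable L : set H.
Hypotheses (L0 : L 0) (LP : forall c x y, L x -> L y -> L (c *: x + y)).

Lemma adh_sub : L `<=` adh L.
Proof. by move=> x Lx d d0; exists x => //; rewrite subrr sq0. Qed.

Lemma adh_lin c x y : adh L x -> adh L y -> adh L (c *: x + y).
Proof.
move=> ax ay d d0; pose s := complex.Re c ^+ 2 + complex.Im c ^+ 2.
have s0 : 0 <= s by rewrite addr_ge0 ?sqr_ge0.
have q0 : 0 < 4 * s + 4 by rewrite ltr_wpDl // mulr_ge0.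
have [u Lu hu] := ax _ (divr_gt0 d0 q0); have [v Lv hv] := ay _ (divr_gt0 d0 q0).
exists (c *: u + v); first exact: LP.
have -> : c *: x + y - (c *: u + v) = c *: (x - u) + (y - v).
  by rewrite scalerBr opprD addrACA.
apply: le_lt_trans (sqD_le _ _) _; rewrite sqZ -/s; move: hu hv; rewrite !ltr_pdivlMr //.
move: (sq_ge0 (x - u)) (sq_ge0 (y - v)); move: (sq (x - u)) (sq (y - v)) => p r p0 r0 h1 h2.
have := mulr_ge0 s0 p0; have := mulr_ge0 s0 r0; lra.
Qed.

Lemma adh_map (T : H -> H) x : bounded_op T -> (forall l, L l -> L (T l)) ->
  adh L x -> adh L (T x).
Proof.
move=> /bounded_opP [Tl [C C0 TC]] TL ax d d0.
have C1 : 0 < C + 1 by rewrite ltr_wpDl.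
have [u Lu hu] := ax _ (divr_gt0 d0 C1); exists (T u); first exact: TL.
rewrite -linearBf //; apply: le_lt_trans (TC _) _; move: hu; rewrite ltr_pdivlMr //.
by apply: le_lt_trans; rewrite mulrC ler_wpM2l ?sq_ge0 // lerDl.
Qed.

Lemma projection_ex : exists P : H -> H,
  [/\ bounded_op P, forall x, adh L (P x), forall x l, L l -> rip l (x - P x) = 0,
      forall x, adh L x -> P x = x
    & forall T T', bounded_op T -> adjoint T T' -> (forall l, L l -> L (T l)) ->
        (forall l, L l -> L (T' l)) -> forall x, P (T x) = T (P x)].
Proof.
have LPr (t : R) x y : L x -> L y -> L (t%:C%C *: x + y) by exact: LP.
have ex x : exists y, adh L y /\ forall l, L l -> rip l (x - y) = 0.
  by have [y yL hy] := orth_decomposition x L0 LPr; exists y.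
have [P hP] := choice ex.
have adhB x y : adh L x -> adh L y -> adh L (x - y).
  by move=> ax ay; rewrite addrC -scaleN1r; exact: adh_lin.
have uniq x y : adh L y -> (forall l, L l -> rip l (x - y) = 0) -> P x = y.
  move=> yL hy; have [PL hPx] := hP x.
  apply/eqP; rewrite -subr_eq0; apply/eqP/sq_eq0; rewrite -ripxx.
  apply: (@rip_adh0 _ _ L); last exact: adhB.
  move=> l Ll; have := hPx l Ll; have := hy l Ll; rewrite !ripBr; lra.
have Plin : linear P.
  move=> c x y; have [[PxL hx] [PyL hy]] := (hP x, hP y).
  apply: uniq; first exact: adh_lin.
  move=> l Ll; have -> : c *: x + y - (c *: P x + P y) = c *: (x - P x) + (y - P y).
    by rewrite scalerBr opprD addrACA.
  rewrite ripDr hy // addr0.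
  have Lc : L (Num.conj c *: l) by rewrite -[_ *: l]addr0; exact: LP.
  by rewrite /rip /rform ipZr -ipZl; exact: (hx _ Lc).
exists P; split.
- apply/bounded_opP; split=> //; exists 1 => // x; rewrite mul1r.
  have [PL hx] := hP x.
  have o : rip (P x) (x - P x) = 0 by apply: (rip_adh0 hx).
  by rewrite -{2}(subrK (P x) x) sqD (ripC (x - P x)) o mulr0 addr0 lerDr sq_ge0.
- by move=> x; case: (hP x).
- by move=> x l Ll; case: (hP x) => _ h; exact: h.
- by move=> x ax; apply: uniq => // l Ll; rewrite subrr rip0r.
move=> T T' Tb TT' TL T'L x; have [PL hx] := hP x; apply: uniq; first exact: adh_map.
move=> l Ll; rewrite -linearBf; last exact: bounded_lin.
by rewrite ripC (rip_adj _ _ TT') ripC; apply: hx; exact: T'L.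
Qed.

End Projection.

(** * Finite direct sums of copies of a Hilbert space *)

Section Amplification.
Context {R : realType} {K : hilbertType R} (I : finType).
Implicit Types (x y : I -> K).

Definition amp_form x y : R[i] := \sum_i ip (x i) (y i).

Lemma amp_qform x : qform amp_form x = \sum_i sq (x i).
Proof. by rewrite /qform /rform /amp_form raddf_sum. Qed.

Lemma amp_hilbert : hilbert_form amp_form.
Proof.
split.
- split=> [x y z|c x y|x y|x].
  + by rewrite /amp_form -big_split; apply: eq_bigr => i _; exact: ipDl.
  + by rewrite /amp_form mulr_sumr; apply: eq_bigr => i _; exact: ipZl.
  + by rewrite /amp_form rmorph_sum; apply: eq_bigr => i _; exact: ipC.
  + by apply: sumr_ge0 => i _; rewrite ipxx ler0c sq_ge0.
- move=> x; rewrite amp_qform => /eqP; rewrite psumr_eq0; last by move=> i _; exact: sq_ge0.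
  by move=> /allP h; apply/funext => i; apply/sq_eq0/eqP/h; rewrite mem_index_enum.
move=> u uC.
have comp i (x : I -> K) : sq (x i) <= qform amp_form x.
  by rewrite amp_qform (bigD1 i) //= lerDl sumr_ge0 // => j _; exact: sq_ge0.
have lim i : exists l, cvgs (fun n => u n i) l.
  apply: hilbert_complete => e e0; have [N hN] := uC e e0; exists N => m n Nm Nn.
  apply: le_lt_trans (hN m n Nm Nn); exact: (comp i (u m - u n)).
have [l hl] := choice lim; exists l => e e0.
have c0 : 0 < #|I|%:R + 1 :> R by rewrite ltr_wpDl.
have ex i : exists N, forall n, (N <= n)%N -> sq (u n i - l i) < e / (#|I|%:R + 1).
  by apply: hl; rewrite divr_gt0.
have [f hf] := choice ex; exists (\max_i f i)%N => n Nn; rewrite amp_qform.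
apply: (@le_lt_trans _ _ (\sum_(i : I) e / (#|I|%:R + 1))).
  apply: ler_sum => i _; apply/ltW/hf; apply: leq_trans Nn; exact: leq_bigmax.
by rewrite sumr_const -[_ *+ _]mulr_natr mulrAC ltr_pdivrMr // ltr_pM2l // ltrDl.
Qed.

End Amplification.

Record star_algebra (R : realType) (K : hilbertType R) (S : set (K -> K)) : Prop := {
  salg_bounded : forall s, S s -> bounded_op s;
  salg_adj : forall s, S s -> S (adj s);
  salg_id : S idfun;
  salg_comb : forall c s t, S s -> S t -> S (c *: s + t);
  salg_comp : forall s t, S s -> S t -> S (s \o t) }.

(** * Density of a star-algebra in its bicommutant *)

Section Density.
Context {R : realType} {K : hilbertType R} {S : set (K -> K)}.
Hypothesis sS : star_algebra S.
Local Notation N := (commutant (commutant S)).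

Lemma salg_0 : S 0.
Proof.
by have := salg_comb sS (-1) (salg_id sS) (salg_id sS); rewrite scaleN1r addNr.
Qed.

Lemma salg_Z c s : S s -> S (c *: s).
Proof. by move=> Ss; have := salg_comb sS c Ss salg_0; rewrite addr0. Qed.

Lemma salg_adjP s : S s -> adjoint s (adj s).
Proof. by move=> Ss; apply: adjP; exact: (salg_bounded sS). Qed.

(** The amplification argument of the bicommutant theorem: the projection on the closure of the
    vectors (s xi_i)_i commutes with the amplified [S], so its matrix entries lie in the commutant
    of [S] and commute with [X]; hence the amplified [X] preserves that closure. *)
Lemma weak_density (I : finType) (xi z : I -> K) X : N X ->
  (forall s, S s -> \sum_i ip (s (xi i)) (z i) = 0) ->
  \sum_i ip (X (xi i)) (z i) = 0.
Proof.
move=> NX hz.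
have [A [F [G [FK GK Flin Fip]]]] := hilbert_of_form (@amp_hilbert R K I).
have Xb : bounded_op X by case: NX.
have Glin : linear G.
  by move=> c x y; apply: (can_inj FK); rewrite GK Flin !GK.
pose L : set A := [set x | exists2 s, S s & x = F (fun i => s (xi i))].
have L0 : L 0.
  exists 0; first exact: salg_0.
  by rewrite -(linear0f Flin); congr F.
have LP c x y : L x -> L y -> L (c *: x + y).
  move=> [s Ss ->] [t St ->]; exists (c *: s + t); first exact: salg_comb.
  by rewrite -Flin.
have [P [Pb PL Pperp Pid Pcomm]] := projection_ex L0 LP.
pose amp (T : K -> K) (x : A) : A := F (fun i => T (G x i)).
have sqF x : sq (F x) = \sum_i sq (x i).
  by rewrite -amp_qform /sq /qform /rform Fip.
have amp_bounded T : bounded_op T -> bounded_op (amp T).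
  move=> /bounded_opP [Tl [C C0 TC]]; apply/bounded_opP; split.
    move=> c x y; rewrite /amp Glin -Flin; congr F.
    by apply/funext => i; exact: Tl.
  exists C => // x; rewrite /amp sqF -{2}(GK x) sqF mulr_sumr.
  by apply: ler_sum => i _; exact: TC.
have amp_adj T T' : adjoint T T' -> adjoint (amp T) (amp T').
  move=> TT' x y.
  have -> : ip (amp T x) y = \sum_i ip (T (G x i)) (G y i) by rewrite -{1}(GK y) Fip.
  have -> : ip x (amp T' y) = \sum_i ip (G x i) (T' (G y i)) by rewrite -{1}(GK x) Fip.
  by apply: eq_bigr => i _; exact: TT'.
pose delta j (k : K) : A := F (fun i => if i == j then k else 0).
have Pmat i j : commutant S (fun k => G (P (delta j k)) i).
  have dlin c k l : delta j (c *: k + l) = c *: delta j k + delta j l.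
    rewrite /delta -Flin; congr F; apply/funext => m.
    change ((if m == j then c *: k + l else 0) = c *: (if m == j then k else 0) + (if m == j then l else 0)).
    by case: ifP => _ //; rewrite scaler0 addr0.
  split; last first.
    move=> s Ss; apply/funext => k /=.
    have -> : s (G (P (delta j k)) i) = G (amp s (P (delta j k))) i by rewrite /amp FK.
    rewrite -(Pcomm _ (amp (adj s))).
    - congr (G (P _) i); rewrite /amp /delta FK; congr F; apply/funext => m.
      case: ifP => _ //; apply: linear0f.
      exact: bounded_lin (salg_bounded sS Ss).
    - apply: amp_bounded; exact: (salg_bounded sS).
    - by apply: amp_adj; exact: salg_adjP.
    - move=> _ [t St ->]; exists (s \o t); first exact: salg_comp.
      by rewrite /amp FK.
    - move=> _ [t St ->]; exists (adj s \o t); last by rewrite /amp FK.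
      by apply: salg_comp => //; exact: salg_adj.
  have /bounded_opP [Pl [C C0 PC]] := Pb; apply/bounded_opP; split.
    by move=> c k l; rewrite dlin Pl Glin.
  exists C => // k; apply: (@le_trans _ _ (sq (P (delta j k)))).
    rewrite -{2}(GK (P _)) sqF (bigD1 i) //= lerDl.
    by apply: sumr_ge0 => m _; exact: sq_ge0.
  apply: le_trans (PC _) _; rewrite ler_wpM2l // /delta sqF (bigD1 j) //= eqxx big1 ?addr0 //.
  by move=> m /negbTE ->; rewrite sq0.
have deltaE x : x = \sum_j delta j (G x j).
  have FS (J : seq I) : \sum_(j <- J) delta j (G x j) =
      F (\sum_(j <- J) (fun i => if i == j then G x j else 0)).
    elim: J => [|j J IH]; first by rewrite !big_nil linear0f.
    by rewrite !big_cons IH /delta -[F _]scale1r -Flin scale1r.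
  rewrite FS -{1}(GK x); congr F; apply/funext => i.
  rewrite fct_sumE (bigD1 i) //= eqxx big1 ?addr0 //.
  by move=> j; rewrite eq_sym => /negbTE ->.
have sumG (J : seq I) (v : I -> A) i : G (\sum_(j <- J) v j) i = \sum_(j <- J) G (v j) i.
  elim: J => [|j J IH]; first by rewrite !big_nil linear0f.
  by rewrite !big_cons linearDf // -IH.
have sumT (J : seq I) (T : K -> K) (v : I -> K) : linear T ->
    T (\sum_(j <- J) v j) = \sum_(j <- J) T (v j).
  move=> Tl; elim: J => [|j J IH]; first by rewrite !big_nil linear0f.
  by rewrite !big_cons linearDf // IH.
have sumP (J : seq I) (v : I -> A) : P (\sum_(j <- J) v j) = \sum_(j <- J) P (v j).
  have Pl := bounded_lin Pb; elim: J => [|j J IH]; first by rewrite !big_nil linear0f.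
  by rewrite !big_cons linearDf // IH.
have Xl := bounded_lin Xb.
have XP x : amp X (P x) = P (amp X x).
  apply: (can_inj GK); apply/funext => i; rewrite {1}/amp FK.
  rewrite {1}(deltaE x) sumP sumG sumT // [in RHS](deltaE (amp X x)) sumP sumG.
  apply: eq_bigr => j _; rewrite {1}/amp FK.
  have [_ /(_ _ (Pmat i j)) h] := NX.
  by have /(congr1 (fun f => f (G x j))) := h.
have Lxi : L (F xi) by exists idfun; [exact: salg_id|].
have XL : adh L (amp X (F xi)).
  by rewrite -(Pid _ (adh_sub Lxi)) XP; exact: PL.
have main (w : I -> K) : (forall s, S s -> \sum_i ip (s (xi i)) (w i) = 0) ->
    complex.Re (\sum_i ip (X (xi i)) (w i)) = 0.
  move=> hw; have : rip (amp X (F xi)) (F w) = 0.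
    apply: (rip_adh0 _ XL) => _ [s Ss ->].
    by rewrite /rip /rform Fip /amp_form hw.
  by rewrite /rip /rform Fip /amp_form FK.
(* [main] yields real parts only; the imaginary part is obtained from the vectors i z. *)
have iz s : S s -> \sum_i ip (s (xi i)) ('i%C *: z i) = 0.
  by move=> Ss; under eq_bigr do rewrite ipZr; rewrite -mulr_sumr hz // mulr0.
have := main _ hz; have := main _ iz; under eq_bigr do rewrite ipZr.
rewrite -mulr_sumr; case: (\sum_i _) => a b /= h1 h2; congr Complex => //.
by move: h1; lra.
Qed.

(** The approximants must stay self-adjoint for [bt_diff], so density is proved for the real
    subspace of self-adjoint elements, through [adh_criterion]. *)
Lemma sa_density (I : finType) (xi : I -> K) X (d : R) : N X -> adjoint X X -> 0 < d ->
  exists s, [/\ S s, adjoint s s & forall i, sq (X (xi i) - s (xi i)) < d].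
Proof.
move=> NX Xadj d0.
have [A [F [G [FK GK Flin Fip]]]] := hilbert_of_form (@amp_hilbert R K I).
pose L : set A := [set x | exists2 s, S s /\ adjoint s s & x = F (fun i => s (xi i))].
have sqF x : sq (F x) = \sum_i sq (x i).
  by rewrite -amp_qform /sq /qform /rform Fip.
have ripF x y : rip (F x) (F y) = complex.Re (\sum_i ip (x i) (y i)).
  by rewrite /rip /rform Fip.
have XL : adh L (F (fun i => X (xi i))).
  apply: adh_criterion.
  - exists 0; last by rewrite -(linear0f Flin); congr F.
    by split; [exact: salg_0|move=> u v; change (ip 0 v = ip u 0); rewrite ip0l ip0r].
  - move=> t _ _ [s [Ss ss] ->] [s' [Ss' ss'] ->]; exists (t%:C%C *: s + s'); last by rewrite -Flin.
    split; first exact: salg_comb.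
    by rewrite -{2}(conjR t); exact: adjoint_comb.
  move=> z0 hz; pose z := G z0.
  have {}hz s : S s -> adjoint s s -> complex.Re (\sum_i ip (s (xi i)) (z i)) = 0.
    move=> Ss ss; rewrite -ripF /z GK; apply: hz.
    by exists s.
  rewrite -(GK z0) ripF -/z.
  (* For self-adjoint T, the real part of the pairing of T xi with z is half the complex pairing of
     T (xi, z) with (z, xi). The doubled family brings the real statement back to [weak_density]. *)
  pose X2 (p : I + I) := match p with inl i => xi i | inr i => z i end.
  pose Z2 (p : I + I) := match p with inl i => z i | inr i => xi i end.
  have fold (T : K -> K) : \sum_p ip (T (X2 p)) (Z2 p) =
      \sum_i ip (T (xi i)) (z i) + \sum_i ip (T (z i)) (xi i).
    by rewrite big_sumType.
  have saE (T : K -> K) : adjoint T T -> \sum_p ip (T (X2 p)) (Z2 p) =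
      (2 * complex.Re (\sum_i ip (T (xi i)) (z i)))%:C%C.
    move=> TT; rewrite fold.
    have -> : \sum_i ip (T (z i)) (xi i) = Num.conj (\sum_i ip (T (xi i)) (z i)).
      by rewrite rmorph_sum; apply: eq_bigr => i _; rewrite TT; exact: ipC.
    by case: (\sum_i ip (T (xi i)) (z i)) => a b; congr Complex => /=; ring.
  have sa0 s : S s -> adjoint s s -> \sum_p ip (s (X2 p)) (Z2 p) = 0.
    by move=> Ss ss; rewrite saE // hz // mulr0.
  have all0 s : S s -> \sum_p ip (s (X2 p)) (Z2 p) = 0.
    move=> Ss; have ss' := salg_adjP Ss; have Ss' := salg_adj sS Ss.
    pose u := 1 *: s + adj s; pose v := 'i%C *: (-1 *: s + adj s).
    have Su : S u by exact: salg_comb.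
    have Sv : S v by apply: salg_Z; exact: salg_comb.
    have ua : adjoint u u.
      move=> p q; change (ip (1 *: s p + adj s p) q = ip p (1 *: s q + adj s q)).
      by rewrite !scale1r ipDl ipDr ss' (adjointC ss') addrC.
    have va : adjoint v v.
      move=> p q; change (ip ('i%C *: (-1 *: s p + adj s p)) q = ip p ('i%C *: (-1 *: s q + adj s q))).
      rewrite !scaleN1r ipZl ipZr !ipDl !ipDr ipNl ipNr ss' (adjointC ss').
      rewrite (_ : Num.conj 'i%C = - 'i%C :> R[i]); last by congr Complex; rewrite oppr0.
      by rewrite mulNr -mulrN opprD opprK addrC.
    have hu := sa0 u Su ua; have hv := sa0 v Sv va.
    have eu : \sum_p ip (u (X2 p)) (Z2 p) =
       \sum_p ip (s (X2 p)) (Z2 p) + \sum_p ip (adj s (X2 p)) (Z2 p).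
      rewrite -big_split; apply: eq_bigr => p _ /=.
      by change (ip (1 *: s (X2 p) + adj s (X2 p)) (Z2 p) = ip (s (X2 p)) (Z2 p) + ip (adj s (X2 p)) (Z2 p)); rewrite scale1r ipDl.
    have ev : \sum_p ip (v (X2 p)) (Z2 p) =
       'i%C * (- \sum_p ip (s (X2 p)) (Z2 p) + \sum_p ip (adj s (X2 p)) (Z2 p)).
      rewrite -sumrN -big_split mulr_sumr; apply: eq_bigr => p _ /=.
      by change (ip ('i%C *: (-1 *: s (X2 p) + adj s (X2 p))) (Z2 p) = 'i%C * (- ip (s (X2 p)) (Z2 p) + ip (adj s (X2 p)) (Z2 p))); rewrite ipZl ipDl scaleN1r ipNl.
    move: hu hv; rewrite eu ev; case: (\sum_p ip (s (X2 p)) (Z2 p)) => a b.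
    case: (\sum_p ip (adj s (X2 p)) (Z2 p)) => a' b' [h1 h2] [h3 h4].
    by congr Complex; move: h1 h2 h3 h4; lra.
  have := weak_density NX all0; rewrite saE // => -[] /eqP.
  by rewrite mulf_eq0 pnatr_eq0 /= => /eqP.
have [_ [s [Ss ss] ->] hs] := XL d d0; exists s; split=> // i.
apply: le_lt_trans hs.
have -> : F (fun i => X (xi i)) - F (fun i => s (xi i)) = F (fun i => X (xi i) - s (xi i)).
  by rewrite -scaleN1r addrC -Flin; congr F; apply/funext => j;
    change (-1 *: s (xi j) + X (xi j) = X (xi j) - s (xi j)); rewrite scaleN1r addrC.
rewrite sqF (bigD1 i) //= lerDl; apply: sumr_ge0 => m _; exact: sq_ge0.
Qed.

End Density.

Section BoundedTransform.
Context {R : realType} {K : hilbertType R}.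
Implicit Types (s X r : K -> K).

(** Here w is (1 + s^2)^-1 h, and |h|^2 = |w|^2 + 2 |s w|^2 + |s s w|^2. The bounds do not involve
    the norm of [s]. *)
Lemma bt_contr s (w h : K) : linear s -> adjoint s s -> w + s (s w) = h ->
  sq w <= sq h /\ sq (s w) <= sq h.
Proof.
move=> sl ss <-; rewrite sqD -(rip_adj _ _ ss) ripxx.
by have := sq_ge0 w; have := sq_ge0 (s w); have := sq_ge0 (s (s w)); split; lra.
Qed.

(* [s (1 + s^2)^-1 - X (1 + X^2)^-1
   = (1 + s^2)^-1 ((s - X) + s (X - s) X) (1 + X^2)^-1] *)
Lemma bt_diff s X rs r (xi : K) : linear s -> adjoint s s -> linear X -> linear rs ->
  (forall h, rs h + s (s (rs h)) = h) -> (forall h, rs (h + s (s h)) = h) ->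
  (forall h, r h + X (X (r h)) = h) ->
  sq (s (rs xi) - X (r xi)) <=
  2 * sq (s (r xi) - X (r xi)) + 2 * sq (s (X (r xi)) - X (X (r xi))).
Proof.
move=> sl ss Xl rl rs1 rs2 r1; set eta := r xi.
have comm v : rs (s v) = s (rs v).
  have E : s v = s (rs v) + s (s (s (rs v))) by rewrite -(linearDf _ _ sl) rs1.
  by rewrite E rs2.
have xiE : xi = eta + X (X eta) by rewrite r1.
have E1 : s (rs xi) = rs (s eta) + rs (s (X (X eta))).
  by rewrite -comm [in LHS]xiE (linearDf _ _ sl) (linearDf _ _ rl).
have E2 : X eta = rs (X eta) + rs (s (s (X eta))) by rewrite -(linearDf _ _ rl) rs2.
have -> : s (rs xi) - X eta = rs (s eta - X eta) + rs (s (X (X eta) - s (X eta))).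
  rewrite (linearBf _ _ sl) !(linearBf _ _ rl) addrACA -opprD.
  by rewrite -E1 -E2.
apply: le_trans (sqD_le _ _) _.
have [h1 _] := bt_contr sl ss (rs1 (s eta - X eta)).
have [_] := bt_contr sl ss (rs1 (X (X eta) - s (X eta))).
by rewrite -comm (sqC (X (X eta))); lra.
Qed.

End BoundedTransform.

(** * Normality and complete positivity *)

Section NormalOfState.
Context {R : realType} {H K : hilbertType R} {M : set (H -> H)} {N : set (K -> K)}.
Context {phi : (H -> H) -> R[i]} {psi : (K -> K) -> R[i]} {f : (H -> H) -> (K -> K)}.
Hypotheses (vM : von_neumann M) (vN : von_neumann N).
Hypotheses (sM : normal_faithful_state M phi) (sN : normal_faithful_state N psi).

(* if [t] is the supremum of [f d], [d] in [D], then [t <= f s] and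
   [psi (f s - t) = 0] *)
Lemma normal_of_state : set_fun M N f -> linear_on M f ->
  (forall a, M a -> positive_op a -> positive_op (f a)) ->
  (forall a, M a -> adjoint a a -> adjoint (f a) (f a)) ->
  (forall a, M a -> psi (f a) = phi a) -> normal_map M N f.
Proof.
move=> fM fL fp fa fphi D s DM dir slub; have [[Ms ss] Ds smin] := slub.
have fB a b : M a -> M b -> f (a - b) = f a - f b.
  by move=> Ma Mb; have := fL (-1) b a Mb Ma; rewrite !scaleN1r ![- _ + _]addrC.
have fmono a b : M a -> M b -> op_le a b -> op_le (f a) (f b).
  by move=> Ma Mb ab; rewrite /op_le -fB //; apply: fp => //; exact: vn_sub.
have fsa a : self_adjoint_part M a -> self_adjoint_part N (f a).
  by move=> [Ma aa]; split; [exact: fM|exact: fa].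
have fDM : f @` D `<=` self_adjoint_part N by move=> _ [d Dd <-]; exact/fsa/DM.
have fdir : up_directed op_le (f @` D).
  case: dir => -[d0 Dd0] dir; split; first by exists (f d0), d0.
  move=> _ _ [c Dc <-] [d Dd <-]; have [g [Dg cg dg]] := dir c d Dc Dd.
  have [[Mc _] [Md _] [Mg _]] := And3 (DM c Dc) (DM d Dd) (DM g Dg).
  by exists (f g); split; [exists g|exact: fmono|exact: fmono].
have fub v : (f @` D) v -> op_le v (f s).
  by move=> [d Dd <-]; have [Md _] := DM d Dd; apply: fmono => //; exact: Ds.
have [t tlub] := lub_ex vN fDM fdir (fsa s (conj Ms ss)) fub.
have [[Nt tt] tub tmin] := tlub.
have tfs : op_le t (f s) by apply: tmin => //; exact: fsa.
have Nfs := fM s Ms.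
have rE a : M a -> rphi psi (f a) = rphi phi a by move=> Ma; rewrite /rphi fphi.
suff <- : t = f s by [].
apply/esym/eqP; rewrite -subr_eq0; apply/eqP; apply: (rphi_faithful sN) => //.
  exact: vn_sub.
apply/eqP; rewrite eq_le (rphi_ge0 sN) ?andbT //; last exact: vn_sub.
rewrite (rphiB vN sN) // rE // subr_le0; apply: (rphi_lub vM sM DM dir slub) => d Dd.
have [Md _] := DM d Dd; rewrite -rE //; apply: (rphi_le vN sN) => //; first exact: fM.
by apply: tub; exists d.
Qed.

End NormalOfState.

(** * Positivity of operator matrices from cyclic vectors *)

Section CPCyclic.
Context {R : realType} {H : hilbertType R}.

Lemma rip_ge0_adh (S : H -> H) (D : set H) x : bounded_op S -> adh D x ->
  (forall y, D y -> 0 <= rip (S y) y) -> 0 <= rip (S x) x.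
Proof.
move=> /bounded_opP [Sl [C C0 SC]] Dx h; apply/ler_addgt0Pl => e e0.
(* Dominates, per unit of |w|^2, the squares of the three error terms <S w, x>, <S x, w> and <S w,
   w>, each of which is then at most e/3. *)
pose k := C * sq x + sq (S x) + C + 1.
have k0 : 0 < k by rewrite ltr_wpDl // !addr_ge0 ?mulr_ge0 ?sq_ge0.
pose t := Num.min 1 ((e / 3) ^+ 2 / k).
have e3 : 0 < (e / 3) ^+ 2 by rewrite exprn_gt0 // divr_gt0.
have t0 : 0 < t by rewrite lt_min ltr01 divr_gt0.
have [y Dy] := Dx t t0; rewrite lt_min ltr_pdivlMr // => /andP[p1 pk].
have := h y Dy; set w := x - y in p1 pk.
have -> : y = x - w by rewrite subKr.
clearbody w.
rewrite linearBf // ripBl !ripBr => hy.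
have p0 := sq_ge0 w.
have small a : a ^+ 2 <= sq w * k -> `|a| <= e / 3.
  move=> ha; rewrite -ler_sqr ?nnegrE ?divr_ge0 ?(ltW e0) //.
  by rewrite real_normK ?num_real //; apply: le_trans ha (ltW pk).
have kk a : 0 <= a -> a <= k -> sq w * a <= sq w * k by move=> _ ak; rewrite ler_wpM2l.
have Sx0 := sq_ge0 (S x); have x0 := sq_ge0 x; have Cx0 := mulr_ge0 C0 x0.
have a1 : `|rip (S w) x| <= e / 3.
  apply: small; apply: le_trans (rip_CS _ _) _.
  apply: (@le_trans _ _ (sq w * (C * sq x))).
    by rewrite mulrA ler_wpM2r // mulrC; exact: SC.
  by apply: kk => //; rewrite /k; lra.
have a2 : `|rip (S x) w| <= e / 3.
  apply: small; apply: le_trans (rip_CS _ _) _; rewrite mulrC.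
  by apply: kk => //; rewrite /k; lra.
have a3 : `|rip (S w) w| <= e / 3.
  apply: small; apply: le_trans (rip_CS _ _) _.
  apply: (@le_trans _ _ (sq w * C)); last by apply: kk => //; rewrite /k; lra.
  apply: (@le_trans _ _ (sq (S w) * 1)); first by rewrite ler_wpM2l ?sq_ge0 // ltW.
  by rewrite mulr1 mulrC; exact: SC.
move: a1 a2 a3; rewrite !ler_norml => /andP[? ?] /andP[? ?] /andP[? ?].
lra.
Qed.

Lemma ip_ge0_adh (S : H -> H) (D : set H) x : bounded_op S -> adh D x ->
  (forall y, D y -> 0 <= ip (S y) y) -> 0 <= ip (S x) x.
Proof.
move=> Sb Dx h.
have [re im] : (forall y, D y -> 0 <= rip (S y) y) /\ (forall y, D y -> rip (S y) ('i%C *: y) = 0).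
  by split=> y Dy; have := h y Dy; rewrite ipE lecE /= => /andP[/eqP].
have Zb c : bounded_op (c *: S).
  have /bounded_opP [Sl [C C0 SC]] := Sb; apply/bounded_opP; split.
    move=> k u v; change (c *: S (k *: u + v) = k *: (c *: S u) + c *: S v).
    by rewrite Sl scalerDr !scalerA mulrC.
  exists ((complex.Re c ^+ 2 + complex.Im c ^+ 2) * C) => [|u].
    by rewrite mulr_ge0 ?addr_ge0 ?sqr_ge0.
  change (sq (c *: S u) <= (complex.Re c ^+ 2 + complex.Im c ^+ 2) * C * sq u).
  by rewrite sqZ -mulrA ler_wpM2l ?addr_ge0 ?sqr_ge0 //; exact: SC.
have h1 := rip_ge0_adh Sb Dx re.
(* The imaginary part vanishes in the limit because i S and - i S both satisfy the real hypothesis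
   on [D]. *)
have h2 : 0 <= rip ('i%C *: S x) x.
  apply: (rip_ge0_adh (Zb 'i%C) Dx) => y Dy.
  by change (0 <= rip ('i%C *: S y) y); rewrite ripi im // oppr0.
have h3 : 0 <= rip ((- 'i%C) *: S x) x.
  apply: (rip_ge0_adh (Zb (- 'i%C)) Dx) => y Dy.
  by change (0 <= rip ((- 'i%C) *: S y) y); rewrite scaleNr ripNl ripi im // !oppr0.
rewrite ipE lecE /= h1 andbT; move: h2 h3; rewrite scaleNr ripNl ripi opprK => h2 h3.
by apply/eqP; lra.
Qed.

Lemma bounded_zero : bounded_op (0 : H -> H).
Proof.
apply/bounded_opP; split=> [c x y|].
  by change ((0 : H) = c *: 0 + 0); rewrite scaler0 addr0.
by exists 0 => // x; change (sq (0 : H) <= 0 * sq x); rewrite sq0 mul0r.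
Qed.

Lemma ip_suml (I : Type) (J : seq I) (v : I -> H) y :
  ip (\sum_(i <- J) v i) y = \sum_(i <- J) ip (v i) y.
Proof.
elim: J => [|i J IH]; first by rewrite !big_nil ip0l.
by rewrite !big_cons ipDl IH.
Qed.

Lemma vn_sum (M : set (H -> H)) (I : Type) (J : seq I) (a : I -> H -> H) :
  von_neumann M -> (forall i, M (a i)) -> M (\sum_(i <- J) a i).
Proof.
move=> vM Ma; elim: J => [|i J IH]; first by rewrite big_nil; exact: vn_0.
by rewrite big_cons; exact: vn_add.
Qed.

Lemma bounded_sum (I : Type) (J : seq I) (S : I -> H -> H) :
  (forall i, bounded_op (S i)) -> bounded_op (\sum_(i <- J) S i).
Proof.
move=> Sb; elim: J => [|i J IH]; first by rewrite big_nil; exact: bounded_zero.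
by rewrite big_cons -[S i]scale1r; exact: bounded_comb.
Qed.

End CPCyclic.

(* The coordinates of a vector of [H^n] are moved one after the other into the
   cyclic subspace generated by one of them, whose projection commutes with [M]. *)
Lemma positive_of_cyclic (R : realType) (H : hilbertType R) (M : set (H -> H)) n
    (c : 'I_n -> 'I_n -> H -> H) :
  von_neumann M -> (forall i j, M (c i j)) ->
  (forall h (b : 'I_n -> H -> H), (forall j, M (b j)) ->
     0 <= \sum_i \sum_j ip (c i j (b j h)) (b i h)) ->
  forall x : 'I_n -> H, 0 <= \sum_i \sum_j ip (c i j (x j)) (x i).
Proof.
move=> vM Mc hc.
have [A [F [G [FK GK Flin Fip]]]] := hilbert_of_form (@amp_hilbert R H 'I_n).
have sqF x : sq (F x) = \sum_i sq (x i) by rewrite -amp_qform /sq /qform /rform Fip.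
have Glin : linear G by move=> k x y; apply: (can_inj FK); rewrite GK Flin !GK.
pose E i j (x : A) : A := F (fun k => if k == i then c i j (G x j) else 0).
have Eb i j : bounded_op (E i j).
  have /bounded_opP [cl [C C0 cC]] := vn_bounded vM (Mc i j).
  apply/bounded_opP; split.
    move=> k x y; rewrite /E -Flin; congr F; apply/funext => m.
    change ((if m == i then c i j (G (k *: x + y) j) else 0) =
      k *: (if m == i then c i j (G x j) else 0) + (if m == i then c i j (G y j) else 0)).
    by case: ifP => _; rewrite ?scaler0 ?addr0 // Glin -cl.
  exists C => // x; rewrite /E sqF (bigD1 i) //= eqxx big1 ?addr0; last first.
    by move=> m /negbTE ->; rewrite sq0.
  apply: le_trans (cC _) _; rewrite ler_wpM2l // -{2}(GK x) sqF (bigD1 j) //= lerDl.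
  by apply: sumr_ge0 => m _; exact: sq_ge0.
pose S : A -> A := \sum_(i < n) \sum_(j < n) E i j.
have Sb : bounded_op S by apply: bounded_sum => i; exact: bounded_sum.
have SE x : ip (S (F x)) (F x) = \sum_i \sum_j ip (c i j (x j)) (x i).
  rewrite /S fct_sumE ip_suml; apply: eq_bigr => i _.
  rewrite fct_sumE ip_suml; apply: eq_bigr => j _.
  rewrite /E FK Fip /amp_form (bigD1 i) //= eqxx big1 ?addr0 //.
  by move=> m /negbTE ->; rewrite ip0l.
(* Induction on the number of leading coordinates allowed to be nonzero. *)
suff main k : forall x : 'I_n -> H, (forall j : 'I_n, (k <= j)%N -> x j = 0) ->
    0 <= \sum_i \sum_j ip (c i j (x j)) (x i).
  by move=> x; apply: (main n) => j; rewrite leqNgt ltn_ord.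
elim: k => [|k IH] x x0.
  apply: sumr_ge0 => i _; apply: sumr_ge0 => j _.
  by rewrite !x0 // ip0r.
have [kn|nk] := ltnP k n; last first.
  by apply: IH => j kj; have := ltn_ord j; rewrite ltnNge (leq_trans nk kj).
pose k0 := Ordinal kn; pose h := x k0.
pose L : set H := [set v | exists2 a, M a & v = a h].
have L0 : L 0 by exists 0 => //; exact: vn_0.
have LP d u v : L u -> L v -> L (d *: u + v).
  by move=> [a Ma ->] [b Mb ->]; exists (d *: a + b) => //; exact: vn_comb.
have [P [Pb PL Pperp Pid Pcomm]] := projection_ex L0 LP.
have PM a y : M a -> P (a y) = a (P y).
  move=> Ma; apply: (Pcomm a (adj a)); [exact: vn_bounded vM _ Ma|exact: vn_adjP vM _ Ma|..].
    by move=> _ [b Mb ->]; exists (a \o b) => //; exact: vn_comp.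
  by move=> _ [b Mb ->]; exists (adj a \o b) => //; apply: vn_comp => //; exact: vn_adjM.
pose u j := P (x j); pose v j := x j - P (x j).
have xE j : x j = u j + v j by rewrite /u /v addrC subrK.
have perp y z : adh L y -> (forall l, L l -> rip l z = 0) -> ip y z = 0.
  move=> yL hz; rewrite ipE (rip_adh0 hz yL); congr Complex.
  apply: (@rip_adh0 _ _ L) => // l Ll.
  have Li : L ((- 'i%C) *: l) by rewrite -[_ *: l]addr0; exact: LP.
  have := hz _ Li; rewrite scaleNr ripNl ripi opprK; exact.
have vperp i l : L l -> rip l (v i) = 0 by exact: Pperp.
have cross i j : ip (c i j (u j)) (v i) = 0.
  by apply: perp (vperp i); rewrite /u -PM //; exact: PL.
have cross' i j : ip (c i j (v j)) (u i) = 0.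
  have [Mcij Mcij'] : M (c i j) /\ M (adj (c i j)) by split=> //; exact: vn_adjM.
  rewrite (vn_adjP vM Mcij) ipC perp ?rmorph0 //; last exact: vperp.
  by rewrite /u -PM //; exact: PL.
(* The cross terms vanish because [P] commutes with [M]. The part [u] is a limit of vectors of the
   form b_j h, covered by the hypothesis; the part [v] has lost its coordinate [k], since [P] fixes
   [h]. *)
have -> : \sum_i \sum_j ip (c i j (x j)) (x i) =
    \sum_i \sum_j ip (c i j (u j)) (u i) + \sum_i \sum_j ip (c i j (v j)) (v i).
  rewrite -big_split; apply: eq_bigr => i _; rewrite -big_split; apply: eq_bigr => j _.
  have cl := vn_linear vM (Mc i j).
  have E1 : c i j (x j) = c i j (u j) + c i j (v j) by rewrite {1}xE linearDf.
have E2 (p q y z : H) : ip (p + q) (y + z) = ip p y + ip p z + (ip q y + ip q z).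
  by rewrite ipDl !ipDr.
by rewrite E1 {1}(xE i) E2 cross cross' addr0 add0r.
apply: addr_ge0; last first.
  apply: IH => j kj; rewrite /v; have [jk|jk] := eqVneq (j : nat) k.
    have -> : j = k0 by apply/val_inj.
    rewrite Pid ?subrr //; apply: adh_sub; exists idfun => //; exact: vn_id.
  by rewrite x0 ?(linear0f (bounded_lin Pb)) ?subrr // ltn_neqAle eq_sym jk.
rewrite -SE; pose D : set A := [set y | exists2 b : 'I_n -> H -> H, forall j, M (b j) & y = F (fun j => b j h)].
apply: (ip_ge0_adh Sb (D := D)); last first.
  by move=> _ [b Mb ->]; rewrite SE; exact: hc.
move=> d d0; have n1 : 0 < n%:R + 1 :> R by rewrite ltr_wpDl.
have ex j : exists b, M b /\ sq (u j - b h) < d / (n%:R + 1).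
  have [_ [b Mb ->] hb] := PL (x j) _ (divr_gt0 d0 n1); by exists b.
have [b hb] := choice ex; exists (F (fun j => b j h)).
  by exists b => // j; case: (hb j).
have -> : F u - F (fun j => b j h) = F (fun j => u j - b j h).
  rewrite -scaleN1r addrC -Flin; congr F; apply/funext => j.
  by change (-1 *: b j h + u j = u j - b j h); rewrite scaleN1r addrC.
rewrite sqF; apply: (@le_lt_trans _ _ (\sum_(j < n) d / (n%:R + 1))).
  by apply: ler_sum => j _; apply/ltW; case: (hb j).
by rewrite sumr_const card_ord -[_ *+ _]mulr_natr mulrAC ltr_pdivrMr // ltr_pM2l // ltrDl.
Qed.

(** Stability of [S] under one conjugation gives stability of its commutant under the inverse one; a
    second application restores the direction for the bicommutant. *)
Lemma commutant_conj (R : realType) (K : hilbertType R) (U V : K -> K) (S : set (K -> K)) :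
  bounded_op U -> bounded_op V -> cancel U V -> cancel V U ->
  (forall s, S s -> S (U \o (s \o V))) ->
  forall b, commutant S b -> commutant S (V \o (b \o U)).
Proof.
move=> Ub Vb UK VK SU b [bb bS]; split.
  by apply: bounded_comp => //; exact: bounded_comp.
move=> s Ss; apply/funext => x /=.
have := congr1 (fun f => V (f (U x))) (bS _ (SU s Ss)).
by rewrite /= !UK.
Qed.

Lemma vn_generatedE (R : realType) (K : hilbertType R) (S : set (K -> K)) :
  (forall a, S a -> exists2 b, S b & adjoint a b) -> (forall a, S a -> bounded_op a) ->
  vn_generated S = commutant (commutant S).
Proof.
move=> Sadj Sb; rewrite eqEsubset; split=> [X|X SX N [vN SN]].
  by apply; split; [exact: bicommutant_vn|exact: bicommutant_sub].
by case: vN => _ <-; apply: commutant_anti SX; exact: commutant_anti.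
Qed.

Lemma positive_null (R : realType) (K : hilbertType R) (X : K -> K) x :
  bounded_op X -> positive_op X -> rip (X x) x = 0 -> X x = 0.
Proof.
move=> Xb Xp X0; apply: sq_eq0; have [C _ XC] := bounded_rip Xb.
have XC' y : rip (X y) y <= C * sq y by apply: le_trans (XC y); exact: ler_norm.
have := pos_sq x (bounded_lin Xb) Xp XC'; rewrite X0 mulr0 => h.
by apply/eqP; rewrite eq_le h sq_ge0.
Qed.

(** Normality is [lub_approx] at the vector [w]. For faithfulness it suffices that [w] separates
    positive elements, by [positive_null]. *)
Lemma vector_state (R : realType) (K : hilbertType R) (N : set (K -> K)) (w : K) :
  von_neumann N -> sq w = 1 ->
  (forall X, N X -> positive_op X -> X w = 0 -> X = 0) ->
  normal_faithful_state N (fun X => ip (X w) w).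
Proof.
move=> vN w1 hN; split.
- move=> c X Y NX NY; change (ip (c *: X w + Y w) w = c * ip (X w) w + ip (Y w) w).
  by rewrite ipDl ipZl.
- by move=> X NX; exact.
- by rewrite ipxx w1.
- move=> D s DN dir slub; have [[Ns ss] Ds _] := slub.
  have real X : adjoint X X -> ip (X w) w = (rip (X w) w)%:C%C.
    move=> XX; rewrite ipE; congr Complex.
    have : ip (X w) w = Num.conj (ip (X w) w) by rewrite -ipC XX.
    by rewrite {1}ipE [in RHS]ipE => -[] /eqP; rewrite -addr_eq0 -mulr2n mulrn_eq0 => /eqP.
  split=> [|_ [d Dd <-]|z].
  + by rewrite /= real // complex_real.
  + have [Nd dd] := DN d Dd.
    by rewrite !real // lecR; move: (Ds d Dd); rewrite (oleP dd ss) => /(_ w).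
  move=> zr hz; have [d0 Dd0] := proj1 dir; have [Nd0 dd0] := DN d0 Dd0.
  have := hz _ (ex_intro2 _ _ d0 Dd0 erefl); rewrite real //.
  case: z zr hz => z1 z2 _ hz; rewrite lecE /= => /andP[/eqP z20 _].
  rewrite real // lecE /= z20 eqxx /=; apply/ler_addgt0Pl => t t0.
  have [d Dd hd] := lub_approx vN DN dir slub w t0.
  have [Nd dd] := DN d Dd.
  have := hz _ (ex_intro2 _ _ d Dd erefl); rewrite real // lecE /= => /andP[_].
  by move: hd; lra.
- move=> X NX Xp X0; apply: hN => //; apply: positive_null => //; last by rewrite -Re_ip X0.
  exact: (vn_bounded vN).
Qed.

(** * The dilation *)

Section Dilation.
Context {R : realType} {H K : hilbertType R} {M : set (H -> H)} {phi : (H -> H) -> R[i]}.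
Context {Phi Psi : (H -> H) -> (H -> H)} {e : nat -> (H -> H) -> K}.
Hypotheses (vM : von_neumann M) (st : normal_faithful_state M phi).
Hypotheses (uPhi : ucp_map M M Phi) (uPsi : ucp_map M M Psi).
Hypothesis phiPhi : forall a, M a -> phi (Phi a) = phi a.
Hypothesis PhiPsi : forall a, M a -> Phi (Psi a) = a.
Hypothesis eL : forall n c a b, M a -> M b -> e n (c *: a + b) = c *: e n a + e n b.
Hypothesis eS : forall n a, M a -> e n.+1 (Psi a) = e n a.
Hypothesis eip : forall n a b, M a -> M b -> ip (e n a) (e n b) = phi (adj b \o a).
Hypothesis edense : forall x (d : R), 0 < d -> exists n a, M a /\ sq (x - e n a) < d.
Implicit Types (a b : H -> H).

Local Notation Ps n a := (iter n Psi a).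
Local Notation Ph n a := (iter n Phi a).

Let PsM n a : M a -> M (Ps n a). Proof. exact: iterPsM. Qed.
Let MM a b : M a -> M b -> M (a \o b). Proof. exact: (vn_comp vM). Qed.
Let Madj a : M a -> M (adj a). Proof. exact: (vn_adjM vM). Qed.
Let Psmul n a b : M a -> M b -> Ps n (a \o b) = Ps n a \o Ps n b.
Proof. exact: (iterPs_mul vM st uPhi uPsi phiPhi PhiPsi). Qed.

(** * The representations of [M] at the successive levels *)

Lemma eSn n k a : M a -> e (n + k)%N (Ps k a) = e n a.
Proof.
move=> Ma; elim: k => [|k IH]; first by rewrite addn0.
by rewrite addnS /= eS ?IH //; exact: PsM.
Qed.

Lemma sq_eS n k a : M a -> sq (e n (Ps k a)) = sq (e n a).
Proof.
move=> Ma; rewrite !(sq_e (eip n)) //; last exact: PsM.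
rewrite (iterPs_adj vM uPsi) // -Psmul //; last exact: Madj.
by rewrite /rphi (iterPs_phi uPsi phiPhi PhiPsi) //; apply: MM => //; exact: Madj.
Qed.

Lemma sq_en n m a : M a -> sq (e n a) = sq (e m a).
Proof. by move=> Ma; rewrite !(sq_e (eip _)). Qed.

Lemma comp_lin_r a b b' c : M a -> a \o (c *: b + b') = c *: (a \o b) + (a \o b').
Proof. by move=> Ma; apply/funext => h; exact: (vn_linear vM Ma). Qed.

(** Each [e n a] reappears at all higher levels, so the levels from [N] on are still dense. At
    levels n + k the operator [pi n a] is plain left multiplication by [iter k Psi a]
    ([pi_high]). *)
Definition levels N : set K := [set x | exists n a, [/\ (N <= n)%N, M a & x = e n a]].

Lemma levels_dense N x : adh (levels N) x.
Proof.
move=> d d0; have [n [a [Ma h]]] := edense x d0.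
exists (e n a) => //; exists (n + N)%N, (Ps N a).
by split; [exact: leq_addl|exact: PsM|rewrite eSn].
Qed.

Lemma level_op (F : nat -> (H -> H) -> K) (C : R) : 0 <= C ->
  (forall n c a b, M a -> M b -> F n (c *: a + b) = c *: F n a + F n b) ->
  (forall n a, M a -> F n.+1 (Psi a) = F n a) ->
  (forall n a, M a -> sq (F n a) <= C * sq (e n a)) ->
  exists T : K -> K, bounded_op T /\ forall n a, M a -> T (e n a) = F n a.
Proof.
move=> C0 FL FS FC.
have FSn n k a : M a -> F (n + k)%N (Ps k a) = F n a.
  move=> Ma; elim: k => [|k IH]; first by rewrite addn0.
  by rewrite addnS /= FS ?IH //; exact: PsM.
have [|c [n a] [m b] /= Ma Mb|[n a] /= Ma|x d d0|T [Tb hT]] :=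
  @extension _ K (nat * (H -> H)) [set p | M p.2] (fun p => e p.1 p.2) (fun p => F p.1 p.2) C.
- exact: C0.
- exists ((n + m)%N, c *: Ps m a + Ps n b) => /=; split.
  + by apply: vn_comb => //; exact: PsM.
  + by rewrite eL ?eSn 1?addnC ?eSn //; exact: PsM.
  + by rewrite FL ?FSn 1?addnC ?FSn //; exact: PsM.
- exact: FC.
- by have [n [a [Ma h]]] := edense x d0; exists (n, a).
by exists T; split=> // n a Ma; exact: (hT (n, a)).
Qed.

(** The level of the vector may lie below or above that of the operator. Both are raised to n + m,
    which turns [b] into [iter n Psi b] and [a] into [iter m Psi a]. *)
Lemma pi_ex n a : exists T : K -> K, M a -> bounded_op T /\
  forall m b, M b -> T (e m b) = e (n + m)%N (Ps m a \o Ps n b).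
Proof.
have [Ma|nMa] := pselect (M a); last by exists id.
have /bounded_opP [_ [C C0 aC]] := vn_bounded vM Ma.
have [m c b b' Mb Mb'|m b Mb|m b Mb|T hT] :=
  @level_op (fun m b => e (n + m)%N (Ps m a \o Ps n b)) C C0.
- rewrite (iterPs_comb uPsi) // comp_lin_r ?eL //; try exact: PsM.
  + by apply: MM; exact: PsM.
  + by apply: MM; exact: PsM.
- rewrite addnS -[Ps n (Psi b)]iterSr /= -(Psi_mul vM st uPhi uPsi phiPhi PhiPsi) ?eS //; try exact: PsM.
  by apply: MM; exact: PsM.
- have := sq_e_comp vM st (eip (n + m)%N) (PsM m Ma) (PsM n Mb)
     (iterPs_bdd vM uPsi m Ma aC).
  by rewrite (sq_eS (n + m)%N n Mb) (sq_en (n + m)%N m Mb).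
by exists T.
Qed.

Definition pi n a : K -> K := projT1 (cid (pi_ex n a)).

Lemma pi_bounded n a : M a -> bounded_op (pi n a).
Proof. by move=> Ma; case: (projT2 (cid (pi_ex n a)) Ma). Qed.

Lemma piE n m a b : M a -> M b -> pi n a (e m b) = e (n + m)%N (Ps m a \o Ps n b).
Proof. by move=> Ma; case: (projT2 (cid (pi_ex n a)) Ma) => _; exact. Qed.

Lemma pi_high n k a b : M a -> M b -> pi n a (e (n + k)%N b) = e (n + k)%N (Ps k a \o b).
Proof.
move=> Ma Mb; rewrite piE // addnC -(eSn (n + k)%N n); last by apply: MM => //; exact: PsM.
by rewrite Psmul //; [rewrite -iterD|exact: PsM].
Qed.

(** Identities between operators are checked on the high levels only, where [pi n a] is a left
    multiplication. *)
Lemma pi_eq (T : K -> K) n a : M a -> bounded_op T ->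
  (forall k b, M b -> T (e (n + k)%N b) = e (n + k)%N (Ps k a \o b)) -> pi n a = T.
Proof.
move=> Ma Tb h; apply: (dense_eq (levels_dense n)) => //; first exact: pi_bounded.
by move=> _ [m [b [nm Mb ->]]]; rewrite -(subnKC nm) pi_high // h.
Qed.

Lemma pi_comb n c a b : M a -> M b -> pi n (c *: a + b) = c *: pi n a + pi n b.
Proof.
move=> Ma Mb; apply: pi_eq; first exact: vn_comb.
  by apply: bounded_comb; exact: pi_bounded.
move=> k d Md.
change (c *: pi n a (e (n + k)%N d) + pi n b (e (n + k)%N d) =
  e (n + k)%N (Ps k (c *: a + b) \o d)).
rewrite !pi_high // (iterPs_comb uPsi) // -eL //; try by apply: MM => //; exact: PsM.
Qed.

Lemma pi_mul n a b : M a -> M b -> pi n (a \o b) = pi n a \o pi n b.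
Proof.
move=> Ma Mb; apply: pi_eq; first exact: MM.
  by apply: bounded_comp; exact: pi_bounded.
move=> k d Md /=.
by rewrite (pi_high n k Mb Md) (pi_high n k Ma (MM (PsM k Mb) Md)) (Psmul k Ma Mb).
Qed.

Lemma pi_id n : pi n idfun = idfun.
Proof.
apply: pi_eq; [exact: vn_id|exact: bounded_id|].
by move=> k b Mb; rewrite (iterPs_id uPsi).
Qed.

Lemma pi_S n a : M a -> pi n.+1 (Psi a) = pi n a.
Proof.
move=> Ma; have MPa : M (Psi a) by exact: (PsM 1).
apply: pi_eq => //; first exact: pi_bounded.
by move=> k b Mb; rewrite addSnnS pi_high // -iterSr.
Qed.

Lemma pi_adj n a : M a -> adjoint (pi n a) (pi n (adj a)).
Proof.
move=> Ma; have Ma' := Madj Ma.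
apply: (dense_adjoint (levels_dense n)); [exact: pi_bounded|exact: pi_bounded|].
move=> _ _ [m [b [nm Mb ->]]] [l [c [nl Mc ->]]].
rewrite -(subnKC nm) -(subnKC nl); move: (m - n)%N (l - n)%N => {nm nl}m {}l.
rewrite -(eSn (n + m)%N l Mb) -(eSn (n + l)%N m Mc) -!addnA (addnC l m).
have [Mlb Mmc] := (PsM l Mb, PsM m Mc).
have [Mka Mka'] := (PsM (m + l) Ma, PsM (m + l) Ma').
rewrite !pi_high // /rip /rform !eip //; try exact: MM.
by rewrite (adj_comp vM) // -(iterPs_adj vM uPsi) // (adj_adj vM).
Qed.

Lemma adj_pi n a : M a -> adj (pi n a) = pi n (adj a).
Proof. by move=> Ma; apply/adjE/pi_adj. Qed.

Definition vac : K := e 0 idfun.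

Lemma e_id n : e n idfun = vac.
Proof. by rewrite -(iterPs_id uPsi n) -{1}[n]add0n eSn //; exact: vn_id. Qed.

Lemma pi_vac n a : M a -> pi n a vac = e n a.
Proof.
move=> Ma; rewrite -(e_id n) -{2 3}[n]addn0 pi_high //; exact: vn_id.
Qed.

(** The inverse shift should lower the level, which is impossible at level 0; [e n (Psi a)] is the
    lowered vector for n > 0 and makes sense for every n. *)
Lemma shift_ex : exists UV : (K -> K) * (K -> K),
  [/\ bounded_op UV.1, bounded_op UV.2,
      forall n a, M a -> UV.1 (e n a) = e n.+1 a
    & forall n a, M a -> UV.2 (e n a) = e n (Psi a)].
Proof.
have PM a : M a -> M (Psi a) by exact: (PsM 1).
have [n c a b Ma Mb|n a Ma|n a Ma|U [Ub hU]] :=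
  @level_op (fun n a => e n.+1 a) 1 ler01.
- exact: eL.
- by rewrite eS //.
- by rewrite mul1r (sq_en n.+1 n Ma).
have [n c a b Ma Mb|n a Ma|n a Ma|V [Vb hV]] :=
  @level_op (fun n a => e n (Psi a)) 1 ler01.
- by rewrite (ucp_linear uPsi) // eL //; exact: PM.
- by rewrite eS //; exact: PM.
- by rewrite mul1r (sq_eS n 1 Ma).
by exists (U, V).
Qed.

Definition shiftU : K -> K := (projT1 (cid shift_ex)).1.
Definition shiftV : K -> K := (projT1 (cid shift_ex)).2.

Lemma shiftU_bounded : bounded_op shiftU.
Proof. by case: (projT2 (cid shift_ex)). Qed.

Lemma shiftV_bounded : bounded_op shiftV.
Proof. by case: (projT2 (cid shift_ex)). Qed.

Lemma shiftUE n a : M a -> shiftU (e n a) = e n.+1 a.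
Proof. by move=> Ma; case: (projT2 (cid shift_ex)) => _ _ h _; exact: h. Qed.

Lemma shiftVE n a : M a -> shiftV (e n a) = e n (Psi a).
Proof. by move=> Ma; case: (projT2 (cid shift_ex)) => _ _ _ h; exact: h. Qed.

Lemma shiftUV : shiftU \o shiftV = idfun.
Proof.
apply: (dense_eq (levels_dense 0)); [|exact: bounded_id|].
  by apply: bounded_comp; [exact: shiftU_bounded|exact: shiftV_bounded].
move=> _ [n [a [_ Ma ->]]] /=; rewrite shiftVE // shiftUE ?eS //.
exact: (PsM 1).
Qed.

Lemma shiftVU : shiftV \o shiftU = idfun.
Proof.
apply: (dense_eq (levels_dense 0)); [|exact: bounded_id|].
  by apply: bounded_comp; [exact: shiftV_bounded|exact: shiftU_bounded].
by move=> _ [n [a [_ Ma ->]]] /=; rewrite shiftUE // shiftVE ?eS.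
Qed.

Lemma shift_adj : adjoint shiftU shiftV.
Proof.
apply: (dense_adjoint (levels_dense 0)); [exact: shiftU_bounded|exact: shiftV_bounded|].
move=> _ _ [n [a [_ Ma ->]]] [m [b [_ Mb ->]]].
rewrite -(eSn n m Ma) -(eSn m n Mb) (addnC m n) shiftUE ?shiftVE; try exact: PsM.
have [Ma' Mb'] := (PsM m Ma, PsM n Mb).
have Mb'' : M (Psi (Ps n b)) by exact: (PsM 1).
by rewrite -[e _ (Ps n b)]eS // /rip /rform !eip.
Qed.

Lemma shift_vac : shiftU vac = vac /\ shiftV vac = vac.
Proof.
have M1 := vn_id vM; rewrite /vac shiftUE // shiftVE // (ucp_unital uPsi).
by rewrite e_id.
Qed.

Lemma shift_pi n a : M a -> shiftU \o (pi n a \o shiftV) = pi n.+1 a.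
Proof.
move=> Ma; apply/esym/pi_eq => //.
  apply: bounded_comp; first exact: shiftU_bounded.
  by apply: bounded_comp; [exact: pi_bounded|exact: shiftV_bounded].
move=> k b Mb; have MPb : M (Psi b) by exact: (PsM 1).
rewrite /= shiftVE // addSn eS // pi_high // shiftUE //.
by apply: MM => //; exact: PsM.
Qed.

Lemma pi_Sn n k a : M a -> pi (n + k)%N (Ps k a) = pi n a.
Proof.
move=> Ma; elim: k => [|k IH]; first by rewrite addn0.
by rewrite addnS /= pi_S ?IH //; exact: PsM.
Qed.

(** * The algebra generated by all levels *)

Definition tower : set (K -> K) := [set T | exists n a, M a /\ T = pi n a].

Lemma tower_pi n a : M a -> tower (pi n a).
Proof. by exists n, a. Qed.

(** The images of [M] increase with the level, since [pi n a] is also [pi (n + k) (iter k Psi a)];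
    their union is therefore closed under sums and products. *)
Lemma tower_common s t : tower s -> tower t ->
  exists n a b, [/\ M a, M b, s = pi n a & t = pi n b].
Proof.
move=> [n [a [Ma ->]]] [m [b [Mb ->]]]; exists (n + m)%N, (Ps m a), (Ps n b).
by split; [exact: PsM|exact: PsM|rewrite pi_Sn|rewrite addnC pi_Sn].
Qed.

Lemma tower_star : star_algebra tower.
Proof.
split.
- by move=> _ [n [a [Ma ->]]]; exact: pi_bounded.
- by move=> _ [n [a [Ma ->]]]; rewrite adj_pi //; apply/tower_pi/Madj.
- by rewrite -(pi_id 0); apply: tower_pi; exact: vn_id.
- move=> c s t Ss St; have [n [a [b [Ma Mb -> ->]]]] := tower_common Ss St.
  by rewrite -pi_comb //; apply: tower_pi; exact: vn_comb.
- move=> s t Ss St; have [n [a [b [Ma Mb -> ->]]]] := tower_common Ss St.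
  by rewrite -pi_mul //; apply: tower_pi; exact: MM.
Qed.

Definition dilated : set (K -> K) := commutant (commutant tower).

Lemma dilated_vn : von_neumann dilated.
Proof.
apply: bicommutant_vn => s Ss; last exact: (salg_bounded tower_star).
by exists (adj s); [exact: (salg_adj tower_star)|exact: salg_adjP tower_star _ Ss].
Qed.

Lemma pi_dilated n a : M a -> dilated (pi n a).
Proof.
move=> Ma; apply: bicommutant_sub; last exact: tower_pi.
by move=> s Ss; exact: (salg_bounded tower_star).
Qed.

Lemma e_inj a : M a -> sq (e 0 a) = 0 -> a = 0.
Proof.
move=> Ma; rewrite (sq_e (eip 0)) // => a0.
have := rphi_faithful st (MM (Madj Ma) Ma) (adj_comp_pos vM Ma) a0 => aa.
apply/funext => h; apply: sq_eq0; rewrite -ripxx -(rip_adjl vM) //.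
by have := congr1 (fun f => f h) aa; rewrite /= => ->; rewrite rip0l.
Qed.

(* [c] is the compression of [X] to the closure of [e 0 M], read in [M] *)
Definition expectable (X : K -> K) c := M c /\
  forall b x, M b -> M x -> ip (e 0 (c \o b)) (e 0 x) = ip (X (e 0 b)) (e 0 x).

(** Raised to level n, the matrix coefficient is [phi] of Psi^n(adj x) c Psi^n(b). Applying Phi^n,
    which preserves [phi] and is a bimodule map over Psi^n, gives [phi] of adj x Phi^n(c) b. *)
Lemma expectable_pi n c : M c -> expectable (pi n c) (Ph n c).
Proof.
move=> Mc; have MPc : M (Ph n c) by exact: iterPhM.
split=> // b x Mb Mx; have [Mx' MPb MPx] : [/\ M (adj x), M (Ps n b) & M (Ps n x)].
  by split; [exact: Madj|exact: PsM|exact: PsM].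
rewrite eip //; last exact: MM.
have -> : pi n c (e 0 b) = e n (c \o Ps n b) by rewrite piE // addn0.
have -> : e 0 x = e n (Ps n x) by rewrite -{1}[n]add0n eSn.
rewrite eip //; last exact: MM.
rewrite (iterPs_adj vM uPsi) //.
rewrite -[RHS](iterPh_phi uPhi phiPhi n); last by apply: MM; [exact: PsM|exact: MM].
rewrite (iterPh_modl vM st uPhi uPsi phiPhi PhiPsi) //; last exact: MM.
by rewrite (iterPh_modr vM st uPhi uPsi phiPhi PhiPsi).
Qed.

Lemma expectable_comb k X Y c d : expectable X c -> expectable Y d ->
  expectable (k *: X + Y) (k *: c + d).
Proof.
move=> [Mc hc] [Md hd]; split; first exact: vn_comb.
move=> b x Mb Mx.
change (ip (e 0 (k *: (c \o b) + (d \o b))) (e 0 x) = ip (k *: X (e 0 b) + Y (e 0 b)) (e 0 x)).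
by rewrite eL ?ipDl ?ipZl ?hc ?hd //; exact: MM.
Qed.

Lemma e_0 : e 0 0 = 0.
Proof. by have M0 := vn_0 vM; have := eB (eL 0) M0 M0; rewrite !subrr. Qed.

Lemma expectable0 : expectable 0 0.
Proof.
split; first exact: vn_0.
by move=> b x Mb Mx; change (ip (e 0 0) (e 0 x) = ip 0 (e 0 x)); rewrite e_0.
Qed.

Lemma expectable_sq X c b : expectable X c -> M b -> sq (e 0 (c \o b)) <= sq (X (e 0 b)).
Proof.
move=> [Mc hc] Mb; have Mcb := MM Mc Mb.
have E : sq (e 0 (c \o b)) = rip (X (e 0 b)) (e 0 (c \o b)).
  by rewrite /sq /qform /rform hc.
have [->|n0] := eqVneq (sq (e 0 (c \o b))) 0; first exact: sq_ge0.
have p0 : 0 < sq (e 0 (c \o b)) by rewrite lt_def n0 sq_ge0.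
by rewrite -(ler_pM2r p0) -expr2 {1}E; exact: rip_CS.
Qed.

Lemma expectable_uniq X c d : expectable X c -> expectable X d -> c = d.
Proof.
move=> hc hd; have := expectable_comb (-1) hd hc; rewrite !scaleN1r addNr addrC => h.
have M1 := vn_id vM; have := expectable_sq h M1.
rewrite sq0 => h0; apply/eqP; rewrite -subr_eq0; apply/eqP/e_inj; first by case: h.
by apply/eqP; rewrite eq_le h0 sq_ge0.
Qed.

(** [expectable_sq] bounds [c] only in the norm of [phi]; [l2_order] at y = C^-1 adj c c turns this
    into a bound on [H]. *)
Lemma expectable_bdd X c (C : R) : 0 < C -> expectable X c -> bdd X C -> bdd c C.
Proof.
move=> C0 hc XC h; have [Mc _] := hc.
have Mcc : M (adj c \o c) by apply: MM => //; exact: Madj.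
pose y := (C^-1)%:C%C *: (adj c \o c).
have My : M y by exact: vn_scale.
have Ci : 0 <= C^-1 by rewrite invr_ge0 ltW.
have yp : positive_op y by apply: scaled_pos => //; exact: (adj_comp_pos vM Mc).
have := l2_order vM st (eip 0) My yp _ h.
change (((forall b, M b -> rphi phi (adj b \o (y \o b)) <= rphi phi (adj b \o b)) ->
  rip ((C^-1)%:C%C *: adj c (c h)) h <= sq h) -> sq (c h) <= C * sq h).
rewrite ripZl (rip_adjl vM) // ripxx => H1.
rewrite -ler_pdivrMl //; apply: H1 => b Mb; have Mcb := MM Mc Mb.
have bl := vn_linear vM (Madj Mb).
have -> : adj b \o (y \o b) = (C^-1)%:C%C *: (adj (c \o b) \o (c \o b)).
  rewrite (adj_comp vM) //; apply/funext => k; exact: (linearZf _ _ bl).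
rewrite (rphiZ vM st); last by apply: MM => //; exact: Madj.
rewrite -!(sq_e (eip 0)) // ler_pdivrMl //.
exact: le_trans (expectable_sq hc Mb) (XC _).
Qed.

(** A sequence of approximants is chosen to be good at two vectors at once: [vac] determines the
    limit [c], while [e 0 b] shows that [c] is the compression of [X] at [b]. The sequence depends
    on [b]. *)
Lemma expectable_limit_at X (C : R) b : 0 <= C -> M b ->
  (forall d, 0 < d -> exists Y c, [/\ expectable Y c, bdd c C, sq (Y vac - X vac) < d
     & sq (Y (e 0 b) - X (e 0 b)) < d]) ->
  exists c, [/\ M c, forall x, M x -> ip (e 0 c) (e 0 x) = ip (X vac) (e 0 x)
    & forall x, M x -> ip (e 0 (c \o b)) (e 0 x) = ip (X (e 0 b)) (e 0 x)].
Proof.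
move=> C0 Mb happ; have M1 := vn_id vM.
(* With these tolerances consecutive approximants differ by at most 2 (1/8 + 1)/4 < 1 times 8^-k in
   squared norm, the rate demanded by [l2_complete]. *)
have t0 (k : nat) : 0 < 4^-1 / 8 ^+ k :> R by rewrite divr_gt0 ?invr_gt0 // exprn_gt0.
have ex (k : nat) : exists Yc : (K -> K) * (H -> H), [/\ expectable Yc.1 Yc.2, bdd Yc.2 C,
    sq (Yc.1 vac - X vac) < 4^-1 / 8 ^+ k & sq (Yc.1 (e 0 b) - X (e 0 b)) < 4^-1 / 8 ^+ k].
  by have [Y [c h]] := happ _ (t0 k); exists (Y, c).
have [f hf] := choice ex; pose Y k := (f k).1; pose c k := (f k).2.
have Yc k : expectable (Y k) (c k) by case: (hf k).
have cM k : M (c k) by case: (Yc k).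
have cC k : bdd (c k) C by case: (hf k).
have fast (g : H -> H) : M g -> (forall k, sq (Y k (e 0 g) - X (e 0 g)) < 4^-1 / 8 ^+ k) ->
    forall k, sq (e 0 (c k.+1 \o g) - e 0 (c k \o g)) <= 1 / 8 ^+ k.
  move=> Mg hg k.
  have := expectable_sq (expectable_comb (-1) (Yc k) (Yc k.+1)) Mg.
  change (sq (e 0 (-1 *: (c k \o g) + (c k.+1 \o g))) <= sq (-1 *: Y k (e 0 g) + Y k.+1 (e 0 g)) ->
    sq (e 0 (c k.+1 \o g) - e 0 (c k \o g)) <= 1 / 8 ^+ k).
  rewrite eL ?scaleN1r; [|exact: MM|exact: MM].
  rewrite ![- _ + _]addrC => /le_trans; apply.
  have := sqD_le (Y k.+1 (e 0 g) - X (e 0 g)) (X (e 0 g) - Y k (e 0 g)).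
  rewrite subrKA (sqC (X (e 0 g))); have := hg k; have := hg k.+1.
  rewrite exprS invfM; have : 0 < (8 ^+ k)^-1 :> R by rewrite invr_gt0 exprn_gt0.
  by move: ((8 ^+ k)^-1) => i; lra.
have hvac k : sq (Y k (e 0 idfun) - X (e 0 idfun)) < 4^-1 / 8 ^+ k by case: (hf k).
have hb k : sq (Y k (e 0 b) - X (e 0 b)) < 4^-1 / 8 ^+ k by case: (hf k).
have [c0 [Mc0 c0C c0e c0s]] := l2_complete vM st (eL 0) (eip 0) C0 cM cC (fast _ M1 hvac).
have /bounded_opP [_ [B B0 bB]] := vn_bounded vM Mb.
have cbB k : bdd (c k \o b) (C * B).
  by move=> h; apply: le_trans (cC k _) _; rewrite -mulrA ler_wpM2l.
have [c1 [Mc1 _ c1e c1s]] := l2_complete vM st (eL 0) (eip 0) (mulr_ge0 C0 B0)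
  (fun k => MM (cM k) Mb) cbB (fast _ Mb hb).
(* Right multiplication by [b] is not controlled by the norm of [phi]; the two limits are compared
   as strong limits on [H]. *)
have c1E : c1 = c0 \o b.
  apply/funext => h; apply/eqP; rewrite -subr_eq0; apply/eqP/sq_le_small => d d0; apply/ltW.
  have d4 : 0 < d / 4 by rewrite divr_gt0.
  have [N1 h1] := c1s h _ d4; have [N2 h2] := c0s (b h) _ d4; pose n := maxn N1 N2.
  apply: (@sq_tri _ _ _ (c n (b h))); first by rewrite sqC; exact: h1 (leq_maxl _ _).
  exact: h2 (leq_maxr _ _).
have lim (g cg : H -> H) : M g -> M cg ->
    (forall k, sq (Y k (e 0 g) - X (e 0 g)) < 4^-1 / 8 ^+ k) ->
    (forall d, 0 < d -> exists N, forall n, (N <= n)%N -> sq (e 0 (c n \o g) - e 0 cg) < d) ->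
    forall x, M x -> ip (e 0 cg) (e 0 x) = ip (X (e 0 g)) (e 0 x).
  move=> Mg Mcg hg hcg.
  suff re z : (forall k, ip (e 0 (c k \o g)) z = ip (Y k (e 0 g)) z) ->
      rip (e 0 cg) z = rip (X (e 0 g)) z.
    move=> x Mx; rewrite (ipE (e 0 cg)) (ipE (X _)); congr Complex; apply: re => k.
      by case: (Yc k) => _ h; exact: h.
    by rewrite !ipZr; congr (_ * _); case: (Yc k) => _ h; exact: h.
  move=> hz; apply/eqP; rewrite -subr_eq0 -sqrf_eq0 eq_le sqr_ge0 andbT.
  apply/ler_addgt0Pl => d d0; rewrite addr0.
  have z1 : 0 < 4 * (sq z + 1) by rewrite mulr_gt0 // ltr_wpDl ?sq_ge0.
  have d'0 := divr_gt0 d0 z1.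
  have [N1 h1] := hcg _ d'0; have [N2 h2] := invn_small d'0; pose n := maxn N1 N2.
  have hn : sq (Y n (e 0 g) - X (e 0 g)) < d / (4 * (sq z + 1)).
    apply: lt_trans (hg n) _; apply: le_lt_trans (h2 n (leq_maxr _ _)).
    have n8 : n.+1%:R <= 8 ^+ n :> R by rewrite -natrX ler_nat ltn_expl.
    have i8 : (8 ^+ n)^-1 <= n.+1%:R^-1 :> R by rewrite lef_pV2 ?posrE ?ltr0n ?exprn_gt0.
    have : 0 <= (8 ^+ n)^-1 :> R by rewrite invr_ge0 exprn_ge0.
    by move: i8; move: ((8 ^+ n)^-1) (n.+1%:R^-1) => i j; lra.
  have := h1 n (leq_maxl _ _); move: hn; rewrite !ltr_pdivlMr //.
  have E : rip (e 0 cg) z - rip (X (e 0 g)) z =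
      rip (Y n (e 0 g) - X (e 0 g)) z - rip (e 0 (c n \o g) - e 0 cg) z.
    rewrite !ripBl /rip /rform hz; ring.
  rewrite E.
  have := rip_CS (Y n (e 0 g) - X (e 0 g)) z; have := rip_CS (e 0 (c n \o g) - e 0 cg) z.
  move: (sq_ge0 (Y n (e 0 g) - X (e 0 g))) (sq_ge0 (e 0 (c n \o g) - e 0 cg)).
  move: (sq (Y n (e 0 g) - X (e 0 g))) (sq (e 0 (c n \o g) - e 0 cg)) => p q p0 q0.
  set u := rip _ z; set v := rip _ z => h3 h4 h5 h6.
  by have := sqr_ge0 (u + v); move: h3 h4; rewrite !expr2; lra.
exists c0; split=> //; first exact: (lim idfun).
by rewrite -c1E; exact: (lim b).
Qed.

(** The [c] obtained for different [b] coincide, because [e 0] is injective and [e 0 c] is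
    determined by [X vac]. *)
Lemma expectable_limit X (C : R) : 0 <= C ->
  (forall b d, M b -> 0 < d -> exists Y c, [/\ expectable Y c, bdd c C, sq (Y vac - X vac) < d
     & sq (Y (e 0 b) - X (e 0 b)) < d]) ->
  exists c, expectable X c.
Proof.
move=> C0 happ; have M1 := vn_id vM.
have at_ b : M b -> exists c, [/\ M c, forall x, M x -> ip (e 0 c) (e 0 x) = ip (X vac) (e 0 x)
    & forall x, M x -> ip (e 0 (c \o b)) (e 0 x) = ip (X (e 0 b)) (e 0 x)].
  by move=> Mb; apply: (expectable_limit_at C0 Mb) => d; exact: happ.
have [c [Mc hc _]] := at_ _ M1; exists c; split=> // b x Mb Mx.
have [d [Md hd hdb]] := at_ b Mb; rewrite -hdb //; suff -> : c = d by [].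
apply/eqP; rewrite -subr_eq0; apply/eqP/e_inj; first exact: vn_sub.
have Mcd : M (c - d) by exact: vn_sub.
rewrite /sq /qform /rform {1}(eB (eL 0)) // ipDl ipNl hc // hd // subrr.
by [].
Qed.

(* This replaces Kaplansky's density theorem: [a (1 + a^2)^-1] is bounded by [1]
   whatever the size of the approximants [a] of [X]. *)
Lemma bounded_transform_dense X r (I : finType) (xi : I -> K) (d : R) :
  dilated X -> adjoint X X -> (forall h, r h + X (X (r h)) = h) -> 0 < d ->
  exists n c, [/\ M c, bdd c 1 & forall i, sq (pi n c (xi i) - X (r (xi i))) < d].
Proof.
move=> NX XX r1 d0.
have d4 : 0 < d / 4 by rewrite divr_gt0.
(* The vectors at which [bt_diff] compares [X] with its approximant. *)
pose zeta (p : I + I) := match p with inl i => r (xi i) | inr i => X (r (xi i)) end.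
have [_ [[n [a0 [Ma0 ->]]] s0s0 hs]] := sa_density tower_star zeta NX XX d4.
(* [sa_density] makes [pi n a0] self-adjoint, not [a0]; the real part [a] is self-adjoint in [M] and
   has the same image. *)
pose a := (2^-1 : R)%:C%C *: (1 *: a0 + adj a0).
have Ma0' := Madj Ma0.
have Ma : M a by apply: vn_scale => //; exact: vn_comb.
have aa : adjoint a a.
  move=> u v; change (ip ((2^-1 : R)%:C%C *: (1 *: a0 u + adj a0 u)) v =
    ip u ((2^-1 : R)%:C%C *: (1 *: a0 v + adj a0 v))).
  have h := vn_adjP vM Ma0.
  by rewrite !scale1r ipZl ipZr conjR ipDl ipDr h (adjointC h) addrC.
have pa : pi n a = pi n a0.
  have Msum : M (1 *: a0 + adj a0) by exact: vn_comb.
  have M0 := vn_0 vM.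
  have -> : a = (2^-1 : R)%:C%C *: (1 *: a0 + adj a0) + 0 by rewrite addr0.
  rewrite pi_comb // pi_comb // -adj_pi // (adjE s0s0).
  have -> : pi n 0 = 0.
    have := pi_comb n (-1) M0 M0; rewrite scaleN1r addNr => ->.
    by rewrite scaleN1r addNr.
  rewrite addr0 scale1r -[X in X + X]scale1r -scalerDl scalerA.
  have -> : (2^-1 : R)%:C%C * (1 + 1) = 1 :> R[i].
    by rewrite -(rmorph1 (real_complex R)) -rmorphD -rmorphM /=; congr (_%:C%C); field.
  by rewrite scale1r.
have Maa : M (a \o a) by exact: MM.
have aap : positive_op (a \o a).
  by apply: rip_pos => [|h /=]; [exact: adjoint_comp|rewrite (rip_adj _ _ aa) ripxx sq_ge0].
have [ra [Mra rap ra1 ra2]] := resolvent_ex vM Maa aap.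
have al := vn_linear vM Ma; have Mc := MM Ma Mra.
exists n, (a \o ra); split=> //.
  by move=> h; rewrite mul1r; have [_] := bt_contr al aa (ra1 h).
have Mrr := MM Maa Mra; have M1 := vn_id vM.
have rs1 h : pi n ra h + pi n a (pi n a (pi n ra h)) = h.
  have E : ra + ((a \o a) \o ra) = idfun by apply/funext => k; exact: ra1.
  have := pi_comb n 1 Mra Mrr; rewrite !scale1r E pi_id (pi_mul n Maa Mra) (pi_mul n Ma Ma) => /(congr1 (fun f => f h)) H1.
  exact: (esym H1).
have rs2 h : pi n ra (h + pi n a (pi n a h)) = h.
  have E : ra \o (1 *: idfun + (a \o a)) = idfun.
    apply/funext => k; change (ra (1 *: k + a (a k)) = k).
    by rewrite scale1r; exact: ra2.
  have Mx : M (1 *: idfun + (a \o a)) by exact: vn_comb.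
  have := pi_mul n Mra Mx; rewrite E pi_id (pi_comb n 1 M1 Maa) pi_id (pi_mul n Ma Ma) => /(congr1 (fun f => f h)) H1.
  move: H1; change (h = pi n ra (1 *: h + pi n a (pi n a h)) ->
    pi n ra (h + pi n a (pi n a h)) = h).
  by rewrite scale1r => <-.
have pia : adjoint (pi n a) (pi n a) by have := pi_adj n Ma; rewrite (adjE aa).
have Xl : linear X by apply: bounded_lin; case: NX.
move=> i; rewrite (pi_mul n Ma Mra).
apply: le_lt_trans (bt_diff (xi i) (bounded_lin (pi_bounded n Ma)) pia Xl
  (bounded_lin (pi_bounded n Mra)) rs1 rs2 r1) _.
rewrite pa; have h1 := hs (inl i); have h2 := hs (inr i).
by rewrite /= sqC in h1; rewrite /= sqC in h2; lra.
Qed.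

Lemma expectable_bt X r : dilated X -> adjoint X X ->
  (forall h, r h + X (X (r h)) = h) -> exists c, expectable (X \o r) c.
Proof.
move=> NX XX r1; apply: (expectable_limit ler01) => b d Mb d0.
pose xi (i : bool) := if i then vac else e 0 b.
have [n [c [Mc c1 hc]]] := bounded_transform_dense xi NX XX r1 d0.
exists (pi n c), (Ph n c); split.
- exact: expectable_pi.
- exact: (iterPh_bdd vM uPhi).
- exact: (hc true).
- exact: (hc false).
Qed.

(** [X] is approximated by X (1 + t^2 X^2)^-1 for small t, which is 1/t times the bounded transform
    of t X. The factor 1/t is harmless: these operators inherit the bound of [X], and
    [expectable_bdd] passes it to their expectations. *)
Lemma expectable_sa X : dilated X -> adjoint X X -> exists c, expectable X c.
Proof.
move=> NX XX; have vN := dilated_vn.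
have Xb : bounded_op X by case: NX.
have /bounded_opP [Xl [C0 C00 XC0]] := Xb.
pose C := C0 + 1; have Cp : 0 < C by rewrite ltr_wpDl.
have C1 : 1 <= C by rewrite lerDr.
have Cge : 0 <= C by exact: ltW.
have XC : bdd X C.
  by move=> h; apply: le_trans (XC0 h) _; rewrite ler_wpM2r ?sq_ge0 // lerDl.
have CC0 : 0 <= C * C by rewrite mulr_ge0 // ltW.
apply: (expectable_limit (ltW Cp)) => b d Mb d0.
(* Since h - r h = t^2 X^2 r h, the squared error at h is at most t^4 C^3 |h|^2, hence at most t C^3
   |h|^2 for t <= 1; [k] covers both vectors, with strict inequality. *)
pose k := C * C * C * (sq vac + sq (e 0 b) + 1).
have k0 : 0 < k by rewrite !mulr_gt0 // ltr_wpDl // addr_ge0 ?sq_ge0.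
pose t := Num.min 1 (d / k).
have t0 : 0 < t by rewrite lt_min ltr01 divr_gt0.
have t1 : t <= 1 by rewrite ge_min lexx.
have tk : t * k <= d by rewrite -ler_pdivlMr // ge_min lexx orbT.
pose tX := t%:C%C *: X.
have NtX : dilated tX by exact: vn_scale.
have tXE h : tX h = t%:C%C *: X h by [].
have tXX : adjoint tX tX by move=> u v; rewrite !tXE ipZl ipZr conjR XX.
have NtXX : dilated (tX \o tX) by exact: vn_comp.
have tXp : positive_op (tX \o tX).
  by apply: rip_pos => [|h /=]; [exact: adjoint_comp|rewrite (rip_adj _ _ tXX) ripxx sq_ge0].
have [r [Nr rp r1 r2]] := resolvent_ex vN NtXX tXp.
have [c hc] := expectable_bt NtX tXX r1.
have tXl : linear tX := vn_linear vN NtX.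
have ti0 : t != 0 by rewrite gt_eqF.
have tti : (t^-1)%:C%C * t%:C%C = 1 :> R[i] by rewrite -rmorphM /= mulVf // rmorph1.
have hY : expectable (X \o r) ((t^-1)%:C%C *: c).
  have := expectable_comb (t^-1)%:C%C hc expectable0; rewrite !addr0.
  have -> // : (t^-1)%:C%C *: (tX \o r) = X \o r.
  by apply/funext => h; change ((t^-1)%:C%C *: (t%:C%C *: X (r h)) = X (r h));
    rewrite scalerA tti scale1r.
have rC h : sq (r h) <= sq h by have [] := bt_contr tXl tXX (r1 h).
have close h : sq ((X \o r) h - X h) <= t * (C * C * C * sq h).
  rewrite /= sqC -linearBf //.
  rewrite (_ : h - r h = tX (tX (r h))); last by rewrite -{1}(r1 h) /= addrC addKr.
  apply: le_trans (XC _) _; rewrite tXE sqZr linearZf // sqZr.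
  have := XC (X (r h)); have := XC (r h); have := rC h; clear tk.
  move: (sq_ge0 h) (sq_ge0 (r h)) (sq_ge0 (X (r h))) (sq_ge0 (X (X (r h)))).
  move: (sq h) (sq (r h)) (sq (X (r h))) (sq (X (X (r h)))) => p q u v p0 q0 u0 v0 h1 h2 h3.
  have v1 : v <= C * C * p.
    apply: (le_trans h3); rewrite -mulrA ler_wpM2l //; apply: (le_trans h2).
    by rewrite ler_wpM2l.
  have t3 : t ^+ 2 * (t ^+ 2 * v) <= t * v.
    rewrite mulrA ler_wpM2r // -exprD exprS ger_pMr //.
    by rewrite exprn_ile1 // ltW.
  apply: (@le_trans _ _ (C * (t * v))); first by rewrite ler_wpM2l.
  rewrite mulrCA ler_wpM2l //; first exact: ltW.
  by rewrite -!mulrA ler_wpM2l // mulrA.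
have small h : sq h < sq vac + sq (e 0 b) + 1 -> sq ((X \o r) h - X h) < d.
  move=> hh; apply: le_lt_trans (close h) _; apply: lt_le_trans tk.
  by rewrite ltr_pM2l // /k ltr_pM2l // !mulr_gt0.
exists (X \o r), ((t^-1)%:C%C *: c); split=> //.
- apply: (expectable_bdd Cp hY) => h; apply: le_trans (XC _) _.
  by rewrite ler_wpM2l.
- apply: small; have := sq_ge0 (e 0 b); lra.
- apply: small; have := sq_ge0 vac; lra.
Qed.

Lemma expectable_ex X : dilated X -> exists c, expectable X c.
Proof.
move=> NX; have vN := dilated_vn; have X'X := vn_adjP vN NX; have NX' := vn_adjM vN NX.
(* [X] is half of A + i B, with [A] and [B] self-adjoint. *)
pose A := 1 *: X + adj X; pose B := 'i%C *: (-1 *: X + adj X).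
have NA : dilated A by exact: vn_comb.
have NB : dilated B by apply: vn_scale => //; exact: vn_comb.
have AA : adjoint A A.
  move=> p q; change (ip (1 *: X p + adj X p) q = ip p (1 *: X q + adj X q)).
  by rewrite !scale1r ipDl ipDr X'X (adjointC X'X) addrC.
have BB : adjoint B B.
  move=> p q; change (ip ('i%C *: (-1 *: X p + adj X p)) q = ip p ('i%C *: (-1 *: X q + adj X q))).
  rewrite !scaleN1r ipZl ipZr !ipDl !ipDr ipNl ipNr X'X (adjointC X'X).
  rewrite (_ : Num.conj 'i%C = - 'i%C :> R[i]); last by congr Complex; rewrite oppr0.
  by rewrite mulNr -mulrN opprD opprK addrC.
have [a ha] := expectable_sa NA AA; have [b hb] := expectable_sa NB BB.
have := expectable_comb (2^-1 : R)%:C%C (expectable_comb 'i%C hb ha) (expectable_comb (-1) ha ha).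
set c := (X in expectable _ X) => h; exists c; move: h.
have -> // : (2^-1 : R)%:C%C *: ('i%C *: B + A) + (-1 *: A + A) = X.
apply/funext => x.
change ((2^-1 : R)%:C%C *: ('i%C *: ('i%C *: (-1 *: X x + adj X x)) + (1 *: X x + adj X x)) +
  (-1 *: A x + A x) = X x).
rewrite !scaleN1r addNr addr0 scalerA -expr2 sqr_i scaleN1r scale1r opprD opprK addrACA addNr addr0.
rewrite -{1 2}[X x]scale1r -scalerDl scalerA.
have -> : (2^-1 : R)%:C%C * (1 + 1) = 1 :> R[i].
  by rewrite -(rmorph1 (real_complex R)) -rmorphD -rmorphM /=; congr (_%:C%C); field.
by rewrite scale1r.
Qed.

(** * The automorphism and minimality *)

Definition theta (X : K -> K) : K -> K := shiftU \o (X \o shiftV).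
Definition thetai (X : K -> K) : K -> K := shiftV \o (X \o shiftU).

Lemma shiftUK : cancel shiftU shiftV.
Proof. by move=> x; exact: (congr1 (fun f => f x) shiftVU). Qed.

Lemma shiftVK : cancel shiftV shiftU.
Proof. by move=> x; exact: (congr1 (fun f => f x) shiftUV). Qed.

Lemma thetaK : cancel theta thetai.
Proof. by move=> X; apply/funext => x; rewrite /theta /thetai /= !shiftUK. Qed.

Lemma thetaiK : cancel thetai theta.
Proof. by move=> X; apply/funext => x; rewrite /theta /thetai /= !shiftVK. Qed.

Lemma theta_pi n a : M a -> theta (pi n a) = pi n.+1 a.
Proof. exact: shift_pi. Qed.

Lemma thetai_pi n a : M a -> thetai (pi n a) = pi n (Psi a).
Proof. by move=> Ma; rewrite -(pi_S n Ma) -theta_pi ?thetaK //; exact: (PsM 1). Qed.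

Lemma tower_theta s : tower s -> tower (theta s).
Proof. by move=> [n [a [Ma ->]]]; rewrite theta_pi //; exact: tower_pi. Qed.

Lemma tower_thetai s : tower s -> tower (thetai s).
Proof. by move=> [n [a [Ma ->]]]; rewrite thetai_pi //; apply: tower_pi; exact: (PsM 1). Qed.

Lemma theta_dilated X : dilated X -> dilated (theta X).
Proof.
apply: (commutant_conj shiftV_bounded shiftU_bounded shiftVK shiftUK) => s.
exact: (commutant_conj shiftU_bounded shiftV_bounded shiftUK shiftVK tower_theta).
Qed.

Lemma thetai_dilated X : dilated X -> dilated (thetai X).
Proof.
apply: (commutant_conj shiftU_bounded shiftV_bounded shiftUK shiftVK) => s.
exact: (commutant_conj shiftV_bounded shiftU_bounded shiftVK shiftUK tower_thetai).
Qed.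

Lemma theta_hom : star_homomorphism dilated dilated theta.
Proof.
split.
- exact: theta_dilated.
- move=> c X Y NX NY; apply/funext => x; exact: (bounded_lin shiftU_bounded).
- by move=> X Y NX NY; apply/funext => x; rewrite /theta /= shiftUK.
- by apply/funext => x; rewrite /theta /= shiftVK.
- move=> X Y NX NY XY; rewrite /theta => x y /=.
  by rewrite shift_adj XY -(adjointC shift_adj).
Qed.

Lemma theta_bij : set_bij dilated dilated theta.
Proof.
split; first exact: theta_dilated.
  by move=> X Y _ _ /(can_inj thetaK).
by move=> X NX; exists (thetai X); [exact: thetai_dilated|exact: thetaiK].
Qed.

Lemma theta_positive X : positive_op X -> positive_op (theta X).
Proof. by move=> Xp x; rewrite /theta /= shift_adj. Qed.

Lemma thetai_positive X : positive_op X -> positive_op (thetai X).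
Proof. by move=> Xp x; rewrite /thetai /= (adjointC shift_adj). Qed.

Lemma theta_vac X : ip (theta X vac) vac = ip (X vac) vac.
Proof. by case: shift_vac => U1 V1; rewrite /theta /= shift_adj V1. Qed.

Lemma iter_theta_pi n a : M a -> iter n theta (pi 0 a) = pi n a.
Proof. by move=> Ma; elim: n => //= n ->; rewrite theta_pi. Qed.

(** ['pinv_] is the inverse on [dilated] only, so membership is carried along in the induction. *)
Lemma iter_pinv_theta n X : dilated X ->
  iter n ('pinv_(fun=> idfun) dilated theta) X = iter n thetai X.
Proof.
move=> NX; suff [_ //] : dilated (iter n thetai X) /\
  iter n ('pinv_(fun=> idfun) dilated theta) X = iter n thetai X.
elim: n => //= n [NY ->]; split; first exact: thetai_dilated.
have Ni := thetai_dilated NY.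
rewrite -{1}(thetaiK (iter n thetai X)) pinvKV //; last by rewrite inE.
by case: theta_bij.
Qed.

Lemma iter_thetai_pi n k a : M a -> iter k thetai (pi n a) = pi n (Ps k a).
Proof. by move=> Ma; elim: k => //= k ->; rewrite thetai_pi //; exact: PsM. Qed.

(** Nonnegative powers give all the levels; a negative power sends [pi 0 a] to
    [pi 0 (iter k Psi a)], which adds nothing new. *)
Lemma tower_orbit : \bigcup_(k in [set: int]) [set iterz dilated theta k (pi 0 a) | a in M] = tower.
Proof.
rewrite eqEsubset; split=> [X [[n|n] _ [a Ma <-]]|_ [n [a [Ma ->]]]].
- by rewrite /iterz iter_theta_pi //; exact: tower_pi.
- rewrite /iterz iter_pinv_theta; last exact: pi_dilated.
  by rewrite iter_thetai_pi //; apply: tower_pi; exact: PsM.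
- by exists (Posz n) => //; exists a => //; rewrite /iterz iter_theta_pi.
Qed.

Lemma theta_minimal : minimal_dilation M dilated theta (pi 0).
Proof.
rewrite /minimal_dilation tower_orbit vn_generatedE // => s Ss.
  by exists (adj s); [exact: (salg_adj tower_star)|exact: salg_adjP tower_star _ Ss].
by apply: (salg_bounded tower_star); exact: Ss.
Qed.

(** Testing at level n + m amounts to testing a translate by [thetai] at level m, so facts known at
    level 0 spread to all levels. *)
Lemma iter_thetai_level n m X b x : M b -> M x ->
  ip (iter n thetai X (e m b)) (e m x) = ip (X (e (n + m)%N b)) (e (n + m)%N x).
Proof.
move=> Mb Mx; elim: n m => // n IH m.
by rewrite /= {1}/thetai /= (adjointC shift_adj) !shiftUE // IH addnS addSn.
Qed.

Lemma expectable_adj X Y c : adjoint X Y -> expectable X c -> expectable Y (adj c).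
Proof.
move=> XY [Mc hc]; split=> [|b x Mb Mx]; first exact: Madj.
have [Mcx Mc'] := (MM Mc Mx, Madj Mc).
transitivity (ip (e 0 b) (e 0 (c \o x))).
  by rewrite !eip //; [rewrite (adj_comp vM)|exact: MM].
by rewrite ipC hc // -ipC (adjointC XY).
Qed.

Lemma expectable_modl X a c : M a -> expectable X c -> expectable (pi 0 a \o X) (a \o c).
Proof.
move=> Ma [Mc hc]; split=> [|b x Mb Mx]; first exact: MM.
have [Ma' Mcb] := (Madj Ma, MM Mc Mb); have Ma'x := MM Ma' Mx.
transitivity (ip (e 0 (c \o b)) (e 0 (adj a \o x))).
  rewrite !eip //; last exact: (MM Ma Mcb).
  by rewrite (adj_comp vM) // (adj_adj vM).
by rewrite hc //= (pi_adj 0 Ma) piE.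
Qed.

Lemma expectable_modr X a c : M a -> expectable X c -> expectable (X \o pi 0 a) (c \o a).
Proof.
move=> Ma [Mc hc]; split=> [|b x Mb Mx]; first exact: MM.
by rewrite /= piE // -hc //; exact: MM.
Qed.

Lemma expectable_sum (I : Type) (J : seq I) (X : I -> K -> K) (c : I -> H -> H) :
  (forall i, expectable (X i) (c i)) ->
  expectable (\sum_(i <- J) X i) (\sum_(i <- J) c i).
Proof.
move=> h; elim: J => [|i J IH]; first by rewrite !big_nil; exact: expectable0.
by rewrite !big_cons -[X i]scale1r -[c i]scale1r; exact: expectable_comb.
Qed.

Lemma expectable_id : expectable idfun idfun.
Proof. by have := expectable_pi 0 (vn_id vM); rewrite pi_id. Qed.

(** Positivity on [H] is extracted from a norm bound: if 0 <= X <= C then C - X has norm at most C,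
    hence so does C - c, and |C h - c h| <= C |h| forces <c h, h> >= 0. *)
Lemma expectable_positive X c : dilated X -> positive_op X -> expectable X c -> positive_op c.
Proof.
move=> NX Xp hc; have vN := dilated_vn; have [Mc _] := hc.
have XX := pos_adj (vn_linear vN NX) Xp.
have cc : adjoint c c.
  have {2}-> : c = adj c by exact: expectable_uniq hc (expectable_adj XX hc).
  exact: vn_adjP vM _ Mc.
have [C0 C00 XC0] := bounded_rip (vn_bounded vN NX).
pose C := C0 + 1; have Cp : 0 < C by rewrite ltr_wpDl.
pose Y := C%:C%C *: idfun - X.
have NY : dilated Y by apply: vn_sub => //; apply: vn_scale => //; exact: vn_id.
have YE x : rip (Y x) x = C * sq x - rip (X x) x.
  by change (rip (C%:C%C *: x - X x) x = C * sq x - rip (X x) x); rewrite ripBl ripZl ripxx.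
have YY : adjoint Y Y.
  move=> x y; change (ip (C%:C%C *: x - X x) y = ip x (C%:C%C *: y - X y)).
  by rewrite !ipDl !ipDr ipNl ipNr XX ipZl ipZr conjR.
have Yp : positive_op Y.
  apply: rip_pos => // x; rewrite YE subr_ge0; apply: le_trans (ler_norm _) _.
  by apply: le_trans (XC0 x) _; rewrite ler_wpM2r ?sq_ge0 // lerDl.
have YC x : rip (Y x) x <= C * sq x by rewrite YE gerBl; exact: pos_rip.
have Ybdd : bdd Y (C * C).
  move=> x; apply: le_trans (pos_sq x (vn_linear vN NY) Yp YC) _.
  by rewrite -mulrA ler_wpM2l // ltW.
have hY : expectable Y (C%:C%C *: idfun - c).
  have := expectable_comb C%:C%C expectable_id (expectable_comb (-1) hc expectable0).
  by rewrite !addr0 !scaleN1r.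
have Yc := expectable_bdd (mulr_gt0 Cp Cp) hY Ybdd.
apply: rip_pos => // h; have := Yc h.
change (sq (C%:C%C *: h - c h) <= C * C * sq h -> 0 <= rip (c h) h).
rewrite sqB sqZr ripZl ripC => h1.
by rewrite -(pmulr_rge0 _ Cp); have := sq_ge0 (c h); lra.
Qed.

(** * Faithfulness of the vector state *)

Lemma vac1 : sq vac = 1.
Proof.
have M1 := vn_id vM; rewrite (sq_e (eip 0) M1) adj_id; exact: (rphi_id st).
Qed.

(** The compression of [X] is positive with [phi] equal to <X vac, vac> = 0, hence it is 0 by
    faithfulness of [phi]. *)
Lemma vac_null_level0 X b : dilated X -> positive_op X -> X vac = 0 -> M b ->
  ip (X (e 0 b)) (e 0 b) = 0.
Proof.
move=> NX Xp X0 Mb; have [c hc] := expectable_ex NX; have M1 := vn_id vM.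
have [Mc h] := hc; rewrite -h //.
have c0 : phi c = 0.
  by have := h _ _ M1 M1; rewrite eip ?adj_id // => ->; rewrite -/vac X0 ip0l.
have -> : c = 0.
  by apply: (state_faithful st) => //; exact: expectable_positive NX Xp hc.
by change (ip (e 0 0) (e 0 b) = 0); rewrite e_0 ip0l.
Qed.

(** The shift fixes [vac], so every translate of [X] by [thetai] kills [vac] too; [vac_null_level0]
    for all translates shows that [X] vanishes at all levels. *)
Lemma vac_separating X : dilated X -> positive_op X -> X vac = 0 -> X = 0.
Proof.
move=> NX Xp X0.
have Ni n : dilated (iter n thetai X) /\ positive_op (iter n thetai X).
  by elim: n => //= n [? ?]; split; [exact: thetai_dilated|exact: thetai_positive].
have i0 n : iter n thetai X vac = 0.
  elim: n => //= n IH; rewrite /thetai /= (proj1 shift_vac) IH.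
  exact: (linear0f (bounded_lin shiftV_bounded)).
apply: (dense_eq (levels_dense 0)) => [||_ [n [b [_ Mb ->]]]].
- exact: (vn_bounded dilated_vn).
- exact: bounded_zero.
apply: positive_null => //; first exact: (vn_bounded dilated_vn).
rewrite /rip /rform -[n]addn0 -iter_thetai_level //.
by have [N1 P1] := Ni n; rewrite (vac_null_level0 N1 P1 (i0 n) Mb).
Qed.

Definition vac_state (X : K -> K) : R[i] := ip (X vac) vac.

Lemma vac_stateP : normal_faithful_state dilated vac_state.
Proof. by apply: (vector_state dilated_vn vac1) => X; exact: vac_separating. Qed.

Lemma vac_state_pi a : M a -> vac_state (pi 0 a) = phi a.
Proof.
move=> Ma; have M1 := vn_id vM.
by rewrite /vac_state pi_vac // eip // adj_id.
Qed.

(** * The expectation and the verification of the dilation *)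

Definition expectation (X : K -> K) : H -> H :=
  if pselect (exists c, expectable X c) is left h then projT1 (cid h) else idfun.

Lemma expectationE X c : expectable X c -> expectation X = c.
Proof.
move=> h; rewrite /expectation; case: pselect => [h'|[]]; last by exists c.
exact: expectable_uniq (projT2 (cid h')) h.
Qed.

Lemma expectationP X : dilated X -> expectable X (expectation X).
Proof. by move=> /expectable_ex [c hc]; rewrite (expectationE hc). Qed.

Lemma expectation_vac X : dilated X -> phi (expectation X) = vac_state X.
Proof.
move=> NX; have [Mc h] := expectationP NX; have M1 := vn_id vM.
by rewrite /vac_state -h // eip // adj_id.
Qed.

(** At the vectors b_j h, the bimodule property rewrites the matrix form as <E(X) h, h> for the
    single positive element X, the sum of the i(adj b_i) A_ij i(b_j). *)
Lemma expectation_cp : completely_positive dilated expectation.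
Proof.
move=> n A NA Ap x; under eq_bigr do under eq_bigr do rewrite mxE.
have Ec i j : expectable (A i j) (expectation (A i j)) by exact: expectationP.
have Mc i j : M (expectation (A i j)) by case: (Ec i j).
apply: (positive_of_cyclic (c := fun i j => expectation (A i j)) vM) => // h b Mb.
pose c := \sum_i \sum_j (adj (b i) \o (expectation (A i j) \o b j)).
pose X := \sum_i \sum_j (pi 0 (adj (b i)) \o (A i j \o pi 0 (b j))).
have Xc : expectable X c.
  apply: expectable_sum => i; apply: expectable_sum => j.
  by apply: expectable_modl; [exact: Madj|exact: expectable_modr].
have NX : dilated X.
  have vN := dilated_vn; apply: (vn_sum _ vN) => i; apply: (vn_sum _ vN) => j.
  apply: (vn_comp vN); first by apply: pi_dilated; exact: Madj.
  by apply: (vn_comp vN) => //; exact: pi_dilated.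
have Xp : positive_op X.
  move=> z; rewrite /X fct_sumE ip_suml.
  rewrite (_ : \sum_i _ = \sum_i \sum_j ip (A i j (pi 0 (b j) z)) (pi 0 (b i) z)); first exact: Ap.
  apply: eq_bigr => i _; rewrite fct_sumE ip_suml; apply: eq_bigr => j _ /=.
  by rewrite (adjointC (pi_adj 0 (Mb i))).
have := expectable_positive NX Xp Xc h; rewrite /c fct_sumE ip_suml.
rewrite (_ : \sum_i _ = \sum_i \sum_j ip (expectation (A i j) (b j h)) (b i h)) //.
apply: eq_bigr => i _; rewrite fct_sumE ip_suml; apply: eq_bigr => j _ /=.
by rewrite (adjointC (vn_adjP vM (Mb i))).
Qed.

Lemma expectation_ucp : ucp_map dilated M expectation.
Proof.
split.
- by move=> X /expectationP [].
- move=> c X Y NX NY; apply: expectationE.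
  by apply: expectable_comb; exact: expectationP.
- exact: expectationE expectable_id.
- exact: expectation_cp.
Qed.

Lemma pi0_hom : star_homomorphism M dilated (pi 0).
Proof.
split.
- by move=> a Ma; exact: pi_dilated.
- by move=> c a b Ma Mb; exact: pi_comb.
- by move=> a b Ma Mb; exact: pi_mul.
- exact: pi_id.
- by move=> a b Ma Mb ab; rewrite -(adjE ab); exact: pi_adj.
Qed.

(** On [e n b] the form is [phi] of adj b Psi^n(a) b, and [Psi] preserves positivity. *)
Lemma pi0_positive a : M a -> positive_op a -> positive_op (pi 0 a).
Proof.
move=> Ma ap x; apply: (ip_ge0_adh (pi_bounded 0 Ma) (levels_dense 0 x)).
move=> _ [n [b [_ Mb ->]]]; have Mn := PsM n Ma.
rewrite piE // eip //; last exact: MM.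
apply: (state_positive st); first by apply: MM; [exact: Madj|exact: MM].
have Pp : positive_op (Ps n a).
  by elim: n {Mn} => //= n IH; apply: (ucp_pos uPsi) => //; exact: PsM.
by move=> h /=; rewrite (adjointC (vn_adjP vM Mb)).
Qed.

Lemma theta_ucp : ucp_map dilated dilated theta.
Proof.
have [tN tL _ t1 _] := theta_hom; split=> // n A _ Ap x.
rewrite (_ : \sum_i _ = \sum_i \sum_j ip (A i j (shiftV (x j))) (shiftV (x i))); first exact: Ap.
by apply: eq_bigr => i _; apply: eq_bigr => j _; rewrite mxE /theta /= shift_adj.
Qed.

Lemma dilation : normal_map M M Phi ->
  reversible_dilation M Phi phi dilated theta vac_state expectation (pi 0).
Proof.
move=> nPhi; have vN := dilated_vn; have sN := vac_stateP.
have tL : linear_on dilated theta by exact: hom_linear theta_hom.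
split.
- split=> //; [exact: theta_ucp|apply: (normal_of_state vN vN sN sN) => //|].
  + exact: theta_dilated.
  + by move=> X _; exact: theta_positive.
  + by move=> X NX; exact: (hom_star theta_hom).
  + by move=> X _; exact: theta_vac.
  + by move=> X _; exact: theta_vac.
- by split; [exact: theta_hom|exact: theta_bij].
- exact: expectation_ucp.
- apply: (normal_of_state vN vM sN st) => //.
  + exact: ucp_fun expectation_ucp.
  + exact: ucp_linear expectation_ucp.
  + by move=> X NX Xp; exact: expectable_positive NX Xp (expectationP NX).
  + move=> X NX XX; have h := expectationP NX.
    have E : expectation X = adj (expectation X) by exact: expectable_uniq h (expectable_adj XX h).
    by rewrite {2}E; apply: (vn_adjP vM); case: h.
  + exact: expectation_vac.
- exact: pi0_hom.
- apply: (normal_of_state vM vN st sN) => //.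
  + exact: hom_fun pi0_hom.
  + exact: hom_linear pi0_hom.
  + exact: pi0_positive.
  + by move=> a Ma; exact: (hom_star pi0_hom).
  + exact: vac_state_pi.
- move=> a b; rewrite !inE => Ma Mb ab; apply/eqP; rewrite -subr_eq0; apply/eqP/e_inj.
    exact: vn_sub.
  by rewrite (eB (eL 0)) // -!pi_vac // ab subrr sq0.
- by move=> a X Ma NX; apply: expectationE; apply: expectable_modl => //; exact: expectationP.
- by move=> a n Ma; rewrite iter_theta_pi //; apply/expectationE/expectable_pi.
- by move=> X NX; rewrite expectation_vac.
Qed.

End Dilation.

Theorem corollary1 (R : realType) (H : hilbertType R) (M : set (H -> H))
    (Phi : (H -> H) -> (H -> H)) (phi : (H -> H) -> R[i])
    (hsys : w_star_system M Phi phi)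
    (hPsi : exists Psi : (H -> H) -> (H -> H),
      ucp_map M M Psi /\ (forall a, M a -> Phi (Psi a) = a)) :
  admits_minimal_reversible_dilation M Phi phi.
Proof.
case: hsys => vM uPhi nPhi st phiPhi; have [Psi [uPsi PhiPsi]] := hPsi.
have [K [e [eL eS eip edense]]] := limit_gns vM st uPhi uPsi phiPhi PhiPsi.
exists K, (dilated vM st uPhi uPsi phiPhi PhiPsi eL eS eip edense).
exists (theta vM st uPhi uPsi phiPhi PhiPsi eL eS eip edense), (vac_state (e := e)).
exists (expectation (M := M) (e := e)), (pi vM st uPhi uPsi phiPhi PhiPsi eL eS eip edense 0).
split; first exact: dilation.
exact: theta_minimal.
Qed.
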